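(* Let $n\ge1$. For any pair of $n$-dimensional hyperbolic polytopes $P,Q\subseteq H^n$, if $\mathrm{vol}(P)<\mathrm{vol}(Q)$ then there exists a scissors embedding of $P$ into $Q$. The same holds in $n$-dimensional spherical geometry: for any pair of $n$-dimensional spherical polytopes $P,Q\subseteq S^n$, if $\mathrm{vol}(P)<\mathrm{vol}(Q)$ then there exists a scissors embedding of $P$ into $Q$.
   Context: $H^n=\{(x_0,\dots,x_n)\in\mathbb R^{n+1}\mid -x_0^2+\sum_{i=1}^nx_i^2=-1,\ x_0>0\}$ and $S^n=\{(x_0,\dots,x_n)\in\mathbb R^{n+1}\mid\sum_{i=0}^nx_i^2=1\}$. Let $X^n$ be either of these. $I(X^n)\le GL_{n+1}(\mathbb R)$ is the isometry group: for $H^n$, the linear maps preserving $-x_0^2+\sum_{i\ge1}x_i^2$ and the sign of $x_0$; for $S^n$, the group $O(n+1)$. A geometric $n$-simplex in $X^n$ is obtained by taking the convex hull of $n+1$ points of $X^n$ in general position (as points of $\mathbb R^{n+1}$) and projecting it to $X^n$ from the origin (in the spherical case the convex hull must not contain the origin). An $n$-polytope is a subset of $X^n$ that is a finite union of geometric $n$-simplices. $\mathrm{vol}$ is the usual hyperbolic (resp. spherical) volume. A scissors embedding $P\hookrightarrow Q$ is given by (an equivalence class, under passing to refinements, of) a finite set of $n$-polytopes $P_i\subseteq P$ with union $P$ and pairwise disjoint interiors, together with isometries $g_i\in I(X^n)$, such that the polytopes $g_iP_i$ are contained in $Q$ and have pairwise disjoint interiors. *)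

(* Defs.v *)
From HB Require Import structures.
From mathcomp Require Import all_boot all_order all_algebra.
From mathcomp Require Import all_classical all_reals all_analysis.
Import Order.TTheory GRing.Theory Num.Theory.
Import numFieldNormedType.Exports.

Set Implicit Arguments.
Unset Strict Implicit.
Unset Printing Implicit Defensive.

Local Open Scope classical_set_scope.
Local Open Scope ring_scope.

(** The [n]-fold product of a sigma-finite measure, built by pushing
    [m \x tuple_power n] forward along [(x, y) |-> x :: y]. *)
Section tuple_power.
Context d (T : measurableType d) (R : realType).
Variable m : {sigma_finite_measure set T -> \bar R}.

Definition tcons n (p : T * n.-tuple T) : n.+1.-tuple T := [tuple of p.1 :: p.2].

Lemma measurable_tcons n : measurable_fun [set: T * n.-tuple T] (@tcons n).
Proof. exact: (measurable_cons measurable_fst measurable_snd). Qed.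

Section step.
Variables (n : nat) (mu : {sigma_finite_measure set (n.-tuple T) -> \bar R}).

Definition tuple_power_step : set (n.+1.-tuple T) -> \bar R :=
  pushforward (m \x mu)%E (@tcons n).

Let step0 : tuple_power_step set0 = 0%E.
Proof. by rewrite /tuple_power_step /pushforward preimage_set0 measure0. Qed.

Let step_ge0 A : (0 <= tuple_power_step A)%E.
Proof. by rewrite /tuple_power_step /pushforward measure_ge0. Qed.

Let step_sigma_additive : semi_sigma_additive tuple_power_step.
Proof.
move=> F mF tF mUF; rewrite /tuple_power_step /pushforward preimage_bigcup.
apply: measure_semi_sigma_additive.
- by move=> k; rewrite -[X in measurable X]setTI; exact: measurable_tcons.
- apply/trivIsetP => /= i j _ _ ij; rewrite -preimage_setI.
  by move/trivIsetP : tF => /(_ _ _ _ _ ij) ->//; rewrite preimage_set0.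
- by rewrite -preimage_bigcup -[X in measurable X]setTI; exact: measurable_tcons.
Qed.

HB.instance Definition _ := isMeasure.Build _ _ _ tuple_power_step
  step0 step_ge0 step_sigma_additive.

Let step_sigma_finite : sigma_finite setT tuple_power_step.
Proof.
have /sigma_finiteP[F [TF ndF Foo]] := sigma_finiteT m.
have /sigma_finiteP[G [TG ndG Goo]] := sigma_finiteT mu.
pose u (z : n.+1.-tuple T) := (tnth z ord0, [tuple of behead z]).
have mu_ : measurable_fun setT u.
  apply: measurable_fun_pair; first exact: measurable_tnth.
  exact: measurable_behead.
exists (fun k => u @^-1` (F k `*` G k)).
  apply/seteqP; split=> // z _.
  have [i _ Fi] : (\bigcup_k F k) (u z).1 by rewrite -TF.
  have [j _ Gj] : (\bigcup_k G k) (u z).2 by rewrite -TG.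
  exists (maxn i j) => //; split.
    by move: Fi; exact/subsetPset/ndF/leq_maxl.
  by move: Gj; exact/subsetPset/ndG/leq_maxr.
move=> k; have [mFk Fkoo] := Foo k; have [mGk Gkoo] := Goo k; split.
  by rewrite -[X in measurable X]setTI; apply: mu_ => //; exact: measurableX.
rewrite /tuple_power_step /pushforward -comp_preimage.
have -> : u \o @tcons n = id.
  by apply/funext => -[x y]; congr pair; apply: val_inj.
by rewrite preimage_id product_measure1E// lte_mul_pinfty// ge0_fin_numE.
Qed.

HB.instance Definition _ := Measure_isSigmaFinite.Build _ _ _ tuple_power_step
  step_sigma_finite.

End step.

Fixpoint tuple_power n : {sigma_finite_measure set (n.-tuple T) -> \bar R} :=
  match n with
  | 0 => \d_([tuple] : 0.-tuple T)
  | n.+1 => tuple_power_step (tuple_power n)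
  end.

End tuple_power.

Variant geometry := Hyperbolic | Spherical.

Section geometry.
Context {R : realType} (X : geometry).

Definition lebesgue_tuple n :
    {sigma_finite_measure set (n.-tuple (measurableTypeR R)) -> \bar R} :=
  tuple_power lebesgue_measure n.

Definition curvature : R := if X is Hyperbolic then -1 else 1.

(** [curvature * x_0 y_0 + x_1 y_1 + ... + x_n y_n] *)
Definition bform n (x y : 'cV[R]_n.+1) : R :=
  curvature * (x 0 0 * y 0 0) +
  \sum_(i < n) x (lift ord0 i) 0 * y (lift ord0 i) 0.

Definition qform n (x : 'cV[R]_n.+1) : R := bform x x.

Definition model_space n : set 'cV[R]_n.+1 :=
  match X with
  | Hyperbolic => [set x | qform x = -1 /\ 0 < x 0 0]
  | Spherical => [set x | qform x = 1]
  end.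

(** Lorentz boosts preserve the hyperboloid sheet but change the sign of [x_0]
    on some vectors with [qform x > 0], so preserving the sign of [x_0] is a
    condition on vectors with [qform x < 0] only. *)
Definition is_isometry n (g : 'M[R]_n.+1) : Prop :=
  g \in unitmx /\
  match X with
  | Hyperbolic =>
      (forall x : 'cV_n.+1, qform (g *m x) = qform x) /\
      (forall x : 'cV_n.+1, qform x < 0 -> (0 < (g *m x) 0 0) = (0 < x 0 0))
  | Spherical => g^T *m g = 1%:M
  end.

Definition convex_hull n k (v : 'I_k -> 'cV[R]_n) : set 'cV[R]_n :=
  [set x | exists a : 'I_k -> R,
    [/\ forall i, 0 <= a i, \sum_i a i = 1 & x = \sum_i a i *: v i]].

(** Central projection: for [X = Hyperbolic] and [qform x < 0], [x_0 > 0], and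
    for [X = Spherical] and [x != 0], this is the point of [model_space n] on
    the ray from the origin through [x]. *)
Definition radial n (x : 'cV[R]_n.+1) : 'cV[R]_n.+1 :=
  (Num.sqrt `|qform x|)^-1 *: x.

(** General position of [n.+1] points of [R^(n+1)] is linear independence: the
    points lie on no common hyperplane of [model_space n], so that the simplex
    is [n]-dimensional. The condition on the origin is then automatic. *)
Definition simplex n (S : set 'cV[R]_n.+1) : Prop :=
  exists v : 'I_n.+1 -> 'cV[R]_n.+1,
    [/\ forall i, model_space (v i),
        row_free (\matrix_i (v i)^T),
        X = Spherical -> ~ convex_hull v 0 &
        S = @radial n @` convex_hull v].

Definition polytope n (P : set 'cV[R]_n.+1) : Prop :=
  exists (k : nat) (S : 'I_k -> set 'cV[R]_n.+1),
    (forall i, simplex (S i)) /\ P = \bigcup_i S i.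

(** The Riemannian volume. The graph charts [y |-> (+- height y, y)], one for
    the hyperboloid and two (covering all but the equator) for the sphere, have
    coordinate vector fields [tangent]; [bform] restricts to the Riemannian
    metric, whose Gram matrix in the chart is [metric]. *)
Definition column n (y : n.-tuple R) : 'cV[R]_n := \col_i tnth y i.

Definition radicand n (y : n.-tuple R) : R :=
  1 - curvature * \sum_i tnth y i ^+ 2.

Definition height n (y : n.-tuple R) : R := Num.sqrt (radicand y).

Definition chart n (s : bool) (y : n.-tuple R) : 'cV[R]_n.+1 :=
  col_mx ((-1) ^+ s * height y)%:M (column y).

Definition tangent n (s : bool) (y : n.-tuple R) (i : 'I_n) : 'cV[R]_n.+1 :=
  @col_mx _ 1 n 1 ((-1) ^+ s * (- curvature * tnth y i / height y))%:M
    (delta_mx i 0).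

Definition metric n (s : bool) (y : n.-tuple R) : 'M[R]_n :=
  \matrix_(i, j) bform (tangent s y i) (tangent s y j).

Definition sheet_vol n (s : bool) (A : set 'cV[R]_n.+1) : \bar R :=
  \int[@lebesgue_tuple n]_(y in [set y | 0 < radicand y /\ A (chart s y)])
    (Num.sqrt (\det (metric s y)))%:E.

Definition vol n (A : set 'cV[R]_n.+1) : \bar R :=
  match X with
  | Hyperbolic => sheet_vol false A
  | Spherical => (sheet_vol false A + sheet_vol true A)%E
  end.

(** Interior relative to [model_space n]. *)
Definition rel_interior n (A : set 'cV[R]_n.+1) : set 'cV[R]_n.+1 :=
  @interior (subspace (@model_space n)) A.

Definition scissors_embeds n (P Q : set 'cV[R]_n.+1) : Prop :=
  exists (k : nat) (p : 'I_k -> set 'cV[R]_n.+1) (g : 'I_k -> 'M[R]_n.+1),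
    [/\ forall i, polytope (p i),
        P = \bigcup_i p i &
        trivIset setT (fun i => rel_interior (p i))] /\
    [/\ forall i, is_isometry (g i),
        forall i, mulmx (g i) @` p i `<=` Q &
        trivIset setT (fun i => rel_interior (mulmx (g i) @` p i))].

End geometry.

(* Main.v *)
From HB Require Import structures.
Require Import Defs.
From mathcomp Require Import all_boot all_order fingroup perm all_algebra.
From mathcomp Require Import all_classical all_reals all_analysis.
From mathcomp Require Import measurable_realfun ring lra zify.
Import Order.TTheory GRing.Theory Num.Theory.
Import numFieldNormedType.Exports.

Set Implicit Arguments.
Unset Strict Implicit.
Unset Printing Implicit Defensive.

Local Open Scope classical_set_scope.
Local Open Scope ring_scope.

(** Both [P] and [Q] are compared with isometric copies of one tiny cube [tiny e],
    the projection to the model space of a cube of side [2 e]. If [P] is covered by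
    [N] copies of it and [Q] contains [N] pairwise disjoint copies, then cutting [P]
    along the facets of the covering copies gives pieces that can be moved, copy by
    copy, into those in [Q]: this is [scissors_of_covering]. Overlaps of the copies
    that cover [P] do no harm, since each piece is moved only once. So it suffices
    that, for some [c] strictly between the volumes and all small [e], [P] can be
    covered by at most [c / (2 e)^n] copies ([coverable]) and [Q] contains at least
    that many disjoint ones ([packable]); see [scissors_of_counts].

    Such counts come from the graph chart [pt], in which the volume has the density
    [1 / height]. Over every point [u] of the chart there is an isometry [frame X u]
    that carries the base point to [pt u] and depends continuously on [u]. The frame
    coordinates of [pt z] are a linear function of [z - u] whose matrix tends to
    [dslope X u0] when [u] and [z] tend to [u0] ([slopeP]), and the latter is
    triangular with determinant [1 / height] ([det_dslope]). Hence, near [u0],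
    copies of [tiny e] are up to a factor close to 1 translates of one
    parallelepiped of Lebesgue measure [(2 e)^n * height] ([tiny_approx],
    [lebesgue_parallelepiped]), and the lattice of such parallelepipeds shows that
    small boxes are covered and packed with efficiency close to 1 ([local_box]). By
    compactness this holds for all sufficiently small boxes that meet a compact part
    of the chart ([uniform_fine_box]), and approximating by unions of boxes of a
    grid extends it to coverings of compact sets ([coverable_closed]) and packings
    of bounded open sets ([packable_open]).

    A simplex is the part of the model space in a simplicial cone ([radial_hull]),
    so that polytopes are finite unions of polyhedra. The facets are null
    ([density_chart_zero]), so [Q] may be replaced by its interior. A hyperbolic
    polytope is bounded and lies in a compact part of the chart. On the sphere there
    are two hemispheres, exchanged by a reflection, and a band around the equator
    where the chart degenerates; exchanging coordinates carries the band to thin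
    slabs well inside the chart, so that it can be covered at arbitrarily small cost
    ([equator_coverable]). *)

(** * Bilinear form and isometries *)

Section form.
Context {R : realType} (X : geometry).
Implicit Types n : nat.

Lemma curvatureK : curvature X * curvature X = 1 :> R.
Proof. by rewrite /curvature; case: X; lra. Qed.

Definition signature_mx n : 'M[R]_n.+1 :=
  diag_mx (\row_i (if i == ord0 then curvature X else 1)).

Lemma bformE n (x y : 'cV[R]_n.+1) :
  bform X x y = (x^T *m signature_mx n *m y) 0 0.
Proof.
rewrite /bform !mxE big_ord_recl; congr (_ + _).
  by rewrite /signature_mx mul_mx_diag !mxE eqxx; ring.
apply: eq_bigr => i _.
by rewrite /signature_mx mul_mx_diag !mxE /= mulr1.
Qed.

Lemma bformC n (x y : 'cV[R]_n.+1) : bform X x y = bform X y x.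
Proof.
rewrite /bform (mulrC (x 0 0)); congr (_ + _).
by apply: eq_bigr => i _; rewrite mulrC.
Qed.

Lemma bformDl n (x y z : 'cV[R]_n.+1) :
  bform X (x + y) z = bform X x z + bform X y z.
Proof. by rewrite !bformE linearD /= !mulmxDl mxE. Qed.

Lemma bformZl n a (x z : 'cV[R]_n.+1) : bform X (a *: x) z = a * bform X x z.
Proof. by rewrite !bformE linearZ /= -!scalemxAl mxE. Qed.

Lemma bformDr n (x y z : 'cV[R]_n.+1) :
  bform X z (x + y) = bform X z x + bform X z y.
Proof. by rewrite !(bformC z) bformDl. Qed.

Lemma bformZr n a (x z : 'cV[R]_n.+1) : bform X z (a *: x) = a * bform X z x.
Proof. by rewrite !(bformC z) bformZl. Qed.

Lemma bform_suml n (I : finType) (F : I -> 'cV[R]_n.+1) z :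
  bform X (\sum_i F i) z = \sum_i bform X (F i) z.
Proof.
rewrite bformE [(\sum_i F i)^T]linear_sum /= !mulmx_suml summxE.
by apply: eq_bigr => i _; rewrite bformE.
Qed.

Lemma bform_sumr n (I : finType) (F : I -> 'cV[R]_n.+1) z :
  bform X z (\sum_i F i) = \sum_i bform X z (F i).
Proof. by rewrite bformC bform_suml; apply: eq_bigr => i _; rewrite bformC. Qed.

Lemma qformZ n a (x : 'cV[R]_n.+1) : qform X (a *: x) = a ^+ 2 * qform X x.
Proof. by rewrite /qform bformZl bformZr mulrA expr2. Qed.

Lemma qformE n (x : 'cV[R]_n.+1) :
  qform X x = curvature X * x 0 0 ^+ 2 + \sum_(i < n) x (lift ord0 i) 0 ^+ 2.
Proof.
by rewrite /qform /bform expr2; congr (_ + _); apply: eq_bigr=> i _; rewrite expr2.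
Qed.

Lemma model_qform n (x : 'cV[R]_n.+1) :
  model_space X x -> qform X x = curvature X.
Proof. by rewrite /model_space /curvature; case: X => //= -[]. Qed.

End form.

Section hyperbolic.
Context {R : realType} (n : nat).
Implicit Types x y : 'cV[R]_n.+1.
Local Notation bf := (bform Hyperbolic).
Local Notation qf := (qform Hyperbolic).

Lemma sum_sq_ge0 m (f : 'I_m -> R) : 0 <= \sum_i f i ^+ 2.
Proof. by apply: sumr_ge0 => i _; exact: sqr_ge0. Qed.

Lemma cauchy_schwarz_sum m (f g : 'I_m -> R) :
  (\sum_i f i * g i) ^+ 2 <= (\sum_i f i ^+ 2) * (\sum_i g i ^+ 2).
Proof.
set a := \sum_i f i ^+ 2; set b := \sum_i g i ^+ 2; set c := \sum_i f i * g i.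
have a0 : 0 <= a by exact: sum_sq_ge0.
have H t : 0 <= a * t ^+ 2 + 2 * c * t + b.
  suff -> : a * t ^+ 2 + 2 * c * t + b = \sum_i (t * f i + g i) ^+ 2.
    exact: sum_sq_ge0.
  rewrite /a /b /c mulr_sumr !mulr_suml -!big_split /=.
  by apply: eq_bigr => i _; ring.
have [a_eq0|an0] := eqVneq a 0.
  have f0 i : f i = 0.
    apply/eqP; rewrite -sqrf_eq0; apply/eqP.
    have : a == 0 by rewrite a_eq0.
    rewrite psumr_eq0; last by move=> j _; exact: sqr_ge0.
    by move=> /allP/(_ i); rewrite mem_index_enum => /(_ isT)/eqP.
  by rewrite /c big1 ?expr0n ?a_eq0 ?mul0r// => i _; rewrite f0 mul0r.
have ap : 0 < a by rewrite lt_def an0.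
have := H (- (c / a)).
have -> : a * (- (c / a)) ^+ 2 + 2 * c * - (c / a) + b = (a * b - c ^+ 2) / a.
  by field.
by rewrite pmulr_lge0 ?invr_gt0// subr_ge0.
Qed.

(** Reversed Cauchy-Schwarz inequality in the forward light cone. *)
Lemma timelike_bform_lt0 x y :
  qf x < 0 -> qf y < 0 -> 0 < x 0 0 -> 0 < y 0 0 -> bf x y < 0.
Proof.
rewrite !qformE /= => qx qy x0 y0; rewrite /bform /=.
have := cauchy_schwarz_sum (fun i => x (lift ord0 i) 0) (fun i => y (lift ord0 i) 0).
move: qx qy; set a := \sum_i _; set b := \sum_i _; set c := \sum_i _ => qx qy cab.
have a0 : 0 <= a by exact: sum_sq_ge0.
have b0 : 0 <= b by exact: sum_sq_ge0.
have : c ^+ 2 < (x 0 0 * y 0 0) ^+ 2.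
  apply: le_lt_trans cab _; rewrite exprMn.
  have h : a < x 0 0 ^+ 2 by lra.
  have h' : b < y 0 0 ^+ 2 by lra.
  by apply: ltr_pM.
rewrite -subr_gt0 subr_sqr; have xy : 0 < x 0 0 * y 0 0 by exact: mulr_gt0.
rewrite mulN1r => h; suff : c < x 0 0 * y 0 0 by move=> ?; lra.
have [c0|c0] := leP c 0; first by lra.
by move: h; rewrite pmulr_lgt0 ?subr_gt0//; lra.
Qed.

Lemma model_bform_leN1 x y :
  model_space Hyperbolic x -> model_space Hyperbolic y -> bf x y <= -1.
Proof.
move=> [qx x0] [qy y0]; move: qx qy; rewrite !qformE /= => qx qy; rewrite /bform /=.
have := cauchy_schwarz_sum (fun i => x (lift ord0 i) 0) (fun i => y (lift ord0 i) 0).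
move: qx qy; set a := \sum_i _; set b := \sum_i _; set c := \sum_i _ => qx qy cab.
have a0 : 0 <= a by exact: sum_sq_ge0.
have b0 : 0 <= b by exact: sum_sq_ge0.
rewrite mulN1r.
move: (x 0 0) (y 0 0) x0 y0 qx qy => p q p0 q0 qx qy.
have ea : a = p ^+ 2 - 1 by lra.
have eb : b = q ^+ 2 - 1 by lra.
have p1 : 1 <= p by nra.
have q1 : 1 <= q by nra.
have pq : 1 <= p * q by nra.
suff : c <= p * q - 1 by lra.
have [c0|c0] := leP c 0; first by lra.
have : c ^+ 2 <= (p * q - 1) ^+ 2.
  apply: le_trans cab _; rewrite ea eb.
  have := sqr_ge0 (p - q); nra.
by rewrite ler_pXn2r ?nnegrE//; lra.
Qed.

End hyperbolic.

Section isometry.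
Context {R : realType} (X : geometry) (n : nat).
Implicit Types (x : 'cV[R]_n.+1) (g h : 'M[R]_n.+1).

Lemma qform_spherical x : qform Spherical x = (x^T *m x) 0 0.
Proof.
rewrite qformE /= mul1r !mxE big_ord_recl !mxE expr2; congr (_ + _).
by apply: eq_bigr => i _; rewrite !mxE expr2.
Qed.

Lemma isometry_unit g : is_isometry X g -> g \in unitmx.
Proof. by case. Qed.

Lemma isometry_qform g x : is_isometry X g -> qform X (g *m x) = qform X x.
Proof.
case; case: X => _; first by case=> ->.
move=> gg; rewrite !qform_spherical trmx_mul -mulmxA (mulmxA g^T) gg.
by rewrite mul1mx.
Qed.

Lemma isometry_model g x :
  is_isometry X g -> model_space X x -> model_space X (g *m x).
Proof.
move=> ig; rewrite /model_space.
have := isometry_qform x ig; case: X ig => /=; last by move=> _ ->.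
move=> [_ [_ gs]] -> [qx x0]; split=> //; rewrite gs// qx; lra.
Qed.

Lemma isometry1 : is_isometry X (1%:M : 'M[R]_n.+1).
Proof.
split; first exact: unitmx1.
case: X; last by rewrite trmx1 mulmx1.
by split=> x; rewrite mul1mx.
Qed.

Lemma isometryM g h :
  is_isometry X g -> is_isometry X h -> is_isometry X (g *m h).
Proof.
move=> [gu ig] [hu ih]; split; first by rewrite unitmx_mul gu hu.
case: X ig ih => [[gq gs] [hq hs]|gg hh].
  split=> x; rewrite -mulmxA; first by rewrite gq hq.
  by move=> x0; rewrite gs ?hs// hq.
by rewrite trmx_mul -mulmxA (mulmxA g^T) gg mul1mx.
Qed.

Lemma isometryV g : is_isometry X g -> is_isometry X (invmx g).
Proof.
move=> [gu ig]; split; first by rewrite unitmx_inv.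
case: X ig => [[gq gs]|gg].
  split=> x.
    by rewrite -[in RHS](mulKVmx gu x) gq.
  by move=> x0; rewrite -{2}(mulKVmx gu x) gs// -gq mulKVmx.
have -> : invmx g = g^T by rewrite -[LHS]mul1mx -gg mulmxK.
by rewrite trmxK; exact: mulmx1C.
Qed.

(** By [timelike_bform_lt0] the sign of the head of a timelike vector can be read off
    its product with one fixed forward timelike vector, so a form-preserving map
    that sends one such vector forward sends them all forward. *)
Lemma isometry_orthonormal g :
    (forall x y, bform X (g *m x) (g *m y) = bform X x y) ->
    (X = Hyperbolic -> 0 < g 0 0) -> is_isometry X g.
Proof.
move=> gb g00.
have gJ : g^T *m signature_mx X n *m g = signature_mx X n.
  apply/matrixP => i j.
  have E (A : 'M[R]_n.+1) : A i j = ((delta_mx i 0 : 'cV[R]_n.+1)^T *m A *m (delta_mx j 0 : 'cV[R]_n.+1)) 0 0.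
    by rewrite trmx_delta -rowE -colE !mxE.
  rewrite [LHS]E [RHS]E -bformE -gb bformE trmx_mul.
  by rewrite !mulmxA.
have JJ : signature_mx X n *m signature_mx X n = 1%:M :> 'M[R]_n.+1.
  apply/matrixP => i j; rewrite /signature_mx mul_mx_diag !mxE.
  case: (i =P j) => [->|]; rewrite ?mulr0n ?mul0r// !mulr1n.
  by case: eqP => _; rewrite ?mulr1// curvatureK.
have gu : g \in unitmx.
  have : (signature_mx X n *m g^T *m signature_mx X n) *m g = 1%:M.
    by rewrite -!mulmxA (mulmxA g^T) gJ JJ.
  by move=> /mulmx1_unit[].
split=> //.
case: X gb g00 gJ JJ => gb g00 gJ JJ.
  have gq x : qform Hyperbolic (g *m x) = qform Hyperbolic x by rewrite /qform gb.
  split=> // x qx.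
  have qe : qform Hyperbolic (delta_mx 0 0 : 'cV[R]_n.+1) = -1.
    rewrite qformE /= !mxE eqxx expr1n mulr1 big1 ?addr0// => i _.
    by rewrite !mxE /= expr0n.
  have fwd y : qform Hyperbolic y < 0 -> 0 < y 0 0 -> 0 < (g *m y) 0 0.
    move=> qy y0; rewrite ltNge; apply/negP => le0.
    have lt0 : (g *m y) 0 0 < 0.
      rewrite lt_neqAle le0 andbT; apply/eqP => e0.
      have := gq y; rewrite qformE e0 expr0n /= mulr0 add0r => qgy.
      by move: qy; rewrite -qgy ltNge sum_sq_ge0.
    have a := @timelike_bform_lt0 R n (delta_mx 0 0) y.
    have b := @timelike_bform_lt0 R n (g *m delta_mx 0 0) (- (g *m y)).
    have qe' : qform Hyperbolic (g *m (delta_mx 0 0 : 'cV[R]_n.+1)) = -1.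
      by rewrite gq.
    have : bform Hyperbolic (delta_mx 0 0) y < 0.
      by apply: a => //; rewrite ?qe ?mxE ?eqxx ?ltr01//; lra.
    have : bform Hyperbolic (g *m delta_mx 0 0) (- (g *m y)) < 0.
      apply: b.
      - by rewrite qe'; lra.
      - by rewrite -scaleN1r qformZ gq sqrrN expr1n mul1r.
      - by rewrite -colE mxE g00.
      - by rewrite mxE oppr_gt0.
    by rewrite -scaleN1r bformZr gb; lra.
  have x0n0 : x 0 0 != 0.
    apply/eqP => e0; move: qx; rewrite qformE e0 expr0n /= mulr0 add0r.
    by rewrite ltNge sum_sq_ge0.
  have [x0|x0] := ltP 0 (x 0 0); first by rewrite fwd.
  have : 0 < (g *m - x) 0 0.
    apply: fwd; first by rewrite -scaleN1r qformZ sqrrN expr1n mul1r.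
    by rewrite mxE oppr_gt0 lt_neqAle x0n0 x0.
  by rewrite mulmxN mxE oppr_gt0 => h; apply/negbTE; rewrite -leNgt ltW.
have J1 : signature_mx Spherical n = 1%:M :> 'M[R]_n.+1.
  by rewrite /signature_mx -diag_const_mx; congr diag_mx; apply/rowP => i;
    rewrite !mxE if_same.
by move: gJ; rewrite J1 mulmx1.
Qed.

End isometry.

(** * Simplices as cones, and their subdivision *)

Section simplices.
Context {R : realType} (X : geometry) (n : nat).
Implicit Types (x w : 'cV[R]_n.+1) (V W : 'M[R]_n.+1) (l : 'rV[R]_n.+1).

Definition cone V : set 'cV[R]_n.+1 :=
  [set x | exists2 a : 'cV[R]_n.+1, (forall i, 0 <= a i 0) & x = V *m a].

Definition spanned V : set 'cV[R]_n.+1 := @model_space R X n `&` cone V.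

Definition nondeg V := V \in unitmx /\ forall j, model_space X (col j V).

Lemma mulmx_col_sum V (a : 'cV[R]_n.+1) : V *m a = \sum_i a i 0 *: col i V.
Proof.
apply/colP => k; rewrite !mxE summxE; apply: eq_bigr => i _.
by rewrite !mxE mulrC.
Qed.

Lemma model_neq0 x : model_space X x -> x != 0.
Proof.
move=> /model_qform; apply: contra_eq_neq => ->.
rewrite -(scale0r 0) qformZ expr0n mul0r eq_sym.
by rewrite /curvature; case: X; rewrite ?oppr_eq0 oner_eq0.
Qed.

Lemma model_norm x : model_space X x -> `|qform X x| = 1.
Proof.
by move=> /model_qform ->; rewrite /curvature; case: X; rewrite ?normrN normr1.
Qed.

Lemma radial_scale c x : 0 < c -> model_space X x -> radial X (c *: x) = x.
Proof.
move=> c0 mx; rewrite /radial qformZ normrM model_norm// mulr1 ger0_norm ?sqr_ge0//.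
by rewrite sqrtr_sqr gtr0_norm// scalerA mulVf ?gt_eqF// scale1r.
Qed.

(** In the hyperbolic case the vertices have pairwise products at most -1, so that
    a nonzero nonnegative combination of them is timelike and forward; in the
    spherical case it is nonzero because the vertices form a basis. *)
Lemma radial_cone V (a : 'cV[R]_n.+1) : nondeg V -> (forall i, 0 <= a i 0) -> a != 0 ->
  0 < Num.sqrt `|qform X (V *m a)| /\ model_space X (radial X (V *m a)).
Proof.
move=> [Vu Vm] a0 an0.
have [i0 ai0] : exists i, a i 0 != 0.
  apply/existsP; apply: contraR an0 => /existsPn h.
  by apply/eqP/colP => i; rewrite !mxE; apply/eqP; move: (h i); rewrite negbK.
have aip : 0 < a i0 0 by rewrite lt_def ai0 a0.
suff H : qform X (V *m a) != 0 /\ (forall c, 0 < c ->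
      c ^+ 2 * `|qform X (V *m a)| = 1 -> model_space X (c *: (V *m a))).
  have [q0 qm] := H; have s0 : 0 < Num.sqrt `|qform X (V *m a)|.
    by rewrite sqrtr_gt0 normr_gt0.
  split=> //; apply: qm; first by rewrite invr_gt0.
  by rewrite exprVn sqr_sqrtr// mulVf// normr_eq0.
rewrite /model_space; case: X Vm => Vm /=.
- have qle : qform Hyperbolic (V *m a) < 0.
    rewrite /qform {1}mulmx_col_sum bform_suml.
    have Hb i : a i 0 * bform Hyperbolic (col i V) (V *m a) <= 0.
      apply: mulr_ge0_le0; first exact: a0.
      rewrite mulmx_col_sum bform_sumr; apply: sumr_le0 => j _.
      rewrite bformZr; apply: mulr_ge0_le0 (a0 j) _.
      by have := model_bform_leN1 (Vm i) (Vm j); lra.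
    rewrite (bigD1 i0)//= ltr_wnDr//.
      by apply: sumr_le0 => i _; rewrite bformZl.
    rewrite bformZl pmulr_rlt0// mulmx_col_sum bform_sumr.
    rewrite (bigD1 i0)//= ltr_wnDr//.
      apply: sumr_le0 => j _; rewrite bformZr; apply: mulr_ge0_le0 (a0 j) _.
      by have := model_bform_leN1 (Vm i0) (Vm j); lra.
    rewrite bformZr pmulr_rlt0//.
    by have := model_bform_leN1 (Vm i0) (Vm i0); lra.
  split; first by rewrite lt_eqF.
  move=> c c0 cq; split; first by rewrite qformZ; move: cq; rewrite ltr0_norm//; lra.
  rewrite mxE pmulr_rgt0// mulmx_col_sum summxE (bigD1 i0)//= ltr_wpDr//.
    by apply: sumr_ge0 => i _; rewrite mxE mulr_ge0// ltW// (Vm i).2.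
  by rewrite mxE pmulr_rgt0//; exact: (Vm i0).2.
- have qge : 0 < qform Spherical (V *m a).
    rewrite lt_def qformE /= mul1r addr_ge0 ?sqr_ge0 ?sum_sq_ge0// andbT.
    apply: contra an0; rewrite paddr_eq0 ?sqr_ge0 ?sum_sq_ge0// => /andP[h0 h].
    have : V *m a = 0.
      apply/colP => i; rewrite [RHS]mxE; case: (unliftP ord0 i) => [j ->|->].
        move: h; rewrite psumr_eq0; last by move=> k _; exact: sqr_ge0.
        by move=> /allP/(_ j); rewrite mem_index_enum sqrf_eq0 => /(_ isT)/eqP.
      by move: h0; rewrite sqrf_eq0 => /eqP.
    by move=> /(congr1 (mulmx (invmx V))); rewrite mulmx0 mulKmx// => ->.
  split; first by rewrite gt_eqF.
  by move=> c c0; rewrite gtr0_norm// qformZ.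
Qed.

Lemma radial_hull V : nondeg V ->
  @radial R X n @` convex_hull (fun i => col i V) = spanned V.
Proof.
move=> nV; apply/seteqP; split => x.
  move=> [y [a [a0 a1 ->]] <-].
  have -> : \sum_i a i *: col i V = V *m (\col_i a i).
    by rewrite mulmx_col_sum; apply: eq_bigr => i _; rewrite mxE.
  have an0 : (\col_i a i) != 0 :> 'cV[R]_n.+1.
    apply: contra_eq_neq a1 => /colP a_0; rewrite big1 1?eq_sym ?oner_eq0// => i _.
    by have := a_0 i; rewrite !mxE.
  have [|s0 m] := radial_cone nV _ an0; first by move=> i; rewrite mxE.
  split=> //; exists ((Num.sqrt `|qform X (V *m (\col_i a i))|)^-1 *: (\col_i a i)).
    by move=> i; rewrite !mxE mulr_ge0// invr_ge0 ltW.
  by rewrite /radial -scalemxAr.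
move=> [mx [a a0 xa]].
have an0 : a != 0 by apply: contraTneq (model_neq0 mx) => a0'; rewrite xa a0' mulmx0 eqxx.
have s0 : 0 < \sum_i a i 0.
  rewrite lt_def sumr_ge0// andbT; apply: contra an0.
  rewrite psumr_eq0// => /allP h; apply/eqP/colP => i; rewrite mxE.
  by apply/eqP; apply: h; rewrite mem_index_enum.
exists ((\sum_i a i 0)^-1 *: x); last by rewrite radial_scale// invr_gt0.
exists (fun i => (\sum_i a i 0)^-1 * a i 0); split.
- by move=> i; rewrite mulr_ge0// invr_ge0 ltW.
- by rewrite -mulr_sumr mulVf// gt_eqF.
- rewrite xa mulmx_col_sum scaler_sumr; apply: eq_bigr => i _.
  by rewrite scalerA.
Qed.

Lemma simplex_spanned V : nondeg V -> simplex X (spanned V).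
Proof.
move=> nV; exists (fun i => col i V); split.
- exact: nV.2.
- have -> : \matrix_i (col i V)^T = V^T.
    by apply/matrixP => i j; rewrite !mxE.
  by rewrite row_free_unit unitmx_tr nV.1.
- move=> _ [a [_ a1 a0]].
  have va0 : V *m (\col_i a i) = 0.
    by rewrite mulmx_col_sum [RHS]a0; apply: eq_bigr => i _; rewrite mxE.
  have := congr1 (mulmx (invmx V)) va0; rewrite mulmx0 mulKmx ?nV.1// => /colP e.
  have : 1 = 0 :> R.
    by rewrite -a1 big1// => i _; have := e i; rewrite !mxE.
  by move/eqP; rewrite oner_eq0.
- by rewrite radial_hull.
Qed.

Lemma simplexP S : simplex X S -> exists2 V, nondeg V & S = spanned V.
Proof.
move=> [v [vm vf _ ->]]; pose V := (\matrix_i (v i)^T)^T.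
have cV i : col i V = v i by apply/colP => j; rewrite !mxE.
exists V.
  split; first by rewrite unitmx_tr -row_free_unit.
  by move=> j; rewrite cV.
rewrite -radial_hull; first by congr (_ @` convex_hull _); apply/funext=> i; rewrite cV.
split; first by rewrite unitmx_tr -row_free_unit.
by move=> j; rewrite cV.
Qed.

Definition replace_col V i w : 'M[R]_n.+1 := V + (w - col i V) *m delta_mx 0 i.

Lemma col_replace V i w k :
  col k (replace_col V i w) = if k == i then w else col k V.
Proof.
apply/colP => r; rewrite !mxE big_ord1 !mxE eqxx /=.
by case: (k =P i) => [->|_]; rewrite ?mulr1 ?mulr0 ?addr0 ?mxE// addrC subrK.
Qed.

Lemma replace_colE V i w (a : 'cV[R]_n.+1) :
  replace_col V i w *m a = V *m a + a i 0 *: (w - col i V).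
Proof.
rewrite mulmxDl -mulmxA -rowE; congr (_ + _).
by rewrite (_ : row i a = (a i 0)%:M) ?mul_mx_scalar//; apply/rowP=> k; rewrite !mxE ord1.
Qed.

Lemma replace_nondeg V (i j : 'I_n.+1) w (al be : R) : i != j -> nondeg V -> model_space X w ->
  al != 0 -> w = al *: col i V + be *: col j V -> nondeg (replace_col V i w).
Proof.
move=> ij [Vu Vm] mw al0 wE; split; last first.
  by move=> k; rewrite col_replace; case: ifP.
rewrite -unitmx_tr -row_free_unit; apply/inj_row_free => b.
move=> /(congr1 trmx); rewrite trmx_mul trmxK trmx0 replace_colE.
set a := b^T.
have -> : V *m a + a i 0 *: (w - col i V) =
    V *m (a + a i 0 *: ((al - 1) *: delta_mx i 0 + be *: delta_mx j 0)).
  rewrite mulmxDr; congr (_ + _); rewrite -scalemxAr mulmxDr -!scalemxAr -!colE wE.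
  by congr (_ *: _); rewrite scalerBl scale1r addrAC.
move=> /(congr1 (mulmx (invmx V))); rewrite mulmx0 mulKmx// => /colP e.
have ai0 : a i 0 = 0.
  have := e i; rewrite !mxE !eqxx /= (negbTE ij) /= mulr0 addr0 mulr1 => h.
  have : al * a i 0 = 0 by rewrite -h mxE; ring.
  by move=> /eqP; rewrite mulf_eq0 (negbTE al0) /= mxE => /eqP.
rewrite -[b]trmxK -/a; suff -> : a = 0 by rewrite trmx0.
apply/colP => k.
by have := e k; rewrite ai0 scale0r addr0.
Qed.

(** A point on the open edge from vertex [i] to vertex [j] cuts the simplex in
    two, by the hyperplane through it and the other vertices. *)
Lemma spanned_split V (i j : 'I_n.+1) w (al be : R) : i != j -> nondeg V -> model_space X w ->
  0 < al -> 0 < be -> w = al *: col i V + be *: col j V ->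
  spanned V = spanned (replace_col V i w) `|` spanned (replace_col V j w).
Proof.
move=> ij [Vu Vm] mw al0 be0 wE.
have ji : j != i by rewrite eq_sym.
have half p q (s t : R) : p != q -> 0 < s -> 0 < t ->
    w = s *: col p V + t *: col q V -> forall a : 'cV[R]_n.+1,
    (forall k, 0 <= a k 0) -> a p 0 * t <= a q 0 * s ->
    cone (replace_col V p w) (V *m a).
  move=> pq s0 t0 wpq a a0 st.
  exists (a + (a p 0 / s - a p 0) *: delta_mx p 0
      - (a p 0 / s * t) *: delta_mx q 0).
    move=> k; rewrite !mxE; case: (k =P p) => [->|/eqP kp] /=.
      rewrite (negbTE pq) /= mulr1 mulr0 subr0 addrC subrK.
      by rewrite divr_ge0// ltW.
    rewrite mulr0 addr0; case: (k =P q) => [->|_] /=; rewrite ?mulr0 ?subr0// mulr1.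
    by rewrite subr_ge0 mulrAC ler_pdivrMr.
  rewrite replace_colE !mxE !eqxx /= (negbTE pq) /= mulr1 mulr0 subr0.
  rewrite addrC subrK wpq mulmxBr mulmxDr -!scalemxAr -!colE -!addrA.
  rewrite -[LHS]addr0; congr (_ + _).
  apply/colP => k; rewrite !mxE; field; exact: lt0r_neq0.
have sub p q (s t : R) : p != q -> 0 < s -> 0 < t ->
    w = s *: col p V + t *: col q V ->
    cone (replace_col V p w) `<=` cone V.
  move=> pq s0 t0 wpq x [a a0 ->]; rewrite replace_colE.
  exists (a + a p 0 *: ((s - 1) *: delta_mx p 0 + t *: delta_mx q 0)).
    move=> k; rewrite !mxE; case: (k =P p) => [->|_] /=.
      rewrite (negbTE pq) /= mulr0 addr0 mulr1 mulrBr mulr1 addrC subrK.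
      by rewrite mulr_ge0// ltW.
    rewrite mulr0 add0r; case: (k =P q) => [->|_] /=; rewrite ?mulr0 ?addr0// mulr1.
    by rewrite addr_ge0// mulr_ge0// ltW.
  rewrite mulmxDr; congr (_ + _); rewrite -scalemxAr mulmxDr -!scalemxAr -!colE wpq.
  by congr (_ *: _); rewrite scalerBl scale1r addrAC.
have wE' : w = be *: col j V + al *: col i V by rewrite addrC.
apply/seteqP; split => x.
  move=> [mx [a a0 xa]]; rewrite xa in mx *.
  have [h|h] := leP (a i 0 * be) (a j 0 * al).
    by left; split=> //; apply: (half i j al be).
  right; split=> //; apply: (half j i be al) => //; exact: ltW.
move=> [] [mx cx]; split=> //; first exact: (sub i j al be).
exact: (sub j i be al).
Qed.

Definition signed (A : set 'cV[R]_n.+1) l :=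
  (forall x, A x -> 0 <= (l *m x) 0 0) \/ (forall x, A x -> (l *m x) 0 0 <= 0).

Lemma functional_cone V l (a : 'cV[R]_n.+1) :
  (l *m (V *m a)) 0 0 = \sum_i a i 0 * (l *m col i V) 0 0.
Proof.
rewrite mulmx_col_sum mulmx_sumr summxE; apply: eq_bigr => i _.
by rewrite -scalemxAr mxE.
Qed.

(** Induction on the number of vertices off the hyperplane: cutting an edge where
    it crosses the hyperplane yields two simplices with one more vertex on it. *)
Lemma signed_subdivision l V : nondeg V ->
  exists2 s : seq 'M[R]_n.+1, spanned V = \bigcup_(W in [set` s]) spanned W &
    {in s, forall W, nondeg W /\ signed (spanned W) l}.
Proof.
pose m V := #|[pred k | (l *m col k V) 0 0 != 0]|.
have [k] := ubnP (m V); elim: k V => // k IH V mk nV.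
have one : signed (spanned V) l -> exists2 s : seq 'M[R]_n.+1,
    spanned V = \bigcup_(W in [set` s]) spanned W &
    {in s, forall W, nondeg W /\ signed (spanned W) l}.
  move=> sV; exists [:: V]; last by move=> W; rewrite inE => /eqP ->.
  by rewrite set_cons1 bigcup_set1.
have [/existsP[i li]|/existsPn hp] :=
    boolP [exists i, 0 < (l *m col i V) 0 0]; last first.
  apply: one; right => x [_ [a a0 ->]]; rewrite functional_cone.
  apply: sumr_le0 => i _; apply: mulr_ge0_le0 (a0 i) _.
  by rewrite leNgt; exact: hp.
have [/existsP[j lj]|/existsPn hn] :=
    boolP [exists j, (l *m col j V) 0 0 < 0]; last first.
  apply: one; left => x [_ [a a0 ->]]; rewrite functional_cone.
  apply: sumr_ge0 => j _; apply: mulr_ge0 (a0 j) _.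
  by rewrite leNgt; exact: hn.
have ij : i != j by apply: contraTneq li => ->; rewrite -leNgt ltW.
pose be := (l *m col i V) 0 0; pose al := - (l *m col j V) 0 0.
have be0 : 0 < be by [].
have al0 : 0 < al by rewrite oppr_gt0.
pose a : 'cV[R]_n.+1 := al *: delta_mx i 0 + be *: delta_mx j 0.
have aV : V *m a = al *: col i V + be *: col j V.
  by rewrite mulmxDr -!scalemxAr -!colE.
have a0 k' : 0 <= a k' 0.
  by rewrite !mxE addr_ge0// mulr_ge0 ?ler0n// ltW.
have an0 : a != 0.
  apply/eqP => /colP/(_ i)/eqP; rewrite !mxE !eqxx (negbTE ij) /= mulr1 mulr0 addr0.
  by rewrite gt_eqF.
have [s0 mw] := radial_cone nV a0 an0.
set w := radial X (V *m a) in mw.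
pose c := (Num.sqrt `|qform X (V *m a)|)^-1.
have c0 : 0 < c by rewrite invr_gt0.
have wE : w = (c * al) *: col i V + (c * be) *: col j V.
  by rewrite /w /radial aV scalerDr !scalerA -/c -aV.
have lw : (l *m w) 0 0 = 0.
  rewrite wE mulmxDr -!scalemxAr mxE [X in X + _]mxE [X in _ + X]mxE.
  by rewrite -/be /al; ring.
have cal0 : 0 < c * al by exact: mulr_gt0.
have cbe0 : 0 < c * be by exact: mulr_gt0.
have wE' : w = (c * be) *: col j V + (c * al) *: col i V by rewrite addrC.
have dec p : (l *m col p V) 0 0 != 0 -> (m (replace_col V p w) < k)%N.
  move=> lp; apply: leq_trans (ltnSE mk); apply: proper_card.
  apply/properP; split.
    apply/fintype.subsetP => q; rewrite !inE col_replace.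
    by case: (q =P p) => // _; rewrite lw eqxx.
  by exists p; rewrite !inE// col_replace eqxx lw eqxx.
have [||si sie sin] := IH (replace_col V i w).
- by apply: dec; rewrite gt_eqF.
- exact: (replace_nondeg ij nV mw (lt0r_neq0 cal0) wE).
have [||sj sje sjn] := IH (replace_col V j w).
- by apply: dec; rewrite lt_eqF.
- by apply: (replace_nondeg _ nV mw (lt0r_neq0 cbe0) wE'); rewrite eq_sym.
exists (si ++ sj); last first.
  by move=> W; rewrite mem_cat => /orP[/sin|/sjn].
rewrite (spanned_split ij nV mw cal0 cbe0 wE) sie sje.
apply/seteqP; split => x.
  by move=> [] [W Ws Wx]; exists W => //=; rewrite mem_cat; apply/orP; [left|right].
by move=> [W /=]; rewrite mem_cat => /orP[] Ws Wx; [left|right]; exists W.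
Qed.

Lemma subdivision (L : seq 'rV[R]_n.+1) V : nondeg V ->
  exists2 s : seq 'M[R]_n.+1, spanned V = \bigcup_(W in [set` s]) spanned W &
    {in s, forall W, nondeg W /\ {in L, forall l, signed (spanned W) l}}.
Proof.
elim: L V => [|l L IH] V nV.
  exists [:: V]; last by move=> W; rewrite inE => /eqP ->.
  by rewrite set_cons1 bigcup_set1.
have [s se sn] := signed_subdivision l nV.
have H W : exists t : seq 'M[R]_n.+1, W \in s ->
    spanned W = \bigcup_(W in [set` t]) spanned W /\
    {in t, forall W, nondeg W /\ {in L, forall l, signed (spanned W) l}}.
  have [/sn[nW _]|] := boolP (W \in s); last by exists [::].
  by have [t te tn] := IH _ nW; exists t.
have [f fP] := boolp.choice H.
exists (flatten [seq f W | W <- s]).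
  rewrite se; apply/seteqP; split=> x.
    move=> [W Ws Wx]; have [fe fn] := fP _ Ws; move: Wx; rewrite fe => -[W' W'f W'x].
    by exists W' => //=; apply/flattenP; exists (f W) => //; exact: map_f.
  move=> [W /= /flattenP[t /mapP[W' W's ->] Wt] Wx]; exists W' => //.
  by have [-> _] := fP _ W's; exists W.
move=> W /flattenP[t /mapP[W' W's ->] Wt].
have [fe fn] := fP _ W's; have [nW LW] := fn _ Wt; split=> // l'.
rewrite inE => /orP[/eqP ->|]; last exact: LW.
have sub : spanned W `<=` spanned W' by rewrite fe => x Wx; exists W.
by have [_ []h] := sn _ W's; [left|right] => x /sub; exact: h.
Qed.

(** A functional that is nonnegative at all vertices vanishes at the barycentre
    only if it vanishes at all vertices, which form a basis. *)
Lemma spanned_interior_point V : nondeg V -> exists2 b, spanned V b &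
  forall l, l != 0 ->
    ((forall x, spanned V x -> 0 <= (l *m x) 0 0) -> 0 < (l *m b) 0 0) /\
    ((forall x, spanned V x -> (l *m x) 0 0 <= 0) -> (l *m b) 0 0 < 0).
Proof.
move=> nV; pose a : 'cV[R]_n.+1 := const_mx 1.
have a0 k : 0 <= a k 0 by rewrite mxE.
have an0 : a != 0 by apply/eqP => /colP/(_ 0)/eqP; rewrite !mxE oner_eq0.
have [s0 mw] := radial_cone nV a0 an0.
exists (radial X (V *m a)).
  split=> //; exists ((Num.sqrt `|qform X (V *m a)|)^-1 *: a).
    by move=> i; rewrite mxE mulr_ge0// invr_ge0 ltW.
  by rewrite -scalemxAr.
have pos l : l != 0 -> (forall x, spanned V x -> 0 <= (l *m x) 0 0) ->
    0 < (l *m radial X (V *m a)) 0 0.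
  move=> l0 lV; rewrite /radial -scalemxAr mxE pmulr_rgt0 ?invr_gt0//.
  have lc i : 0 <= (l *m col i V) 0 0.
    apply: lV; split; first exact: nV.2.
    exists (delta_mx i 0); last by rewrite colE.
    by move=> j; rewrite mxE ler0n.
  rewrite functional_cone lt_def sumr_ge0 ?andbT; last first.
    by move=> i _; rewrite mxE mul1r.
  apply: contra l0; rewrite psumr_eq0; last by move=> i _; rewrite mxE mul1r.
  move=> /allP h; have : l *m V = 0.
    apply/rowP => i; have := h i; rewrite mem_index_enum => /(_ isT).
    rewrite /= mxE mul1r => /eqP e; rewrite [RHS]mxE -e.
    by rewrite !mxE; apply: eq_bigr => k _; rewrite !mxE.
  by move=> /(congr1 (mulmxr (invmx V))); rewrite /= mul0mx mulmxK ?nV.1// => ->.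
move=> l l0; split; first exact: pos.
move=> lV; have := pos (- l); rewrite oppr_eq0 mulNmx mxE oppr_gt0; apply=> //.
by move=> x Vx; rewrite mulNmx mxE oppr_ge0; exact: lV.
Qed.

End simplices.

(** * Cutting along the facets of a covering *)

Section cutting.
Context {R : realType} (X : geometry) (n : nat).
Implicit Types (x : 'cV[R]_n.+1) (W g h : 'M[R]_n.+1) (l : 'rV[R]_n.+1).
Local Notation M := (@model_space R X n).

Lemma rel_interior_subset (A : set 'cV[R]_n.+1) : rel_interior X A `<=` A.
Proof. by move=> x; exact: (@interior_subset (subspace M)). Qed.

Lemma qformD x y t : qform X (x + t *: y) =
  qform X x + t * (2 * bform X x y) + t ^+ 2 * qform X y.
Proof.
rewrite /qform bformDl !bformDr !bformZl !bformZr (bformC X y x); ring.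
Qed.

(** Moving from a zero of the functional in the direction in which it decreases
    most leaves the half-space but stays close in the model space. *)
Lemma rel_interior_gt0 (p : set 'cV[R]_n.+1) l x : p `<=` M -> l != 0 ->
  (forall y, p y -> 0 <= (l *m y) 0 0) -> rel_interior X p x -> 0 < (l *m x) 0 0.
Proof.
move=> pM l0 lp px; have pxx := rel_interior_subset px.
have Mx : M x by exact: pM.
have lx := lp _ pxx; rewrite lt_def lx andbT; apply/negP => /eqP lx0.
have : within M (nbhs x) p by rewrite nbhs_subspace_in.
rewrite /within /= => nx.
pose q t := qform X x + t * (2 * bform X x (- l^T)) + t ^+ 2 * qform X (- l^T).
pose f t := (Num.sqrt `|q t|)^-1 *: (x + t *: (- l^T)).
have fE t : f t = radial X (x + t *: (- l^T)) by rewrite /f /q -qformD.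
have q0 : q 0 = qform X x by rewrite /q !mul0r expr0n mul0r !addr0.
have cq : q t @[t --> (0:R)] --> q 0.
  apply: cvgD; last by apply: cvgM; [exact: exprn_continuous | exact: cvg_cst].
  apply: cvgD; first exact: cvg_cst.
  by apply: cvgM; [exact: cvg_id | exact: cvg_cst].
have f0 : f 0 = x.
  by rewrite fE scale0r addr0 -[x in LHS]scale1r radial_scale.
have cf : f t @[t --> (0:R)] --> f 0.
  apply: cvgZ.
    apply: cvgV.
      by rewrite q0 model_norm// sqrtr1 oner_eq0.
    apply: continuous_cvg; first exact: sqrt_continuous.
    exact: cvg_norm.
  apply: cvgD; first exact: cvg_cst.
  by apply: cvgZl; exact: cvg_id.
have nf : \forall t \near (0:R), M (f t) -> p (f t).
  by rewrite f0 in cf; exact: cf _ nx.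
have nM : \forall t \near (0:R), M (f t).
  have n1 : \forall t \near (0:R), 0 < qform X x * q t.
    have : qform X x * q t @[t --> (0:R)] --> qform X x * q 0.
      by apply: cvgM => //; exact: cvg_cst.
    move/cvgr_gt; apply; rewrite q0 model_qform// curvatureK; exact: ltr01.
  have n2 : X = Hyperbolic -> \forall t \near (0:R), 0 < (x + t *: (- l^T)) 0 0.
    move=> HX; have x0 : 0 < x 0 0 by move: Mx; rewrite HX => -[].
    have : x 0 0 + t * (- l^T) 0 0 @[t --> (0:R)] --> x 0 0 + 0 * (- l^T) 0 0.
      apply: cvgD; first exact: cvg_cst.
      by apply: cvgM; [exact: cvg_id | exact: cvg_cst].
    rewrite mul0r addr0 => /cvgr_gt/(_ _ x0).
    by apply: filterS => t; rewrite !mxE.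
  have n3 : \forall t \near (0:R), X = Hyperbolic -> 0 < (x + t *: (- l^T)) 0 0.
    have [/n2|HX] := pselect (X = Hyperbolic); first by apply: filterS.
    by apply: (@filterE _ (nbhs (0:R))) => t /HX.
  apply: filterS2 n1 n3 => t q1 x1.
  have qt0 : q t != 0 by apply: contraTneq q1 => ->; rewrite mulr0 ltxx.
  have s0 : 0 < Num.sqrt `|q t| by rewrite sqrtr_gt0 normr_gt0.
  have qf : qform X (f t) = qform X x.
    rewrite /f qformZ qformD -/(q t) exprVn sqr_sqrtr//.
    have := model_norm Mx; move: q1; move: (qform X x) (q t) qt0 => u v v0 uv u1.
    have [v1|v1] := ltP 0 v.
      have u0 : 0 < u by move: uv; rewrite pmulr_lgt0.
      by rewrite gtr0_norm// mulVf// -u1 gtr0_norm.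
    have v1' : v < 0 by rewrite lt_neqAle v0.
    have u0 : u < 0 by move: uv; rewrite nmulr_lgt0.
    by rewrite ltr0_norm// invrN mulNr mulVf// -u1 ltr0_norm// opprK.
  move: qf x1; rewrite (model_qform Mx) /model_space /curvature.
  case: (X) => //= qf.
  by move=> /(_ erefl) x1; split; rewrite ?qf// /f mxE pmulr_rgt0 ?invr_gt0.
have nf' : \forall t \near (0:R), p (f t) by apply: filterS2 nM nf => t a; apply.
have [e /= e0 he] := nf'.
have pe : p (f (e / 2)).
  apply: he; rewrite /ball_ /= sub0r normrN gtr0_norm ?divr_gt0//; lra.
have := lp _ pe; rewrite /f -scalemxAr mulmxDr mxE.
have -> : (l *m x + l *m (e / 2 *: - l^T)) 0 0 = - (e / 2 * (l *m l^T) 0 0).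
  by rewrite mxE lx0 add0r -scalemxAr mulmxN !mxE mulrN.
have ll : 0 < (l *m l^T) 0 0.
  have lE : (l *m l^T) 0 0 = \sum_i l 0 i ^+ 2.
    by rewrite !mxE; apply: eq_bigr => i _; rewrite !mxE expr2.
  rewrite lE lt_def sum_sq_ge0 andbT; apply: contra l0.
  rewrite psumr_eq0; last by move=> i _; exact: sqr_ge0.
  move=> /allP h; apply/eqP/rowP => i; rewrite mxE; apply/eqP.
  by have := h i; rewrite mem_index_enum /= sqrf_eq0; apply.
apply/negP; rewrite -ltNge mulrN oppr_lt0 mulr_gt0 ?mulr_gt0 ?divr_gt0//.
have Mf : M (f (e / 2)) by exact: pM.
rewrite invr_gt0 sqrtr_gt0 normr_gt0; apply/eqP => qe0.
have := model_neq0 Mf; rewrite /f qe0 normr0 sqrtr0 invr0 scale0r eqxx.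
by [].
Qed.

Lemma polytope_seq (s : seq 'M[R]_n.+1) : {in s, forall W, nondeg X W} ->
  polytope X (\bigcup_(W in [set` s]) spanned X W).
Proof.
move=> sn; exists (size s), (fun i => spanned X (tnth (in_tuple s) i)); split.
  by move=> i; apply: simplex_spanned; apply: sn; exact: mem_tnth.
apply/seteqP; split => x.
  move=> [W /= Ws Wx]; have Wi : (index W s < size s)%N by rewrite index_mem.
  by exists (Ordinal Wi) => //=; rewrite (tnth_nth W) /= nth_index.
by move=> [i _ xi]; exists (tnth (in_tuple s) i) => //=; exact: mem_tnth.
Qed.

Lemma polytope_subdivision (L : seq 'rV[R]_n.+1) P : polytope X P ->
  exists2 s : seq 'M[R]_n.+1, P = \bigcup_(W in [set` s]) spanned X W &
    {in s, forall W, nondeg X W /\ {in L, forall l, signed (spanned X W) l}}.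
Proof.
move=> [k [S [simS ->]]].
have H i : exists s : seq 'M[R]_n.+1, S i = \bigcup_(W in [set` s]) spanned X W /\
    {in s, forall W, nondeg X W /\ {in L, forall l, signed (spanned X W) l}}.
  have [V nV ->] := simplexP (simS i).
  by have [s] := subdivision L nV; exists s.
have [f fP] := boolp.choice H.
exists (flatten [seq f i | i <- enum 'I_k]).
  apply/seteqP; split=> x.
    move=> [i _]; have [-> _] := fP i => -[W /= Wf Wx]; exists W => //=.
    by apply/flattenP; exists (f i) => //; apply/map_f; rewrite mem_enum.
  move=> [W /= /flattenP[t /mapP[i _ ->] Wt] Wx]; exists i => //.
  by have [-> _] := fP i; exists W.
move=> W /flattenP[t /mapP[i _ ->]]; exact: (fP i).2.
Qed.

Definition polyhedral (L : seq 'rV[R]_n.+1) : set 'cV[R]_n.+1 :=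
  [set x | M x /\ {in L, forall l, 0 <= (l *m x) 0 0}].

(** The pieces are obtained by cutting [P] along the facets of all the [g i C],
    where [C] is [polyhedral L], and collecting the simplices with the same signs.
    An interior point of a simplex lies in some [g i C], so that by its signs the
    whole piece lies there, and [h i *m invmx (g i)] moves it into [h i C]. *)
Lemma scissors_of_covering (L : seq 'rV[R]_n.+1) N (g h : 'I_N -> 'M[R]_n.+1)
    (P Q : set 'cV[R]_n.+1) :
  polytope X P -> {in L, forall l, l != 0} ->
  (forall i, is_isometry X (g i)) -> (forall i, is_isometry X (h i)) ->
  P `<=` \bigcup_i (mulmx (g i) @` polyhedral L) ->
  (forall i, mulmx (h i) @` polyhedral L `<=` Q) ->
  trivIset setT (fun i => mulmx (h i) @` polyhedral L) ->
  scissors_embeds X P Q.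
Proof.
move=> pP L0 ig ih Pg hQ th.
pose T : finType := ('I_N * 'I_(size L))%type.
pose F (t : T) : 'rV[R]_n.+1 := L`_t.2 *m invmx (g t.1).
have F0 t : F t != 0.
  apply/eqP => /(congr1 (mulmxr (g t.1))) /=.
  rewrite mul0mx mulmxKV ?(isometry_unit (ig _))// => /eqP; apply/negP; apply: L0.
  by rewrite mem_nth.
have [s Ps sn] := polytope_subdivision [seq F t | t : T] pP.
pose sgn W : {ffun T -> bool} :=
  [ffun t => `[< forall x, spanned X W x -> 0 <= (F t *m x) 0 0 >]].
have sgnT W t x : sgn W t -> spanned X W x -> 0 <= (F t *m x) 0 0.
  by rewrite ffunE => /asboolP; apply.
have sgnF W t x : W \in s -> ~~ sgn W t -> spanned X W x -> (F t *m x) 0 0 <= 0.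
  move=> Ws; rewrite ffunE => /asboolPn np Wx.
  have [_ /(_ (F t))[]] := sn _ Ws; last by apply.
    by apply: map_f; rewrite mem_enum.
  by move=> h'; case: np.
pose iso (sg : {ffun T -> bool}) :=
  if [pick i | [forall j, sg (i, j)]] is Some i then h i *m invmx (g i) else 1%:M.
pose p (sg : {ffun T -> bool}) :=
  \bigcup_(W in [set` [seq W <- s | sgn W == sg]]) spanned X W.
have pM sg : p sg `<=` M by move=> x [W _ []].
have isoI sg : is_isometry X (iso sg).
  rewrite /iso; case: pickP => [i _|_]; last exact: isometry1.
  by apply: isometryM => //; exact: isometryV.
have pickE sg x : p sg x -> exists2 i, [forall j, sg (i, j)] &
    iso sg = h i *m invmx (g i).
  move=> [W /=]; rewrite mem_filter => /andP[/eqP sgE Ws] Wx.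
  have nW := (sn _ Ws).1.
  have [b Wb bP] := spanned_interior_point nW.
  have : P b by rewrite Ps; exists W.
  move=> /Pg[i _ [c [Mc Lc] gc]].
  have : [forall j, sg (i, j)].
    apply/forallP => j; rewrite -sgE; apply: contraT => ns.
    have [_] := bP _ (F0 (i, j)) => h'.
    have : (F (i, j) *m b) 0 0 < 0 by apply: h' => x' Wx'; exact: sgnF ns Wx'.
    rewrite -gc /F /= mulmxA mulmxKV ?(isometry_unit (ig _))// ltNge Lc//.
    by rewrite mem_nth.
  rewrite /iso; case: pickP => [i' hi' _|/(_ i) ->//]; by exists i'.
have inC sg x i : p sg x -> [forall j, sg (i, j)] ->
    polyhedral L (invmx (g i) *m x).
  move=> px /forallP hi; split.
    by apply: isometry_model; [exact: isometryV | exact: pM px].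
  move: px => [W /=]; rewrite mem_filter => /andP[/eqP sgE Ws] Wx l lL.
  have jL : (index l L < size L)%N by rewrite index_mem.
  have := hi (Ordinal jL); rewrite -sgE => /sgnT/(_ Wx).
  by rewrite /F /= nth_index// mulmxA.
(* The signs at an interior point determine the cell. *)
have sign_det u sg x : is_isometry X u ->
    rel_interior X (mulmx u @` p sg) x ->
    forall t, sg t = (0 < (F t *m invmx u *m x) 0 0).
  move=> iu ux t.
  have uM : mulmx u @` p sg `<=` M.
    by move=> _ [y py <-]; apply: isometry_model => //; exact: pM py.
  have Fu0 : F t *m invmx u != 0.
    apply/eqP => /(congr1 (mulmxr u)) /=.
    by rewrite mul0mx mulmxKV ?(isometry_unit iu)//; apply/eqP.
  have [st|/negbTE st] := boolP (sg t); apply/esym.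
    apply: rel_interior_gt0 ux => // z [y [W /=]].
    rewrite mem_filter => /andP[/eqP sgE Ws] Wy <-.
    rewrite mulmxA mulmxKV ?(isometry_unit iu)//; apply: sgnT Wy; by rewrite sgE.
  apply/negbTE; rewrite -leNgt ltW// -oppr_gt0.
  have -> : - (F t *m invmx u *m x) 0 0 = (- (F t *m invmx u) *m x) 0 0.
    by rewrite mulNmx [RHS]mxE.
  apply: rel_interior_gt0 ux => //; first by rewrite oppr_eq0.
  move=> z [y [W /=]]; rewrite mem_filter => /andP[/eqP sgE Ws] Wy <-.
  rewrite mulNmx mxE oppr_ge0 mulmxA mulmxKV ?(isometry_unit iu)//.
  by apply: sgnF Wy => //; rewrite sgE st.
have mul1 sg : mulmx 1%:M @` p sg = p sg.
  apply/seteqP; split=> x; first by move=> [y py <-]; rewrite mul1mx.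
  by move=> px; exists x => //; rewrite mul1mx.
exists #|{ffun T -> bool}|, (fun k => p (enum_val k)), (fun k => iso (enum_val k)).
split; split.
- move=> k; apply: polytope_seq => W; rewrite mem_filter => /andP[_ Ws].
  exact: (sn _ Ws).1.
- rewrite Ps; apply/seteqP; split => x.
    move=> [W /= Ws Wx]; exists (enum_rank (sgn W)) => //; rewrite enum_rankK.
    by exists W => //=; rewrite mem_filter eqxx.
  by move=> [k _ [W /=]]; rewrite mem_filter => /andP[_ Ws] Wx; exists W.
- move=> k k' _ _ [x [xk xk']]; apply: enum_val_inj; apply/ffunP => t.
  by rewrite !(@sign_det 1%:M _ x)// ?mul1//; exact: isometry1.
- by move=> k.
- move=> k _ [x px <-]; have [i hi ->] := pickE _ _ px.
  by apply: (hQ i); exists (invmx (g i) *m x); rewrite ?mulmxA//; exact: (inC _ _ _ px).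
- move=> k k' _ _ [y [yk yk']].
  have [x px xy] := rel_interior_subset yk.
  have [x' px' xy'] := rel_interior_subset yk'.
  have [i hi isoE] := pickE _ _ px; have [i' hi' isoE'] := pickE _ _ px'.
  have ii' : i = i'.
    apply: th => //; exists y; split.
      by exists (invmx (g i) *m x); [exact: (inC _ _ _ px)|rewrite mulmxA -isoE].
    by exists (invmx (g i') *m x'); [exact: (inC _ _ _ px')|rewrite mulmxA -isoE'].
  apply: enum_val_inj; apply/ffunP => t.
  rewrite (sign_det _ _ _ (isoI _) yk) (sign_det _ _ _ (isoI _) yk').
  by rewrite isoE isoE' ii'.
Qed.

End cutting.

(** * Moving orthonormal frames *)

Section frames.
Context {R : realType} (X : geometry) (n : nat).
Implicit Types (u z : 'rV[R]_n) (i j k : 'I_n) (g : 'M[R]_n.+1).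
Local Notation kap := (@curvature R X).

Definition partial_rad m u := 1 - kap * \sum_(j < n | (m <= j)%N) u 0 j ^+ 2.
Definition partial_height m u := Num.sqrt (partial_rad m u).
Local Notation ph := partial_height.

Definition in_chart u := 0 < partial_rad 0 u.

Definition pt u : 'cV[R]_n.+1 :=
  \col_r (if unlift ord0 r is Some j then u 0 j else ph 0 u).

Lemma pt0 u : pt u 0 0 = ph 0 u.
Proof. by rewrite mxE unlift_none. Qed.

Lemma ptS u j : pt u (lift ord0 j) 0 = u 0 j.
Proof. by rewrite mxE liftK. Qed.

Lemma partial_rad_gt0 m u : in_chart u -> 0 < partial_rad m u.
Proof.
rewrite /in_chart /partial_rad /curvature; case: X => h.
  have : 0 <= \sum_(j < n | (m <= j)%N) u 0 j ^+ 2.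
    by apply: sumr_ge0 => *; exact: sqr_ge0.
  by rewrite mulN1r opprK; lra.
apply: lt_le_trans h _; rewrite lerD2l lerN2 !mul1r.
rewrite [leRHS](bigID (fun j : 'I_n => m <= j)%N) /= lerDl.
by apply: sumr_ge0 => *; exact: sqr_ge0.
Qed.

Lemma ph_gt0 m u : in_chart u -> 0 < ph m u.
Proof. by move=> /partial_rad_gt0 h; rewrite sqrtr_gt0. Qed.

Lemma sqr_ph m u : in_chart u -> ph m u ^+ 2 = partial_rad m u.
Proof. by move=> /partial_rad_gt0 h; rewrite sqr_sqrtr// ltW. Qed.

Lemma ph_last u : ph n u = 1.
Proof.
rewrite /ph /partial_rad big1 ?mulr0 ?subr0 ?sqrtr1// => j.
by rewrite leqNgt ltn_ord.
Qed.

Lemma sqr_phS i u : in_chart u ->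
  ph i.+1 u ^+ 2 = ph i u ^+ 2 + kap * u 0 i ^+ 2.
Proof.
move=> du; rewrite !sqr_ph// /partial_rad [in RHS](bigD1 i)//=.
have -> : \sum_(j < n | (i <= j)%N && (j != i)) u 0 j ^+ 2 =
    \sum_(j < n | (i < j)%N) u 0 j ^+ 2.
  by apply: eq_bigl => j; rewrite ltn_neqAle andbC eq_sym.
by ring.
Qed.

Lemma low_sum i u : in_chart u ->
  kap * ph 0 u ^+ 2 + \sum_(j < n | (j < i)%N) u 0 j ^+ 2 = kap * ph i u ^+ 2.
Proof.
move=> du; rewrite !sqr_ph// /partial_rad !mulrBr !mulrA curvatureK !mul1r.
have -> : \sum_(j < n | (0 <= j)%N) u 0 j ^+ 2 =
    \sum_(j < n | (i <= j)%N) u 0 j ^+ 2 + \sum_(j < n | (j < i)%N) u 0 j ^+ 2.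
  rewrite (bigID (fun j : 'I_n => i <= j)%N) /=; congr (_ + _).
  by apply: eq_bigl => j; rewrite ltnNge.
by ring.
Qed.

(** The last [n] columns of [exp(t_1 A_1) ... exp(t_n A_n)], where [A_i]
    generates the isometries of the plane of coordinates [0] and [i], and the
    [t_i] are such that the first column is [pt u]. *)
Definition frame_time i u := - kap * u 0 i * ph 0 u / (ph i u * ph i.+1 u).
Definition frame_space j i u :=
  if (j < i)%N then - kap * u 0 i * u 0 j / (ph i u * ph i.+1 u)
  else if j == i then ph i u / ph i.+1 u else 0.

Definition frame_vec i u : 'cV[R]_n.+1 :=
  \col_r (if unlift ord0 r is Some j then frame_space j i u else frame_time i u).

Definition frame u : 'M[R]_n.+1 :=
  \matrix_(r, c) (if unlift ord0 c is Some i then frame_vec i u r 0 else pt u r 0).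

Lemma col_frame0 u : col 0 (frame u) = pt u.
Proof. by apply/colP => r; rewrite mxE mxE unlift_none. Qed.

Lemma col_frameS u i : col (lift ord0 i) (frame u) = frame_vec i u.
Proof. by apply/colP => r; rewrite mxE mxE liftK. Qed.

Lemma frame_space_sum u i (v : 'I_n -> R) :
  \sum_j frame_space j i u * v j =
  - kap * u 0 i / (ph i u * ph i.+1 u) * (\sum_(j < n | (j < i)%N) u 0 j * v j)
  + ph i u / ph i.+1 u * v i.
Proof.
rewrite (bigID (fun j : 'I_n => j < i)%N) /=; congr (_ + _).
  rewrite mulr_sumr; apply: eq_bigr => j ji.
  by rewrite /frame_space ji; ring.
rewrite (bigD1 i) ?ltnn//= big1 ?addr0.
  by rewrite /frame_space ltnn eqxx.
by move=> j /andP[ji jni]; rewrite /frame_space (negbTE ji) (negbTE jni) mul0r.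
Qed.

Lemma bform_frame_vec u i (w : 'cV[R]_n.+1) :
  bform X (frame_vec i u) w = kap * (frame_time i u * w 0 0) +
    \sum_j frame_space j i u * w (lift ord0 j) 0.
Proof.
rewrite /bform mxE unlift_none; congr (_ + _).
by apply: eq_bigr => j _; rewrite mxE liftK.
Qed.

Lemma bform_pt_frame u i : in_chart u -> bform X (frame_vec i u) (pt u) = 0.
Proof.
move=> du; rewrite bform_frame_vec pt0.
under eq_bigr do rewrite ptS.
rewrite frame_space_sum.
have A0 : ph i u != 0 by rewrite gt_eqF// ph_gt0.
have B0 : ph i.+1 u != 0 by rewrite gt_eqF// ph_gt0.
have := low_sum i du; under eq_bigr do rewrite expr2.
move=> e; have -> : \sum_(j < n | (j < i)%N) u 0 j * u 0 j =
  kap * ph i u ^+ 2 - kap * ph 0 u ^+ 2 by rewrite -e; ring.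
rewrite /frame_time.
have kk : kap * kap = 1 := curvatureK X.
have -> : forall a b c d h : R, kap * (- kap * a * h / (b * c) * h) +
   (- kap * a / (b * c) * (kap * b ^+ 2 - kap * h ^+ 2) + d) =
   - (kap * kap) * (a * b ^+ 2 / (b * c)) + d.
  by move=> a b c d h; ring.
by rewrite kk; field; rewrite A0 B0.
Qed.

Lemma qform_pt u : in_chart u -> qform X (pt u) = kap.
Proof.
move=> du; rewrite qformE pt0 sqr_ph// /partial_rad.
under [X in _ + X]eq_bigr do rewrite ptS.
rewrite mulrBr mulrA curvatureK mulr1 mul1r; ring.
Qed.

Lemma bform_frame_vec_le u i k : in_chart u -> (i <= k)%N ->
  bform X (frame_vec i u) (frame_vec k u) = (i == k)%:R.
Proof.
move=> du ik; rewrite bform_frame_vec mxE unlift_none.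
under [X in _ + X]eq_bigr do rewrite mxE liftK.
rewrite frame_space_sum.
have A0 : ph i u != 0 by rewrite gt_eqF// ph_gt0.
have B0 : ph i.+1 u != 0 by rewrite gt_eqF// ph_gt0.
have C0 : ph k u != 0 by rewrite gt_eqF// ph_gt0.
have D0 : ph k.+1 u != 0 by rewrite gt_eqF// ph_gt0.
have kk : kap * kap = 1 := curvatureK X.
have -> : \sum_(j < n | (j < i)%N) u 0 j * frame_space j k u =
    - kap * u 0 k / (ph k u * ph k.+1 u) * (\sum_(j < n | (j < i)%N) u 0 j ^+ 2).
  rewrite mulr_sumr; apply: eq_bigr => j ji.
  by rewrite /frame_space (leq_trans ji ik); ring.
have e := low_sum i du.
have {e}-> : \sum_(j < n | (j < i)%N) u 0 j ^+ 2 =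
  kap * ph i u ^+ 2 - kap * ph 0 u ^+ 2 by rewrite -e; ring.
rewrite /frame_time /frame_space.
have -> : forall a b p q h a' d : R,
   kap * (- kap * a * h / p * (- kap * b * h / q)) +
   (- kap * a / p * (- kap * b / q * (kap * a' ^+ 2 - kap * h ^+ 2)) + d) =
   (kap * kap) * kap * (a * b * a' ^+ 2 / p / q) + d.
  by move=> *; ring.
rewrite kk mul1r.
have [->|ink] := eqVneq i k.
  rewrite ltnn /=; have e := sqr_phS k du.
  have e' : kap * u 0 k ^+ 2 = ph k.+1 u ^+ 2 - ph k u ^+ 2 by rewrite e; ring.
  rewrite mulr1n.
  have -> : kap * (u 0 k * u 0 k * ph k u ^+ 2 / (ph k u * ph k.+1 u) /
    (ph k u * ph k.+1 u)) = (kap * u 0 k ^+ 2) / (ph k.+1 u) ^+ 2.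
    by field; rewrite C0 D0.
  by rewrite e'; field; rewrite D0.
have ltik : (i < k)%N by rewrite ltn_neqAle ik andbT.
rewrite ltik mulr0n; field; by rewrite A0 B0 C0 D0.
Qed.

Lemma bform_frame_vecs u i k : in_chart u ->
  bform X (frame_vec i u) (frame_vec k u) = (i == k)%:R.
Proof.
move=> du; have [ik|ki] := leqP i k; first exact: bform_frame_vec_le.
by rewrite bformC bform_frame_vec_le ?(ltnW ki)// eq_sym.
Qed.

Lemma bform_delta0 (w : 'cV[R]_n.+1) : bform X (delta_mx 0 0) w = kap * w 0 0.
Proof.
rewrite /bform mxE eqxx mul1r big1 ?addr0// => i _.
by rewrite mxE /= mul0r.
Qed.

Lemma bform_deltaS i (w : 'cV[R]_n.+1) :
  bform X (delta_mx (lift ord0 i) 0) w = w (lift ord0 i) 0.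
Proof.
rewrite /bform mxE /= mul0r mulr0 add0r (bigD1 i)//= mxE !eqxx mul1r big1 ?addr0//.
by move=> j ji; rewrite mxE (inj_eq lift_inj) (negbTE ji) mul0r.
Qed.

Lemma bform_frame u (v w : 'cV[R]_n.+1) : in_chart u ->
  bform X (frame u *m v) (frame u *m w) = bform X v w.
Proof.
move=> du.
have cols r c : bform X (col r (frame u)) (col c (frame u)) =
    bform X (delta_mx r 0) (delta_mx c 0).
  case: (unliftP ord0 r) => [i ->|->]; case: (unliftP ord0 c) => [k ->|->].
  - rewrite !col_frameS bform_frame_vecs// bform_deltaS mxE andbT.
    by rewrite (inj_eq lift_inj).
  - by rewrite col_frameS col_frame0 bform_pt_frame// bform_deltaS mxE.
  - rewrite col_frameS col_frame0 bformC bform_pt_frame// bform_delta0 mxE /=.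
    by rewrite mulr0.
  - by rewrite col_frame0 -/(qform X (pt u)) qform_pt// bform_delta0 mxE eqxx mulr1.
have ext (a : 'cV[R]_n.+1) : a = \sum_r a r 0 *: delta_mx r 0.
  by rewrite -[LHS]mul1mx mulmx_col_sum; apply: eq_bigr => r _; rewrite col1.
rewrite [in RHS](ext v) [in RHS](ext w) !mulmx_col_sum !bform_suml.
apply: eq_bigr => r _; rewrite !bformZl !bform_sumr; congr (_ * _).
by apply: eq_bigr => c _; rewrite !bformZr cols.
Qed.

Lemma frame_isometry u : in_chart u -> is_isometry X (frame u).
Proof.
move=> du; apply: isometry_orthonormal => [v w|_]; first exact: bform_frame.
by rewrite mxE unlift_none pt0 ph_gt0.
Qed.

Lemma pt_model u : in_chart u -> model_space X (pt u).
Proof.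
move=> du; have := qform_pt du; have := ph_gt0 0 du.
by rewrite -pt0 /model_space /curvature; case: X => //=.
Qed.

Lemma pt_in_chart (w : 'cV[R]_n.+1) : model_space X w -> 0 < w 0 0 ->
  in_chart (\row_j w (lift ord0 j) 0) /\ w = pt (\row_j w (lift ord0 j) 0).
Proof.
move=> Mw w0; set u := \row_j _.
have radE : partial_rad 0 u = w 0 0 ^+ 2.
  have := model_qform Mw; rewrite qformE /partial_rad => e.
  have -> : \sum_(j < n | (0 <= j)%N) u 0 j ^+ 2 = \sum_j w (lift ord0 j) 0 ^+ 2.
    by apply: eq_bigr => j _; rewrite mxE.
  have -> : \sum_j w (lift ord0 j) 0 ^+ 2 = kap - kap * w 0 0 ^+ 2.
    by apply: (addrI (kap * w 0 0 ^+ 2)); rewrite e; ring.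
  by rewrite mulrBr mulrA curvatureK; ring.
split; first by rewrite /in_chart radE exprn_gt0.
apply/colP => r; case: (unliftP ord0 r) => [j ->|->].
  by rewrite ptS mxE.
by rewrite pt0 /ph radE sqrtr_sqr gtr0_norm.
Qed.

Lemma inv_frame0 u w : in_chart u ->
  (invmx (frame u) *m w) 0 0 = kap * bform X (pt u) w.
Proof.
move=> du; have iu := frame_isometry du.
rewrite -(col_frame0 u) colE -{2}(mulKVmx (isometry_unit iu) w) bform_frame//.
by rewrite bform_delta0 mulrA curvatureK mul1r.
Qed.

Lemma inv_frameS u w i : in_chart u ->
  (invmx (frame u) *m w) (lift ord0 i) 0 = bform X (frame_vec i u) w.
Proof.
move=> du; have iu := frame_isometry du.
rewrite -(col_frameS u) colE -{2}(mulKVmx (isometry_unit iu) w) bform_frame//.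
by rewrite bform_deltaS.
Qed.

(** Difference quotients: the frame coordinates of [pt z] depend linearly on
    [z - u], with coefficients that are continuous in [u] and [z]. *)
Definition slope u z i j :=
  frame_space j i u - frame_time i u * (z 0 j + u 0 j) / (ph 0 z + ph 0 u).

Lemma slopeP u z i : in_chart u -> in_chart z ->
  (invmx (frame u) *m pt z) (lift ord0 i) 0 =
  \sum_j slope u z i j * (z 0 j - u 0 j).
Proof.
move=> du dz; rewrite inv_frameS//.
have -> : bform X (frame_vec i u) (pt z) = bform X (frame_vec i u) (pt z - pt u).
  by rewrite -scaleN1r bformDr bformZr bform_pt_frame// mulr0 addr0.
rewrite bform_frame_vec.
rewrite [(pt z - pt u) 0 0]mxE [(- pt u) 0 0]mxE !pt0.
have hz := ph_gt0 0 dz; have hu := ph_gt0 0 du.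
have h0 : ph 0 z + ph 0 u != 0 by rewrite gt_eqF// addr_gt0.
have -> : ph 0 z - ph 0 u =
    - kap * \sum_j (z 0 j + u 0 j) * (z 0 j - u 0 j) / (ph 0 z + ph 0 u).
  apply: (mulIf h0); rewrite -subr_sqr !sqr_ph// /partial_rad.
  rewrite -mulr_suml mulrA divfK//.
  have -> : \sum_j (z 0 j + u 0 j) * (z 0 j - u 0 j) =
      \sum_j z 0 j ^+ 2 - \sum_j u 0 j ^+ 2.
    by rewrite -sumrB; apply: eq_bigr => j _; ring.
  by ring.
have -> : forall a b, kap * (frame_time i u * (- kap * b)) + a =
   a - (kap * kap) * (frame_time i u * b) by move=> *; ring.
rewrite curvatureK mul1r mulr_sumr -sumrB; apply: eq_bigr => j _.
rewrite [(pt z - pt u) _ _]mxE [(- pt u) _ _]mxE !ptS /slope; field; exact: h0.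
Qed.

Definition dslope u : 'M[R]_n := \matrix_(i, j) slope u u i j.

Lemma slope_diagE u i j : in_chart u ->
  slope u u i j = frame_space j i u - frame_time i u * u 0 j / ph 0 u.
Proof.
move=> du; rewrite /slope; congr (_ - _); field.
by have := ph_gt0 0 du; move=> h; rewrite -mulr2n mulrn_eq0 /= !gt_eqF.
Qed.

(** The [j]-th tangent vector of the chart has no components beyond the [j]-th, so it
    is a combination of the vectors [frame_vec k u] with [k <= j]. *)
Lemma dslope_low u i j : in_chart u -> (j < i)%N -> dslope u i j = 0.
Proof.
move=> du ji; rewrite mxE slope_diagE// /frame_space ji /frame_time.
field; by rewrite !gt_eqF// ph_gt0.
Qed.

Lemma dslope_diag u i : in_chart u -> dslope u i i = ph i.+1 u / ph i u.
Proof.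
move=> du; rewrite mxE slope_diagE// /frame_space ltnn eqxx /frame_time.
have A0 : ph i u != 0 by rewrite gt_eqF// ph_gt0.
have B0 : ph i.+1 u != 0 by rewrite gt_eqF// ph_gt0.
have C0 : ph 0 u != 0 by rewrite gt_eqF// ph_gt0.
have := sqr_phS i du => e.
have -> : ph i u / ph i.+1 u -
   - kap * u 0 i * ph 0 u / (ph i u * ph i.+1 u) * u 0 i / ph 0 u =
   (ph i u ^+ 2 + kap * u 0 i ^+ 2) / (ph i u * ph i.+1 u).
  by field; rewrite A0 B0 C0.
by rewrite -e; field; rewrite A0 B0.
Qed.

Lemma dslope_diag_gt0 u i : in_chart u -> 0 < dslope u i i.
Proof. by move=> du; rewrite dslope_diag// divr_gt0// ph_gt0. Qed.

(** The diagonal entries [ph i.+1 u / ph i u] telescope. *)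
Lemma det_dslope u : in_chart u -> \det (dslope u) = (ph 0 u)^-1.
Proof.
move=> du; rewrite -det_tr det_trig; last first.
  by apply/is_trig_mxP => i j ij; rewrite mxE dslope_low.
have tele m : (m <= n)%N ->
    \prod_(0 <= k < m) (ph k.+1 u / ph k u) = ph m u / ph 0 u.
  elim: m => [|m IH] mn; first by rewrite big_nil divff// gt_eqF// ph_gt0.
  rewrite big_nat_recr//= IH ?(ltnW mn)//; field.
  by rewrite !gt_eqF// ph_gt0.
transitivity (\prod_(0 <= k < n) (ph k.+1 u / ph k u)).
  by rewrite big_mkord; apply: eq_bigr => i _; rewrite mxE dslope_diag.
by rewrite tele// ph_last mul1r.
Qed.

Lemma dslope_unit u : in_chart u -> dslope u \in unitmx.
Proof.
by move=> du; rewrite unitmxE det_dslope// unitfE invr_eq0 gt_eqF// ph_gt0.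
Qed.

End frames.

(** * Lebesgue measure on tuples *)

Section tuple_measure.
Context {R : realType}.
Local Notation lam := (@lebesgue_tuple R).
Local Notation mu1 := (@lebesgue_measure R).

Lemma measurable_tcons_section n (A : set (n.+1.-tuple (measurableTypeR R))) t :
  measurable A -> measurable [set s : measurableTypeR R | A (tcons (s, t))].
Proof.
move=> mA; rewrite (_ : [set s | _] = ysection (@tcons _ (measurableTypeR R) n @^-1` A) t).
  apply: measurable_ysection; rewrite -[X in measurable X]setTI.
  exact: measurable_tcons.
by apply/seteqP; split=> s /=; rewrite /ysection /= inE.
Qed.

(** Tonelli: the head coordinate is integrated first. *)
Lemma lebesgue_tuple_cons n (A : set (n.+1.-tuple (measurableTypeR R))) :
  measurable A ->
  (lam n.+1 A = \int[lam n]_t mu1 [set s | A (tcons (s, t))])%E.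
Proof.
move=> mA.
have mA' : measurable (@tcons _ (measurableTypeR R) n @^-1` A).
  by rewrite -[X in measurable X]setTI; exact: measurable_tcons.
transitivity ((mu1 \x^ lam n)%E (@tcons _ (measurableTypeR R) n @^-1` A)).
  apply: product_measure_unique => // B C mB mC.
  exact: product_measure2E.
apply: eq_integral => t _ /=; congr (mu1 _).
by apply/seteqP; split=> s /=; rewrite /ysection /= inE.
Qed.

Lemma tnth_tcons0 n (s : R) (t : n.-tuple R) :
  tnth (@tcons _ (measurableTypeR R) n (s, t)) ord0 = s.
Proof. by []. Qed.

Lemma tnth_tconsS n (s : R) (t : n.-tuple R) i :
  tnth (@tcons _ (measurableTypeR R) n (s, t)) (lift ord0 i) = tnth t i.
Proof. by rewrite /tcons tnthS. Qed.

Definition parallelepiped n (B : 'M[R]_n) (a : 'I_n -> R) (e : R) :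
    set (n.-tuple (measurableTypeR R)) :=
  [set y | forall i, a i <= \sum_j B i j * tnth y j < a i + e].

Lemma measurable_linear n (b : 'I_n -> R) :
  measurable_fun setT
    (fun y : n.-tuple (measurableTypeR R) => \sum_j b j * tnth y j : R).
Proof.
apply: measurable_sum => j; apply: measurable_funM => //.
exact: measurable_tnth.
Qed.

Lemma measurable_parallelepiped n (B : 'M[R]_n) a e :
  measurable (parallelepiped B a e).
Proof.
rewrite (_ : parallelepiped B a e = \bigcap_(i in [set: 'I_n])
    ((fun y => \sum_j B i j * tnth y j) @^-1` `[a i, a i + e[%classic)).
  apply: fin_bigcap_measurable => // i _; rewrite -[X in measurable X]setTI.
  exact: (measurable_linear (B i)).
apply/seteqP; split => y /=.
  by move=> h i _; rewrite /= in_itv /=; exact: h.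
by move=> h i; have := h i Logic.I; rewrite /= in_itv.
Qed.

Lemma lebesgue_affine_itv (b c a e : R) : 0 < b -> 0 < e ->
  mu1 [set s : R | a <= b * s + c < a + e] = (e / b)%:E.
Proof.
move=> b0 e0.
have -> : [set s : R | a <= b * s + c < a + e] =
    [set` `[(a - c) / b, (a - c) / b + e / b[].
  apply/seteqP; split => s /=; rewrite in_itv /= ler_pdivrMr// -mulrDl ltr_pdivlMr//.
    by move=> /andP[h1 h2]; apply/andP; split; rewrite mulrC; lra.
  by rewrite mulrC => /andP[h1 h2]; apply/andP; split; lra.
rewrite lebesgue_measure_itv /= lte_fin ltrDl divr_gt0//.
by rewrite -EFinB; congr (_%:E); ring.
Qed.

(** Triangularity makes each section in the head coordinate an interval of length
    [e / B 0 0], over a parallelepiped with one dimension less. *)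
Lemma lebesgue_parallelepiped n (B : 'M[R]_n) a e :
  (forall i j : 'I_n, (j < i)%N -> B i j = 0) -> (forall i, 0 < B i i) -> 0 < e ->
  lam n (parallelepiped B a e) = (e ^+ n / \prod_i B i i)%:E.
Proof.
move=> + + e0; elim: n B a => [|n IH] B a Blow Bdiag.
  rewrite big_ord0 divr1 expr0 /lam /= diracE mem_set//.
  by move=> i; case: i.
rewrite lebesgue_tuple_cons; last exact: measurable_parallelepiped.
pose B' : 'M[R]_n := \matrix_(i, j) B (lift ord0 i) (lift ord0 j).
pose a' i := a (lift ord0 i).
have sec t : [set s : R | parallelepiped B a e (tcons (s, t))] =
    if t \in parallelepiped B' a' e then
      [set s | a ord0 <= B ord0 ord0 * s +
        \sum_j B ord0 (lift ord0 j) * tnth t j < a ord0 + e]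
    else set0.
  have sumS s i : \sum_j B (lift ord0 i) j *
      tnth (@tcons _ (measurableTypeR R) n (s, t)) j = \sum_j B' i j * tnth t j.
    rewrite big_ord_recl Blow// mul0r add0r; apply: eq_bigr => j _.
    by rewrite tnth_tconsS mxE.
  have sum0 s : \sum_j B ord0 j * tnth (@tcons _ (measurableTypeR R) n (s, t)) j =
      B ord0 ord0 * s + \sum_j B ord0 (lift ord0 j) * tnth t j.
    rewrite big_ord_recl tnth_tcons0; congr (_ + _).
    by apply: eq_bigr => j _; rewrite tnth_tconsS.
  case: ifPn => [tP|/negP tn]; first rewrite inE in tP.
    apply/seteqP; split => s /=.
      by move=> /(_ ord0); rewrite sum0.
    move=> h i; case: (unliftP ord0 i) => [j ->|->]; first by rewrite sumS; exact: (tP j).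
    by rewrite sum0.
  rewrite inE in tn; apply/seteqP; split => // s /= h; apply: tn => i.
  by rewrite -(sumS s); exact: h.
transitivity (\int[lam n]_t
    ((e / B ord0 ord0)%:E * (\1_(parallelepiped B' a' e) t)%:E))%E.
  apply: eq_integral => t _; rewrite sec indicE.
  case: ifPn => _; last by rewrite measure0 mule0.
  by rewrite lebesgue_affine_itv// mule1.
rewrite ge0_integralZl//; last 2 first.
- by apply/measurable_EFinP/measurable_indic; exact: measurable_parallelepiped.
- by rewrite lee_fin divr_ge0// ltW.
rewrite integral_indic//; last exact: measurable_parallelepiped.
rewrite setIT.
have IH' : lam n (parallelepiped B' a' e) = (e ^+ n / \prod_i B' i i)%:E.
  by apply: IH => [i j ji|i]; rewrite mxE// Blow.
transitivity ((e / B ord0 ord0)%:E * (e ^+ n / \prod_i B' i i)%:E)%E.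
  by congr (_ * _)%E; exact: IH'.
rewrite -EFinM; congr (_%:E); rewrite big_ord_recl exprS.
under eq_bigr do rewrite mxE.
by rewrite invfM mulrACA.
Qed.

End tuple_measure.

(** * The volume as the integral of a density *)

Section density.
Context {R : realType} (X : geometry) (n : nat).
Local Notation kap := (@curvature R X).
Local Notation lam := (@lebesgue_tuple R n).
Local Notation T := (n.-tuple (measurableTypeR R)).
Implicit Types (y : n.-tuple R) (i j : 'I_n).
Local Notation ph := (partial_height X).

Definition rowt y : 'rV[R]_n := \row_j tnth y j.

Lemma radicandE y : radicand X y = partial_rad X 0 (rowt y).
Proof.
by rewrite /radicand /partial_rad; congr (_ - _ * _); apply: eq_bigr => j _;
  rewrite mxE.
Qed.

Lemma heightE y : height X y = ph 0 (rowt y).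
Proof. by rewrite /height radicandE. Qed.

Lemma col_mx_head (a : 'M[R]_1) (b : 'cV[R]_n) :
  (col_mx a b : 'cV[R]_n.+1) 0 0 = a 0 0.
Proof.
by rewrite mxE; case: splitP => // k _; rewrite ord1.
Qed.

Lemma col_mx_tail (a : 'M[R]_1) (b : 'cV[R]_n) j :
  (col_mx a b : 'cV[R]_n.+1) (lift ord0 j) 0 = b j 0.
Proof.
rewrite mxE; case: splitP => [k|k]; first by rewrite ord1.
by move=> /= /eqP; rewrite /bump /= eqn_add2l => /eqP e; congr (b _ 0); apply: val_inj.
Qed.

Lemma chart_head s y : chart X s y 0 0 = (-1) ^+ s * height X y.
Proof. by rewrite /chart col_mx_head mxE eqxx mulr1n. Qed.

Lemma chart_tail s y j : chart X s y (lift ord0 j) 0 = tnth y j.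
Proof. by rewrite /chart col_mx_tail mxE. Qed.

Lemma chartE y : chart X false y = pt X (rowt y).
Proof.
apply/colP => r; case: (unliftP ord0 r) => [j ->|->].
  by rewrite chart_tail ptS mxE.
by rewrite chart_head pt0 mul1r heightE.
Qed.

Lemma bform_tangent s y i j :
  bform X (tangent X s y i) (tangent X s y j) =
  kap * ((- kap * tnth y i / height X y) * (- kap * tnth y j / height X y)) +
  (i == j)%:R.
Proof.
rewrite /bform !col_mx_head !mxE eqxx !mulr1n; congr (_ + _).
  rewrite mulrACA -expr2 -exprM -signr_odd.
  by rewrite (_ : odd _ = false) ?mul1r//; case: s.
under eq_bigr do rewrite !col_mx_tail !mxE !andbT.
rewrite (bigD1 i)//= eqxx mul1r big1 ?addr0// => k ki.
by rewrite (negbTE ki) mul0r.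
Qed.

Lemma tangent_slope y i j : 0 < radicand X y ->
  bform X (frame_vec X i (rowt y)) (tangent X false y j) = dslope X (rowt y) i j.
Proof.
rewrite radicandE => du; rewrite bform_frame_vec col_mx_head.
under eq_bigr do rewrite col_mx_tail mxE andbT.
rewrite (bigD1 j)//= eqxx mulr1 big1 ?addr0; last first.
  by move=> k kj; rewrite (negbTE kj) mulr0.
rewrite [in RHS]mxE slope_diagE// [X in kap * (_ * X)]mxE eqxx mulr1n mul1r.
rewrite [rowt y 0 j]mxE heightE addrC; congr (_ + _).
have -> : forall a b c : R, kap * (a * (- kap * b / c)) = - (kap * kap) * (a * b / c).
  by move=> *; ring.
by rewrite curvatureK mulN1r.
Qed.

(** The tangent vectors are orthogonal to [pt], and [dslope] collects their
    coordinates in the rest of the orthonormal frame. *)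
Lemma metricE s y : 0 < radicand X y ->
  metric X s y = (dslope X (rowt y))^T *m dslope X (rowt y).
Proof.
move=> dy; have du := dy; rewrite radicandE in du.
have iF := frame_isometry du.
apply/matrixP => i j; rewrite mxE bform_tangent -(bform_tangent false).
rewrite -(mulKVmx (isometry_unit iF) (tangent X false y i)).
rewrite -(mulKVmx (isometry_unit iF) (tangent X false y j)) bform_frame//.
rewrite /bform !inv_frame0//.
have tan0 k : bform X (pt X (rowt y)) (tangent X false y k) = 0.
  have h0 : ph 0 (rowt y) != 0 by rewrite gt_eqF// ph_gt0.
  rewrite /bform pt0 col_mx_head [(_)%:M _ _]mxE eqxx mulr1n mul1r.
  under eq_bigr do rewrite ptS col_mx_tail [delta_mx _ _ _ _]mxE andbT.
  rewrite (bigD1 k)//= eqxx mulr1 big1 ?addr0; last first.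
    by move=> l lk; rewrite (negbTE lk) mulr0.
  rewrite heightE [rowt y 0 k]mxE.
  have -> : kap * (ph 0 (rowt y) * (- kap * tnth y k / ph 0 (rowt y))) =
    - (kap * kap) * tnth y k by field.
  by rewrite curvatureK mulN1r addNr.
rewrite !tan0 !mulr0 add0r !mxE; apply: eq_bigr => k _.
by rewrite !inv_frameS// !tangent_slope// [in RHS]mxE.
Qed.

Definition density y : R := (height X y)^-1.

Lemma density_ge0 y : 0 <= density y.
Proof. by rewrite invr_ge0 sqrtr_ge0. Qed.

Lemma volume_density s y : 0 < radicand X y ->
  Num.sqrt (\det (metric X s y)) = density y.
Proof.
move=> dy; have du := dy; rewrite radicandE in du.
rewrite metricE// det_mulmx det_tr det_dslope// -heightE -expr2 sqrtr_sqr.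
by rewrite ger0_norm// density_ge0.
Qed.

Lemma measurable_radicand : measurable_fun setT (fun y : T => radicand X y : R).
Proof.
apply: measurable_funB => //; apply: measurable_funM => //.
apply: measurable_sum => j.
by apply: (@measurable_funX _ T R setT (fun y => tnth y j) 2); exact: measurable_tnth.
Qed.

Lemma measurable_height : measurable_fun setT (fun y : T => height X y : R).
Proof.
apply: (@measurableT_comp _ _ _ _ _ _ (@Num.sqrt R) _ (fun y : T => radicand X y : R));
  last exact: measurable_radicand.
by apply: continuous_measurable_fun; exact: sqrt_continuous.
Qed.

Lemma measurable_density : measurable_fun setT (fun y : T => density y : R).
Proof.
rewrite (_ : (fun _ => _) = (fun x => x `^ (-1)) \o (fun y : T => height X y : R)).
  by apply: measurableT_comp; [exact: measurable_powR | exact: measurable_height].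
by apply/funext => y /=; rewrite powR_inv1// sqrtr_ge0.
Qed.

Definition density_measure (A : set T) : \bar R :=
  (\int[lam]_(y in A) (density y)%:E)%E.

Let density_measure0 : density_measure set0 = 0%E.
Proof. exact: integral_set0. Qed.

Let density_measure_ge0 A : (0 <= density_measure A)%E.
Proof. by apply: integral_ge0 => y _; rewrite lee_fin density_ge0. Qed.

Let density_measure_sigma_additive : semi_sigma_additive density_measure.
Proof.
move=> F mF tF mUF.
rewrite [X in _ --> X](_ : _ = \sum_(k <oo) density_measure (F k))%E; last first.
  apply: ge0_integral_bigcup => //.
    apply: measurable_funTS; apply/measurable_EFinP; exact: measurable_density.
  by move=> y _; rewrite lee_fin density_ge0.
apply/cvg_closeP; split; last by rewrite closeE.
by apply: is_cvg_nneseries => *; exact: density_measure_ge0.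
Qed.

HB.instance Definition _ := isMeasure.Build _ _ _ density_measure
  density_measure0 density_measure_ge0 density_measure_sigma_additive.

Lemma sheet_volE s (A : set 'cV[R]_n.+1) :
  sheet_vol X s A = density_measure [set y | 0 < radicand X y /\ A (chart X s y)].
Proof.
apply: eq_integral => y; rewrite inE /= => -[dy _].
by rewrite volume_density.
Qed.

End density.

(** * Local comparison of small cubes with parallelepipeds *)

Section local.
Context {R : realType} (X : geometry) (n : nat).
Implicit Types (u z : 'rV[R]_n) (i j : 'I_n).
Local Notation kap := (@curvature R X).
Local Notation ph := (partial_height X).

Lemma continuous_partial_rad m : continuous (fun u : 'rV[R]_n => partial_rad X m u).
Proof.
have cs : continuous (fun u : 'rV[R]_n => \sum_(j < n | (m <= j)%N) u 0 j ^+ 2).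
  apply: continuous_big => [|j _ v]; first exact: add_continuous.
  apply: (continuous_comp (f := fun v : 'rV[R]_n => v 0 j) (g := fun x => x ^+ 2)).
    exact: coord_continuous.
  exact: exprn_continuous.
move=> u; have cr : {for u, continuous (fun u' : 'rV[R]_n => partial_rad X m u')}.
  by apply: continuousB; [exact: cst_continuous | apply: continuousM;
    [exact: cst_continuous | exact: cs]].
exact: cr.
Qed.

Section continuity.
Variable u0 : 'rV[R]_n.
Hypothesis du0 : in_chart X u0.
Let N := nbhs (u0, u0).

Let coord1 j : (p.1 : 'rV[R]_n) 0 j @[p --> N] --> u0 0 j.
Proof.
by apply: (cvg_comp (fun p : 'rV_n * 'rV_n => p.1) (fun u : 'rV_n => u 0 j));
  [exact: cvg_fst | exact: coord_continuous].
Qed.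

Let coord2 j : (p.2 : 'rV[R]_n) 0 j @[p --> N] --> u0 0 j.
Proof.
by apply: (cvg_comp (fun p : 'rV_n * 'rV_n => p.2) (fun u : 'rV_n => u 0 j));
  [exact: cvg_snd | exact: coord_continuous].
Qed.

Let cvg_prad m (f : 'rV[R]_n * 'rV[R]_n -> 'rV[R]_n) :
  (forall j, f p 0 j @[p --> N] --> u0 0 j) ->
  partial_rad X m (f p) @[p --> N] --> partial_rad X m u0.
Proof.
move=> fc; apply: cvgB; first exact: cvg_cst.
apply: cvgM; first exact: cvg_cst.
apply: cvg_big => [|j _]; first exact: add_continuous.
by apply: cvgM; exact: fc.
Qed.

Let cvg_ph m (f : 'rV[R]_n * 'rV[R]_n -> 'rV[R]_n) :
  (forall j, f p 0 j @[p --> N] --> u0 0 j) ->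
  ph m (f p) @[p --> N] --> ph m u0.
Proof.
move=> fc; rewrite /partial_height; apply: continuous_cvg; first exact: sqrt_continuous.
exact: cvg_prad.
Qed.

Let ph_neq0 m : ph m u0 != 0. Proof. by rewrite gt_eqF// ph_gt0. Qed.

Let cvg_time i : frame_time X i p.1 @[p --> N] --> frame_time X i u0.
Proof.
apply: cvgM; last first.
  apply: cvgV; first by rewrite mulf_neq0.
  by apply: cvgM; apply: cvg_ph => j; exact: coord1.
apply: cvgM; last by apply: cvg_ph => j; exact: coord1.
by apply: cvgM; [exact: cvg_cst | exact: coord1].
Qed.

Let cvg_space j i : frame_space X j i p.1 @[p --> N] --> frame_space X j i u0.
Proof.
rewrite /frame_space; case: ifP => _.
  apply: cvgM; last first.
    apply: cvgV; first by rewrite mulf_neq0.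
    by apply: cvgM; apply: cvg_ph => k; exact: coord1.
  apply: cvgM; last exact: coord1.
  by apply: cvgM; [exact: cvg_cst | exact: coord1].
case: ifP => _; last exact: cvg_cst.
apply: cvgM; last apply: cvgV => //; by apply: cvg_ph => k; exact: coord1.
Qed.

Let cvg_slope i j : slope X p.1 p.2 i j @[p --> N] --> slope X u0 u0 i j.
Proof.
apply: cvgB; first exact: cvg_space.
apply: cvgM; last first.
  apply: cvgV.
    by rewrite -mulr2n mulrn_eq0 /= ph_neq0.
  by apply: cvgD; apply: cvg_ph => k; [exact: coord2 | exact: coord1].
apply: cvgM; first exact: cvg_time.
by apply: cvgD; [exact: coord2 | exact: coord1].
Qed.

Let cvg_frame r c : frame X p.1 r c @[p --> N] --> frame X u0 r c.
Proof.
have cpt : pt X p.1 r 0 @[p --> N] --> pt X u0 r 0.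
  case: (unliftP ord0 r) => [j ->|->].
    by rewrite ptS; under eq_fun do rewrite ptS; exact: coord1.
  by rewrite pt0; under eq_fun do rewrite pt0; apply: cvg_ph; exact: coord1.
case: (unliftP ord0 c) => [i ->|->]; last first.
  by rewrite mxE unlift_none; under eq_fun do rewrite mxE unlift_none.
rewrite mxE liftK; under eq_fun do rewrite mxE liftK.
case: (unliftP ord0 r) => [j ->|->].
  by rewrite mxE liftK; under eq_fun do rewrite mxE liftK; exact: cvg_space.
by rewrite mxE unlift_none; under eq_fun do rewrite mxE unlift_none; exact: cvg_time.
Qed.

Let cvg_bform : kap * bform X (pt X p.1) (pt X p.2) @[p --> N] --> (1 : R).
Proof.
have <- : kap * bform X (pt X u0) (pt X u0) = 1.
  by rewrite -/(qform X (pt X u0)) qform_pt// curvatureK.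
apply: cvgM; first exact: cvg_cst.
apply: cvgD.
  apply: cvgM; first exact: cvg_cst.
  rewrite pt0; under eq_fun do rewrite !pt0.
  by apply: cvgM; apply: cvg_ph => j; [exact: coord1 | exact: coord2].
apply: cvg_big => [|j _]; first exact: add_continuous.
rewrite ptS; under eq_fun do rewrite !ptS.
by apply: cvgM; [exact: coord1 | exact: coord2].
Qed.

(** What continuity at [(u0, u0)] provides, with a common error [eta]. *)
Definition near_data (eta : R) u z :=
  [/\ in_chart X u /\ in_chart X z,
      forall i j, `|slope X u z i j - dslope X u0 i j| <= eta,
      `|kap * bform X (pt X u) (pt X z) - 1| <= eta,
      `|ph 0 u - ph 0 u0| <= eta &
      forall r c, `|frame X u r c - frame X u0 r c| <= eta].

Lemma near_chart (eta : R) : 0 < eta -> exists2 r, 0 < r &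
  forall u z, (forall i, `|u 0 i - u0 0 i| < r) ->
    (forall i, `|z 0 i - u0 0 i| < r) -> near_data eta u z.
Proof.
move=> eta0.
have close (f : 'rV[R]_n * 'rV[R]_n -> R) l : f p @[p --> N] --> l ->
    \forall p \near N, `|f p - l| <= eta.
  move=> /cvgrPdist_le/(_ _ eta0).
  by apply: filterS => p; rewrite distrC.
have all (I : finType) (P : I -> set ('rV[R]_n * 'rV[R]_n)) :
    (forall a : I, \forall p \near N, P a p) -> \forall p \near N, forall a : I, P a p.
  by move=> h; exact: filter_forall.
have H : \forall p \near N, near_data eta p.1 p.2.
  have h1 : \forall p \near N, 0 < partial_rad X 0 p.1.
    by have := @cvg_prad 0 fst coord1; move/cvgr_gt; apply.
  have h2 : \forall p \near N, 0 < partial_rad X 0 p.2.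
    by have := @cvg_prad 0 snd coord2; move/cvgr_gt; apply.
  have h3 : \forall p \near N, forall ij : 'I_n * 'I_n,
      `|slope X p.1 p.2 ij.1 ij.2 - dslope X u0 ij.1 ij.2| <= eta.
    apply: all => -[i j] /=; rewrite mxE; apply: close; exact: cvg_slope.
  have h4 := close _ _ cvg_bform.
  have h5 := close _ _ (@cvg_ph 0 fst coord1).
  have h6 : \forall p \near N, forall rc : 'I_n.+1 * 'I_n.+1,
      `|frame X p.1 rc.1 rc.2 - frame X u0 rc.1 rc.2| <= eta.
    apply: all => -[i j] /=; apply: close; exact: cvg_frame.
  near=> p; split.
  - by split; near: p.
  - move=> i j; have : forall ij : 'I_n * 'I_n,
      `|slope X p.1 p.2 ij.1 ij.2 - dslope X u0 ij.1 ij.2| <= eta by near: p.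
    by move=> /(_ (i, j)).
  - by near: p.
  - by near: p.
  - move=> r c; have : forall rc : 'I_n.+1 * 'I_n.+1,
      `|frame X p.1 rc.1 rc.2 - frame X u0 rc.1 rc.2| <= eta by near: p.
    by move=> /(_ (r, c)).
have /nbhs_ballP[r /= r0 hr] := H.
exists r => // u z ur zr; apply: (hr (u, z)).
by split; split=> //= i j; rewrite ord1 /ball /= distrC.
Unshelve. all: by end_near.
Qed.

End continuity.
End local.

Section tiny.
Context {R : realType} (X : geometry) (n : nat).
Hypothesis n_gt0 : (0 < n)%N.
Implicit Types (u z : 'rV[R]_n) (i j : 'I_n) (x : 'cV[R]_n.+1).
Local Notation kap := (@curvature R X).
Local Notation ph := (partial_height X).
Local Notation M := (@model_space R X n).

Definition tiny_facets (e : R) : seq 'rV[R]_n.+1 :=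
  [seq e *: delta_mx 0 0 + (-1) ^+ (si.1 : bool) *: delta_mx 0 (lift ord0 si.2)
    | si : bool * 'I_n].

(** The central projection to the model space of a cube of side [2 e] in the affine
    hyperplane [x_0 = 1]. It is polyhedral, so polytopes can be cut along its
    facets, and it has the same shape at every scale up to higher order terms. *)
Definition tiny e : set 'cV[R]_n.+1 := polyhedral X (tiny_facets e).

Lemma tiny_facets_neq0 e : {in tiny_facets e, forall l, l != 0}.
Proof.
move=> l /mapP[[s i] _ ->]; apply/eqP => /rowP/(_ (lift ord0 i))/eqP.
rewrite !mxE !eqxx /= mulr0 add0r mulr1 signr_eq0.
by [].
Qed.

Lemma tinyP e x : tiny e x <-> M x /\ forall i, `|x (lift ord0 i) 0| <= e * x 0 0.
Proof.
have rowE (c : 'I_n.+1) : (delta_mx 0 c *m x : 'M[R]_1) 0 0 = x c 0.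
  by rewrite -rowE mxE.
have facE s i : ((e *: delta_mx 0 0 + (-1) ^+ s *: delta_mx 0 (lift ord0 i)) *m x
    : 'M[R]_1) 0 0 = e * x 0 0 + (-1) ^+ s * x (lift ord0 i) 0.
  by rewrite mulmxDl mxE -!scalemxAl [X in X + _]mxE [X in _ + X]mxE !rowE.
split=> -[Mx h]; split=> //.
  move=> i; have h1 := h (e *: delta_mx 0 0 + (-1) ^+ true *: delta_mx 0 (lift ord0 i)).
  have h0 := h (e *: delta_mx 0 0 + (-1) ^+ false *: delta_mx 0 (lift ord0 i)).
  move: h0 h1; rewrite !facE expr0 expr1 mul1r mulN1r => h0 h1.
  have {h0} : 0 <= e * x 0 0 + x (lift ord0 i) 0.
    by apply: h0; apply/mapP; exists (false, i); rewrite ?mem_enum.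
  have {h1} : 0 <= e * x 0 0 - x (lift ord0 i) 0.
    by apply: h1; apply/mapP; exists (true, i); rewrite ?mem_enum.
  by move=> *; rewrite ler_norml; apply/andP; split; lra.
move=> l /mapP[[s i] _ ->]; rewrite facE /=; have := h i; rewrite ler_norml.
by case: s => /=; rewrite ?expr0 ?expr1 ?mul1r ?mulN1r => /andP[]; lra.
Qed.

Lemma tiny_head_gt0 e x : 0 < e -> tiny e x -> 0 < x 0 0.
Proof.
move=> e0 /tinyP[Mx h].
have x0 : 0 <= x 0 0.
  by have := le_trans (normr_ge0 _) (h (Ordinal n_gt0)); rewrite pmulr_rge0.
rewrite lt_def x0 andbT; apply/eqP => x00.
suff : x = 0 by move=> x_0; have := model_neq0 Mx; rewrite x_0 eqxx.
apply/colP => r; rewrite [RHS]mxE; case: (unliftP ord0 r) => [i ->|->//].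
by have := h i; rewrite x00 mulr0 normr_le0 => /eqP.
Qed.

Lemma tiny_head_le2 e x : 0 < e -> n%:R * e ^+ 2 <= 3 / 4 -> tiny e x ->
  x 0 0 <= 2 /\ `|x 0 0 - 1| <= 4 * (n%:R * e ^+ 2).
Proof.
move=> e0 ne tx; have x0 := tiny_head_gt0 e0 tx; move/tinyP: tx => [Mx h].
have S : \sum_i x (lift ord0 i) 0 ^+ 2 <= n%:R * e ^+ 2 * x 0 0 ^+ 2.
  rewrite -mulrA -exprMn -[n in n%:R]card_ord mulr_natl -sumr_const.
  by apply: ler_sum => i _; rewrite -real_normK ?num_real// lerXn2r ?nnegrE ?mulr_ge0// ltW.
have S0 := sum_sq_ge0 (fun i => x (lift ord0 i) 0).
have := model_qform Mx; rewrite qformE.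
move: (\sum_i _) S S0 => s S S0 q.
move: (x 0 0) x0 q S => t t0 q S.
have t4 : t ^+ 2 <= 4.
  move: q; rewrite /curvature; case: X => q; nra.
have t2 : t <= 2 by nra.
split=> //; have : `|t ^+ 2 - 1| <= 4 * (n%:R * e ^+ 2).
  have : `|t ^+ 2 - 1| = s.
    move: q; rewrite /curvature; case: X => q.
      by rewrite ger0_norm; lra.
    by rewrite ler0_norm; lra.
  move=> ->; apply: le_trans S _; rewrite mulrC ler_wpM2r//.
  by rewrite mulr_ge0// sqr_ge0.
apply: le_trans; have -> : t ^+ 2 - 1 = (t - 1) * (t + 1) by ring.
by rewrite normrM ler_peMr// ger0_norm; lra.
Qed.

Lemma inv_bound (B : 'M[R]_n) : B \in unitmx -> exists2 c, 0 < c &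
  forall (w : 'I_n -> R) e, 0 <= e -> (forall i, `|\sum_j B i j * w j| <= e) ->
    forall j, `|w j| <= c * e.
Proof.
move=> Bu; exists (1 + \sum_j \sum_i `|invmx B j i|).
  rewrite ltr_pwDl//; apply: sumr_ge0 => *; apply: sumr_ge0 => *; exact: normr_ge0.
move=> w e e0 h j; pose W : 'cV[R]_n := \col_j w j.
have -> : w j = \sum_i invmx B j i * (B *m W) i 0.
  have : W j 0 = (invmx B *m (B *m W)) j 0 by rewrite mulKmx.
  by rewrite {1}/W !mxE => ->.
apply: le_trans (ler_norm_sum _ _ _) _.
apply: (@le_trans _ _ (\sum_i `|invmx B j i| * e)).
  apply: ler_sum => i _; rewrite normrM ler_wpM2l//.
  rewrite mxE; have := h i; congr (`|_| <= _).
  by apply: eq_bigr => k _; rewrite mxE.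
rewrite -mulr_suml ler_wpM2r//.
apply: (@le_trans _ _ (\sum_j \sum_i `|invmx B j i|)); last by rewrite lerDr.
rewrite [leRHS](bigD1 j)//= lerDl.
apply: sumr_ge0 => *; apply: sumr_ge0 => *; exact: normr_ge0.
Qed.

(** Up to the factor [1 + th], membership of [pt z] in a small cube with centre
    [pt u] is a condition on [z - u] that is linear and does not depend on [u]. *)
Definition approx_radius u0 (th r : R) := forall u z,
  (forall i, `|u 0 i - u0 0 i| < r) -> (forall i, `|z 0 i - u0 0 i| < r) ->
  [/\ in_chart X u /\ in_chart X z,
      `|ph 0 u - ph 0 u0| <= th * ph 0 u0,
      forall e, 0 <= e ->
        (forall i, `|\sum_j dslope X u0 i j * (z 0 j - u 0 j)| <= e) ->
        tiny (e * (1 + th)) (invmx (frame X u) *m pt X z) &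
      forall e, 0 <= e -> tiny e (invmx (frame X u) *m pt X z) ->
        forall i, `|\sum_j dslope X u0 i j * (z 0 j - u 0 j)| <= e * (1 + th)].

(** By [slopeP] the frame coordinates of [pt z] are the entries of
    [B *m (z - u)] for a matrix [B] close to [dslope u0]. As [dslope u0] is
    invertible, the error is small relative to the coordinates themselves. *)
Lemma tiny_approx u0 (th : R) : in_chart X u0 -> 0 < th <= 1 ->
  exists2 r, 0 < r & approx_radius u0 th r.
Proof.
move=> du0 /andP[th0 th1].
have [c c0 cP] := inv_bound (dslope_unit du0).
have h0 := ph_gt0 0 du0.
have nc0 : 0 < 4 * (n%:R * c + 1) by rewrite mulr_gt0// ltr_wpDl// mulr_ge0// ltW.
(* The first bound makes both the error of the head and [n * c] times the error
   of the slopes at most [th / 4]. *)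
pose eta := Num.min (th / (4 * (n%:R * c + 1))) (th * ph 0 u0).
have eta0 : 0 < eta by rewrite lt_min divr_gt0// mulr_gt0.
have eta1 : n%:R * (eta * c) <= th / 4.
  have : eta <= th / (4 * (n%:R * c + 1)) by rewrite ge_min lexx.
  rewrite ler_pdivlMr// => h.
  have : 0 <= eta by exact: ltW.
  lra.
have eta2 : eta <= th / 4.
  have : eta <= th / (4 * (n%:R * c + 1)) by rewrite ge_min lexx.
  rewrite ler_pdivlMr// => h.
  have h' : 0 <= n%:R * c by rewrite mulr_ge0// ltW.
  have h'' : 0 <= eta * (n%:R * c) by rewrite mulr_ge0// ltW.
  lra.
have [r r0 rP] := near_chart du0 eta0.
exists r => // u z ur zr.
have [[du dz] hs hb hh _] := rP u z ur zr.
set x := invmx (frame X u) *m pt X z.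
have iu := frame_isometry du.
have Mx : M x by apply: isometry_model; [exact: isometryV | exact: pt_model].
have x0 : `|x 0 0 - 1| <= eta by rewrite /x inv_frame0.
pose v i := \sum_j dslope X u0 i j * (z 0 j - u 0 j).
have xv e i : 0 <= e -> (forall i, `|v i| <= e) ->
    `|x (lift ord0 i) 0 - v i| <= th / 4 * e.
  move=> e0 ve; rewrite /x slopeP// /v -sumrB.
  apply: le_trans (ler_norm_sum _ _ _) _.
  apply: (@le_trans _ _ (\sum_(j < n) eta * (c * e))).
    apply: ler_sum => j _; rewrite -mulrBl normrM ler_pM//.
    exact: (cP (fun j => z 0 j - u 0 j)).
  rewrite sumr_const card_ord -[_ *+ n]mulr_natl mulrA mulrA -[n%:R * _ * _]mulrA.
  by rewrite ler_wpM2r.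
have x01 : 1 - eta <= x 0 0 <= 1 + eta by move: x0; rewrite ler_distl.
move/andP: x01 => [x0l x0u].
split=> //; first by rewrite (le_trans hh)// ge_min lexx orbT.
- move=> e e0 ve; apply/tinyP; split=> // i.
  have := xv e i e0 ve; rewrite ler_distl => /andP[h1 h2].
  have := ve i; rewrite -/(v i) ler_norml => /andP[v1 v2].
  have h3 : e * (1 + th / 4) <= e * (1 + th) * x 0 0.
    rewrite -mulrA ler_wpM2l//.
    apply: (@le_trans _ _ ((1 + th) * (1 - th / 4))); first by nra.
    by rewrite ler_wpM2l//; lra.
  by rewrite ler_norml; apply/andP; split; lra.
- move=> e e0 /tinyP[_ tx] i; rewrite -/(v i).
  (* The error at any index is relative to the largest entry of [v]. *)
  have [k _ kP] := @arg_maxP _ _ _ i xpredT (fun i => `|v i|) isT.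
  have E0 : 0 <= `|v k| by exact: normr_ge0.
  have vE j : `|v j| <= `|v k| by exact: kP.
  have := xv _ k E0 vE => h1.
  have h2 : `|v k| <= `|x (lift ord0 k) 0| + th / 4 * `|v k|.
    rewrite -lerBlDl; apply: le_trans h1; rewrite distrC.
    exact: lerB_dist.
  have h3 := tx k.
  have h4 : `|v k| * (1 - th / 4) <= e * (1 + th / 4).
    have : e * x 0 0 <= e * (1 + th / 4) by rewrite ler_wpM2l//; lra.
    lra.
  apply: le_trans (vE i) _.
  have p : 0 < 1 - th / 4 by lra.
  rewrite -(ler_pM2r p); apply: le_trans h4 _; rewrite -mulrA ler_wpM2l//.
  nra.
Qed.

(** The points of [tiny e] are at distance [O(e)] from the base point, and the
    entries of [frame X u] are bounded near [u0]. *)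
Lemma tiny_in_chart u0 (r : R) : in_chart X u0 -> 0 < r ->
  exists2 r', 0 < r' & exists2 e0, 0 < e0 &
  forall u, (forall i, `|u 0 i - u0 0 i| < r') ->
  forall e, 0 < e < e0 -> forall x, tiny e x ->
  exists z, [/\ in_chart X z, (forall i, `|z 0 i - u0 0 i| < r) &
     frame X u *m x = pt X z].
Proof.
move=> du0 r_gt0; have h0 := ph_gt0 0 du0.
pose m := Num.min (r / 2) (ph 0 u0 / 4).
have m0 : 0 < m by rewrite lt_min !divr_gt0.
have [r1 r10 r1P] := near_chart du0 m0.
pose K := m + \sum_a \sum_b `|frame X u0 a b|.
have K0 : 0 < K.
  by rewrite ltr_wpDr//; apply: sumr_ge0 => *; apply: sumr_ge0 => *; exact: normr_ge0.
have nn : (0 : R) < n%:R by rewrite ltr0n.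
pose e0 := Num.min (1 / (2 * n%:R)) (m / (4 * (K * n%:R))).
have e00 : 0 < e0 by rewrite lt_min !divr_gt0// !mulr_gt0.
exists (Num.min r1 (r / 2)); first by rewrite lt_min r10 divr_gt0.
exists e0 => // u ur e /andP[e_gt0]; rewrite lt_min => /andP[e1 e2] x tx.
have ur1 i : `|u 0 i - u0 0 i| < r1.
  by have := ur i; rewrite lt_min => /andP[].
have ur2 i : `|u 0 i - u0 0 i| < r / 2.
  by have := ur i; rewrite lt_min => /andP[].
have [[du _] _ _ hh hf] := r1P u u ur1 ur1.
have fK a b : `|frame X u a b| <= K.
  have := hf a b; rewrite ler_distl => h; apply: (@le_trans _ _ (m + `|frame X u0 a b|)).
    have := ler_norm (frame X u0 a b); have := ler_norm (- frame X u0 a b).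
    by rewrite normrN ler_norml; move/andP: h => [] *; apply/andP; split; lra.
  rewrite lerD2l (bigD1 a)//= (bigD1 b)//= -addrA lerDl addr_ge0//.
    by apply: sumr_ge0 => *; exact: normr_ge0.
  by apply: sumr_ge0 => *; apply: sumr_ge0 => *; exact: normr_ge0.
have n1 : (1 : R) <= n%:R by rewrite ler1n.
have ne1 : n%:R * e < 1 / 2.
  by move: e1; rewrite ltr_pdivlMr ?mulr_gt0//; lra.
have e1' : e <= n%:R * e by rewrite ler_peMl// ltW.
have nee : n%:R * e ^+ 2 <= n%:R * e * (1/2).
  by rewrite expr2 mulrA ler_wpM2l// ?mulr_ge0 ?ltW//; lra.
have [|x2 x1] := @tiny_head_le2 e x e_gt0 _ tx; first by lra.
have /tinyP[Mx hx] := tx.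
have x0 := tiny_head_gt0 e_gt0 tx.
(* The head moves by [4 n e^2 <= 2 n e]; the [n] other entries are at most [2 e]. *)
have near_pt a : `|(frame X u *m x) a 0 - pt X u a 0| <= K * (4 * (n%:R * e)).
  rewrite mxE big_ord_recl -col_frame0 [in X in _ - X]mxE addrAC.
  have -> : frame X u a ord0 * x ord0 0 - frame X u a 0 =
    frame X u a 0 * (x 0 0 - 1) by rewrite mulrBr mulr1.
  apply: le_trans (ler_normD _ _) _.
  have -> : K * (4 * (n%:R * e)) = K * (2 * (n%:R * e)) + K * (2 * (n%:R * e)).
    by ring.
  have : `|frame X u a 0 * (x 0 0 - 1)| <= K * (2 * (n%:R * e)).
    by rewrite normrM ler_pM//; lra.
  have : `|\sum_(i < n) frame X u a (lift ord0 i) * x (lift ord0 i) 0| <=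
      K * (2 * (n%:R * e)).
    apply: le_trans (ler_norm_sum _ _ _) _.
    apply: (@le_trans _ _ (\sum_(i < n) K * (2 * e))).
      apply: ler_sum => i _; rewrite normrM ler_pM//.
      apply: le_trans (hx i) _; rewrite [2 * e]mulrC ler_wpM2l//; exact: ltW.
    rewrite sumr_const card_ord -[_ *+ n]mulr_natl; lra.
  by move=> *; lra.
have small : K * (4 * (n%:R * e)) < m.
  by move: e2; rewrite ltr_pdivlMr ?mulr_gt0// => e2; lra.
have My : M (frame X u *m x) by apply: isometry_model => //; exact: frame_isometry.
have y0 : 0 < (frame X u *m x) 0 0.
  have := near_pt 0; rewrite pt0 ler_distl => /andP[h1 _].
  have mh : m <= ph 0 u0 / 4 by rewrite ge_min lexx orbT.
  by move: hh; rewrite ler_distl => /andP[h2 _]; lra.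
have [dz yz] := pt_in_chart My y0.
exists (\row_j (frame X u *m x) (lift ord0 j) 0); split=> // i.
rewrite mxE; have := near_pt (lift ord0 i); rewrite ptS => h.
have mr : m <= r / 2 by rewrite ge_min lexx.
have -> : (frame X u *m x) (lift ord0 i) 0 - u0 0 i =
  ((frame X u *m x) (lift ord0 i) 0 - u 0 i) + (u 0 i - u0 0 i) by ring.
by apply: le_lt_trans (ler_normD _ _) _; have := ur2 i; lra.
Qed.

End tiny.

(** * Counting disjoint sets of equal measure *)

Lemma seqUP (T : Type) (I : eqType) (D : I -> set T) (s : seq I) x :
  (\big[setU/set0]_(i <- s) D i) x <-> exists2 i, i \in s & D i x.
Proof.
elim: s => [|i s IH]; first by rewrite big_nil; split=> // -[].
rewrite big_cons; split=> [[Dx|/IH[j js Dx]]|[j]].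
- by exists i; rewrite ?mem_head.
- by exists j; rewrite // in_cons js orbT.
- by rewrite in_cons => /orP[/eqP -> ?|js Dx]; [left|right; apply/IH; exists j].
Qed.

Section counting.
Context d (T : measurableType d) (R : realType) (mu : {measure set T -> \bar R}).
Variables (I : eqType) (D : I -> set T).
Hypothesis mD : forall i, measurable (D i).

Lemma measurable_seqU (s : seq I) : measurable (\big[setU/set0]_(i <- s) D i).
Proof.
elim: s => [|i s IH]; first by rewrite big_nil.
by rewrite big_cons; exact: measurableU.
Qed.

Lemma measure_seqU (s : seq I) : uniq s ->
  (forall i j, i != j -> D i `&` D j = set0) ->
  mu (\big[setU/set0]_(i <- s) D i) = (\sum_(i <- s) mu (D i))%E.
Proof.
move=> + disj; elim: s => [|i s IH]; first by rewrite !big_nil measure0.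
rewrite cons_uniq !big_cons => /andP[nis /IH <-].
rewrite measureU//; first exact: measurable_seqU.
apply/seteqP; split=> // x [Dx /seqUP[j js Djx]].
have ij : i != j by apply: contraNneq nis => ->.
by have : (D i `&` D j) x by []; rewrite disj.
Qed.

Lemma measure_seqU_le (s : seq I) :
  (mu (\big[setU/set0]_(i <- s) D i) <= \sum_(i <- s) mu (D i))%E.
Proof.
elim: s => [|i s IH]; first by rewrite !big_nil measure0.
rewrite !big_cons; apply: le_trans (measureU2 _ _ _) _ => //.
  exact: measurable_seqU.
exact: leeD2l.
Qed.

Lemma sum_const_seq (c : R) (s : seq I) :
  (forall i, i \in s -> mu (D i) = c%:E) ->
  (\sum_(i <- s) mu (D i))%E = ((size s)%:R * c)%:E.
Proof.
elim: s => [|i s IH] h; first by rewrite big_nil mul0r.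
rewrite big_cons h ?mem_head// IH => [|j js]; last by rewrite h// in_cons js orbT.
by rewrite -EFinD /= -natr1; congr (_%:E); ring.
Qed.

(** Since at most [b / c] of the disjoint sets fit into [E], there is a duplicate-free
    list of indices of maximal length, and maximality makes it complete. *)
Lemma count_disjoint (S : I -> Prop) (E : set T) (c b : R) : 0 < c ->
  measurable E -> (forall i j, i != j -> D i `&` D j = set0) ->
  (forall i, S i -> mu (D i) = c%:E /\ D i `<=` E) -> (mu E <= b%:E)%E ->
  exists2 s : seq I, uniq s /\ (forall i, i \in s <-> S i) & (size s)%:R * c <= b.
Proof.
move=> c0 mE disj SD Eb.
have bound (s : seq I) : uniq s -> (forall i, i \in s -> S i) -> (size s)%:R * c <= b.
  move=> us sS; rewrite -lee_fin; apply: le_trans Eb.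
  rewrite -sum_const_seq => [|i /sS /SD[]//]; rewrite -measure_seqU//.
  apply: le_measure; rewrite ?inE//; first exact: measurable_seqU.
  by move=> x /seqUP[i /sS /SD[_]]; apply.
pose P m := `[< exists2 s : seq I, uniq s & (forall i, i \in s -> S i) /\ size s = m >].
have P0 : exists m, P m by exists 0%N; apply/asboolP; exists [::].
have Pb m : P m -> (m <= Num.bound (b / c))%N.
  move=> /asboolP[s us [sS <-]]; have h := bound s us sS.
  rewrite -(ler_nat R); apply/ltW; apply: le_lt_trans (archi_boundP _).
    by rewrite ler_pdivlMr.
  rewrite divr_ge0// ?(ltW c0)//; apply: le_trans h; by rewrite mulr_ge0// ltW.
have [m /asboolP[s us [sS sm]] mmax] := ex_maxnP P0 Pb.
exists s; last exact: bound.
split=> // i; split; first exact: sS.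
move=> Si; apply/negPn/negP => nis.
have : (m.+1 <= m)%N; last by rewrite ltnn.
apply: mmax; apply/asboolP; exists (i :: s); rewrite /= ?nis//.
by split; rewrite ?sm// => j; rewrite in_cons => /orP[/eqP ->|/sS].
Qed.

End counting.

(** * Coverings and packings by copies of a small cube *)

Section coverings.
Context {R : realType} (X : geometry) (n : nat).
Hypothesis n_gt0 : (0 < n)%N.
Implicit Types (g h : 'M[R]_n.+1) (A B : set 'cV[R]_n.+1) (c e : R).
Local Notation tiny := (@tiny R X n).
Local Notation copy e g := (mulmx (g : 'M[R]_n.+1) @` tiny e).

(** [(2 e)^n] is the leading term of the volume of [tiny e], so that [c] stands for a
    volume. All small [e] are asked for because a covering of one set and a packing
    of another have to be compared for the same [e]. *)
Definition coverable A c := exists2 e0, 0 < e0 & forall e, 0 < e < e0 ->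
  exists2 s : seq 'M[R]_n.+1, {in s, forall g, is_isometry X g} &
    A `<=` [set x | exists2 g, g \in s & copy e g x] /\
    (size s)%:R * (2 * e) ^+ n <= c.

Definition packable A c := exists2 e0, 0 < e0 & forall e, 0 < e < e0 ->
  exists2 s : seq 'M[R]_n.+1, uniq s /\
      {in s, forall g, is_isometry X g /\ copy e g `<=` A} &
    {in s &, forall g h, copy e g `&` copy e h !=set0 -> g = h} /\
    c <= (size s)%:R * (2 * e) ^+ n.

Lemma coverableS A B c c' : A `<=` B -> c <= c' -> coverable B c -> coverable A c'.
Proof.
move=> AB cc' [e0 e00 H]; exists e0 => // e /H[s sI [Bs sc]].
by exists s => //; split; [exact: subset_trans Bs | exact: le_trans cc'].
Qed.

Lemma packableS A B c c' : A `<=` B -> c' <= c -> packable A c -> packable B c'.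
Proof.
move=> AB cc' [e0 e00 H]; exists e0 => // e /H[s [us sI] [sd sc]].
exists s; split => //; last exact: le_trans sc.
by move=> g /sI[? gA]; split=> //; exact: subset_trans AB.
Qed.

Lemma coverableU A B c c' : coverable A c -> coverable B c' ->
  coverable (A `|` B) (c + c').
Proof.
move=> [a a0 Ha] [b b0 Hb]; exists (Num.min a b); first by rewrite lt_min a0.
move=> e /andP[e0]; rewrite lt_min => /andP[ea eb].
have [|s sI [As sc]] := Ha e; first by rewrite e0.
have [|t tI [Bt tc]] := Hb e; first by rewrite e0.
exists (s ++ t) => [g|]; first by rewrite mem_cat => /orP[/sI|/tI].
split; last by rewrite size_cat natrD mulrDl lerD.
by move=> x [/As|/Bt] [g gs gx]; exists g => //; rewrite mem_cat gs ?orbT.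
Qed.

Lemma coverable_image g A c : is_isometry X g -> coverable A c ->
  coverable (mulmx g @` A) c.
Proof.
move=> ig [e0 e00 H]; exists e0 => // e /H[s sI [As sc]].
exists [seq g *m h | h <- s].
  by move=> h /mapP[k ks ->]; apply: isometryM => //; exact: sI.
split; last by rewrite size_map.
move=> _ [x /As[h hs [y ty <-]] <-]; exists (g *m h); first exact: map_f.
by exists y => //; rewrite mulmxA.
Qed.

Lemma packable_image g A c : is_isometry X g -> packable A c ->
  packable (mulmx g @` A) c.
Proof.
move=> ig [e0 e00 H]; exists e0 => // e /H[s [us sI] [sd sc]].
have gu := isometry_unit ig.
exists [seq g *m h | h <- s]; split; last 2 first.
- move=> _ _ /mapP[h hs ->] /mapP[k ks ->] [_ [[x tx <-] [y ty /= xy]]].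
  congr (_ *m _); apply: sd => //; exists (h *m x); split; first by exists x.
  by exists y => //; apply: (can_inj (mulKmx gu)); rewrite !mulmxA.
- by rewrite size_map.
- by rewrite map_inj_uniq//; exact: can_inj (mulKmx gu).
- move=> _ /mapP[h hs ->]; have [ih hA] := sI h hs; split; first exact: isometryM.
  move=> _ [x tx <-]; exists (h *m x); last by rewrite mulmxA.
  by apply: hA; exists x.
Qed.

Lemma tiny_base e : 0 < e -> tiny e (delta_mx 0 0).
Proof.
move=> e0; apply/tinyP; split; last first.
  by move=> i; rewrite !mxE /= normr0 mulr1 ltW.
have q0 : qform X (delta_mx 0 0 : 'cV[R]_n.+1) = curvature X.
  by rewrite /qform bform_delta0 mxE !eqxx mulr1.
by move: q0; rewrite /model_space /curvature; case: X => //= ->; rewrite mxE eqxx.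
Qed.

Lemma packableU A B c c' : A `&` B = set0 -> packable A c -> packable B c' ->
  packable (A `|` B) (c + c').
Proof.
move=> AB [a a0 Ha] [b b0 Hb]; exists (Num.min a b); first by rewrite lt_min a0.
move=> e /andP[e0]; rewrite lt_min => /andP[ea eb].
have [|s [us sI] [sd sc]] := Ha e; first by rewrite e0.
have [|t [ut tI] [td tc]] := Hb e; first by rewrite e0.
have cross g h x : g \in s -> h \in t -> copy e g x -> copy e h x -> False.
  move=> /sI[_ gA] /tI[_ hB] /gA Ax /hB Bx.
  by have : (A `&` B) x by []; rewrite AB.
exists (s ++ t); split.
- rewrite cat_uniq us ut andbT /=; apply/hasPn => g gt; apply/negP => gs.
  have tb := tiny_base e0.
  by apply: (cross g g (g *m delta_mx 0 0)) => //; exists (delta_mx 0 0).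
- move=> g; rewrite mem_cat => /orP[/sI|/tI] [? gA]; split=> // x /gA; by [left|right].
- move=> g h; rewrite !mem_cat => /orP[] gs /orP[] hs [x [gx hx]].
  + by apply: sd => //; exists x.
  + by case: (cross _ _ _ gs hs gx hx).
  + by case: (cross _ _ _ hs gs hx gx).
  + by apply: td => //; exists x.
- by rewrite size_cat natrD mulrDl lerD.
Qed.

Lemma coverable0 c : 0 <= c -> coverable set0 c.
Proof.
move=> c0; exists 1 => // e _; exists [::] => //; split=> //.
by rewrite mul0r.
Qed.

Lemma packable0 A c : c <= 0 -> packable A c.
Proof. by move=> c0; exists 1 => // e _; exists [::]; split=> //; rewrite mul0r. Qed.

Lemma coverable_seqU (I : eqType) (s : seq I) (A : I -> set 'cV[R]_n.+1) (c : I -> R) :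
  (forall i, i \in s -> coverable (A i) (c i)) ->
  coverable (\big[setU/set0]_(i <- s) A i) (\sum_(i <- s) c i).
Proof.
elim: s => [|i s IH] h; first by rewrite !big_nil; exact: coverable0.
rewrite !big_cons; apply: coverableU; first by apply: h; rewrite mem_head.
by apply: IH => j js; apply: h; rewrite in_cons js orbT.
Qed.

Lemma packable_seqU (I : eqType) (s : seq I) (A : I -> set 'cV[R]_n.+1) (c : I -> R) :
  uniq s -> (forall i j, i != j -> A i `&` A j = set0) ->
  (forall i, i \in s -> packable (A i) (c i)) ->
  packable (\big[setU/set0]_(i <- s) A i) (\sum_(i <- s) c i).
Proof.
move=> + disj; elim: s => [|i s IH] us h; first by rewrite !big_nil; exact: packable0.
move: us; rewrite cons_uniq => /andP[nis us]; rewrite !big_cons; apply: packableU.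
- apply/seteqP; split=> // x [Dx /seqUP[j js Djx]].
  have ij : i != j by apply: contraNneq nis => ->.
  by have : (A i `&` A j) x by []; rewrite disj.
- by apply: h; rewrite mem_head.
- by apply: IH => // j js; apply: h; rewrite in_cons js orbT.
Qed.

(** A covering of [P] has no more members than the packing of [Q], so that each
    member of the covering can be sent to its own member of the packing. *)
Lemma scissors_of_counts (P Q : set 'cV[R]_n.+1) c : polytope X P ->
  coverable P c -> packable Q c -> scissors_embeds X P Q.
Proof.
move=> pP [a a0 Ha] [b b0 Hb].
pose e := Num.min a b / 2.
have m0 : 0 < Num.min a b by rewrite lt_min a0.
have e0 : 0 < e by rewrite divr_gt0.
have em : e < Num.min a b by rewrite ltr_pdivrMr//; lra.
move: em; rewrite lt_min => /andP[ea eb].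
have [|s sI [Ps sc]] := Ha e; first by rewrite e0.
have [|t [ut tI] [td tc]] := Hb e; first by rewrite e0.
have st : (size s <= size t)%N.
  have e2 : 0 < (2 * e) ^+ n by rewrite exprn_gt0// mulr_gt0.
  by rewrite -(ler_nat R) -(ler_pM2r e2) (le_trans sc).
pose g (i : 'I_(size s)) := tnth (in_tuple s) i.
pose h (i : 'I_(size s)) := nth 1%:M t i.
have hs i : h i \in t by apply: mem_nth; exact: leq_trans (ltn_ord i) st.
apply: (@scissors_of_covering R X n (tiny_facets n e) (size s) g h) => //.
- exact: tiny_facets_neq0.
- by move=> i; apply: sI; exact: mem_tnth.
- by move=> i; exact: (tI _ (hs i)).1.
- move=> x /Ps[k ks kx]; have ki : (index k s < size s)%N by rewrite index_mem.
  exists (Ordinal ki) => //; rewrite /g (tnth_nth k) /= nth_index//.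
- by move=> i; exact: (tI _ (hs i)).2.
- move=> i j _ _ ij; have := td _ _ (hs i) (hs j) ij.
  move=> /eqP; rewrite nth_uniq// ?(leq_trans (ltn_ord _) st)//.
  by move=> /eqP; exact: val_inj.
Qed.

End coverings.

(** * Boxes in the chart *)

Section boxes.
Context {R : realType} (X : geometry) (n : nat).
Hypothesis n_gt0 : (0 < n)%N.
Local Notation T := (n.-tuple (measurableTypeR R)).
Local Notation lam := (@lebesgue_tuple R n).
Local Notation ph := (partial_height X).
Local Notation dmu := (@density_measure R X n).
Implicit Types (y w : n.-tuple R) (i j : 'I_n) (b : 'I_n -> R).

Definition box b (rho : R) : set T := parallelepiped 1%:M b rho.

Lemma boxP b rho y : box b rho y <-> forall i, b i <= tnth y i < b i + rho.
Proof.
have E i : \sum_j (1%:M : 'M[R]_n) i j * tnth y j = tnth y i.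
  rewrite (bigD1 i)//= mxE eqxx mul1r big1 ?addr0// => j ji.
  by rewrite mxE eq_sym (negbTE ji) mul0r.
by split=> h i; have := h i; rewrite E.
Qed.

Lemma measurable_box b rho : measurable (box b rho).
Proof. exact: measurable_parallelepiped. Qed.

Lemma lebesgue_box b rho : 0 < rho -> lam (box b rho) = (rho ^+ n)%:E.
Proof.
move=> r0; rewrite lebesgue_parallelepiped//.
- by rewrite big1 ?divr1// => i _; rewrite mxE eqxx.
- by move=> i j ji; rewrite mxE -val_eqE gtn_eqF.
- by move=> i; rewrite mxE eqxx.
Qed.

Definition chart_image (A : set T) : set 'cV[R]_n.+1 :=
  (fun y => pt X (rowt y)) @` A.

Definition lattice_cell (B : 'M[R]_n) (e : R) (k : {ffun 'I_n -> int}) : set T :=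
  parallelepiped B (fun i => 2 * e * (k i)%:~R) (2 * e).

Lemma lattice_cell_disjoint B e k k' : 0 < e -> k != k' ->
  lattice_cell B e k `&` lattice_cell B e k' = set0.
Proof.
move=> e0 kk'; apply/seteqP; split=> // y [yk yk']; case/eqP: kk'.
apply/ffunP => i; have := yk i; have := yk' i.
move: (\sum_j _) => s /andP[h1 h2] /andP[h3 h4].
have e2 : 0 < 2 * e by rewrite mulr_gt0.
have lt1 : (k i)%:~R < (k' i + 1)%:~R :> R.
  by rewrite -(ltr_pM2l e2) intrD mulrDr mulr1; lra.
have lt2 : (k' i)%:~R < (k i + 1)%:~R :> R.
  by rewrite -(ltr_pM2l e2) intrD mulrDr mulr1; lra.
by move: lt1 lt2; rewrite !ltr_int => lt1 lt2; lia.
Qed.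

Lemma lattice_cell_cover B e y : 0 < e -> exists k, lattice_cell B e k y.
Proof.
move=> e0; have e2 : 0 < 2 * e by rewrite mulr_gt0.
exists [ffun i => Num.floor ((\sum_j B i j * tnth y j) / (2 * e))] => i.
rewrite ffunE; set s := \sum_j _.
have /andP[h1 h2] := floor_itv (s / (2 * e)).
move: h1 h2; rewrite ler_pdivlMr// ltr_pdivrMr// intrD => h1 h2.
by apply/andP; split; lra.
Qed.

Lemma lattice_cell_diff B e k y w i : lattice_cell B e k y -> lattice_cell B e k w ->
  `|\sum_j B i j * (tnth y j - tnth w j)| <= 2 * e.
Proof.
move=> /(_ i) yk /(_ i) wk.
have -> : \sum_j B i j * (tnth y j - tnth w j) =
    \sum_j B i j * tnth y j - \sum_j B i j * tnth w j.
  by rewrite -sumrB; apply: eq_bigr => j _; rewrite mulrBr.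
rewrite ler_norml; move/andP: yk => [? ?]; move/andP: wk => [? ?].
by apply/andP; split; lra.
Qed.

Definition untup (u : 'rV[R]_n) : n.-tuple R := [tuple u 0 i | i < n].

Lemma rowtK y : untup (rowt y) = y.
Proof. by apply: eq_from_tnth => i; rewrite tnth_mktuple mxE. Qed.

Lemma untupK u : rowt (untup u) = u.
Proof. by apply/rowP => i; rewrite mxE tnth_mktuple. Qed.

Definition cell_centre (B : 'M[R]_n) (e : R) (k : {ffun 'I_n -> int}) : n.-tuple R :=
  untup (invmx B *m (\col_i (2 * e * (k i)%:~R + e)))^T.

Lemma cell_centreE B e k i : B \in unitmx ->
  \sum_j B i j * tnth (cell_centre B e k) j = 2 * e * (k i)%:~R + e.
Proof.
move=> Bu; have : (B *m (invmx B *m (\col_i (2 * e * (k i)%:~R + e)))) i 0 =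
    2 * e * (k i)%:~R + e by rewrite mulKVmx// mxE.
move=> <-; rewrite mxE; apply: eq_bigr => j _.
by rewrite tnth_mktuple mxE.
Qed.

Lemma cell_centre_in B e k : 0 < e -> B \in unitmx ->
  lattice_cell B e k (cell_centre B e k).
Proof. by move=> e0 Bu i; rewrite cell_centreE//; apply/andP; split; lra. Qed.

Lemma cell_centre_sub B e k y i : B \in unitmx ->
  \sum_j B i j * (tnth y j - tnth (cell_centre B e k) j) =
  \sum_j B i j * tnth y j - (2 * e * (k i)%:~R + e).
Proof.
move=> Bu; rewrite -(cell_centreE _ _ _ Bu) -sumrB.
by apply: eq_bigr => j _; rewrite mulrBr.
Qed.

Lemma cell_centre_diff B e k y i : B \in unitmx -> lattice_cell B e k y ->
  `|\sum_j B i j * (tnth y j - tnth (cell_centre B e k) j)| <= e.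
Proof.
move=> Bu /(_ i) /andP[h1 h2]; rewrite cell_centre_sub//.
by rewrite ler_norml; apply/andP; split; lra.
Qed.

Lemma cell_centre_near B e k y : B \in unitmx ->
  (forall i, `|\sum_j B i j * (tnth y j - tnth (cell_centre B e k) j)| < e) ->
  lattice_cell B e k y.
Proof.
move=> Bu h i; have := h i; rewrite cell_centre_sub//.
by rewrite ltr_norml => /andP[? ?]; apply/andP; split; lra.
Qed.

Lemma lebesgue_lattice_cell u e k : in_chart X u -> 0 < e ->
  lam (lattice_cell (dslope X u) e k) = ((2 * e) ^+ n * ph 0 u)%:E.
Proof.
move=> du e0; rewrite lebesgue_parallelepiped ?mulr_gt0//.
- congr (_%:E); congr (_ * _).
  have <- : \det (dslope X u) = \prod_i dslope X u i i.
    rewrite -det_tr det_trig; last first.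
      by apply/is_trig_mxP => i j ij; rewrite mxE dslope_low.
    by apply: eq_bigr => i _; rewrite mxE.
  by rewrite det_dslope// invrK.
- by move=> i j; exact: dslope_low.
- by move=> i; exact: dslope_diag_gt0.
Qed.

Lemma near_power (rho c th : R) : 0 < rho -> 0 < th -> exists2 e0, 0 < e0 &
  forall e, 0 < e < e0 -> [/\ (rho + c * e) ^+ n <= (1 + th) * rho ^+ n,
     rho ^+ n <= (1 + th) * (rho - c * e) ^+ n & 0 < rho - c * e].
Proof.
move=> r0 th0; have rn : 0 < rho ^+ n by exact: exprn_gt0.
have cp : (rho + c * t) ^+ n @[t --> (0:R)] --> rho ^+ n.
  apply: (cvg_comp (fun t : R => rho + c * t) (fun x => x ^+ n) (G := nbhs rho)).
    have {2}-> : rho = rho + c * 0 by rewrite mulr0 addr0.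
    by apply: cvgD; [exact: cvg_cst | apply: cvgM; [exact: cvg_cst|exact: cvg_id]].
  exact: exprn_continuous.
have cm0 : rho - c * t @[t --> (0:R)] --> rho.
  have {2}-> : rho = rho - c * 0 by rewrite mulr0 subr0.
  by apply: cvgB; [exact: cvg_cst | apply: cvgM; [exact: cvg_cst|exact: cvg_id]].
have cm : (1 + th) * (rho - c * t) ^+ n @[t --> (0:R)] --> (1 + th) * rho ^+ n.
  apply: cvgM; first exact: cvg_cst.
  apply: (cvg_comp (fun t : R => rho - c * t) (fun x => x ^+ n) (G := nbhs rho)) => //.
  exact: exprn_continuous.
have H : \forall t \near (0:R), [/\ (rho + c * t) ^+ n < (1 + th) * rho ^+ n,
     rho ^+ n < (1 + th) * (rho - c * t) ^+ n & 0 < rho - c * t].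
  near=> t; split; near: t.
  - by apply: (cvgr_lt _ cp); rewrite ltr_pMl// ltrDl.
  - by apply: (cvgr_gt _ cm); rewrite ltr_pMl// ltrDl.
  - exact: (cvgr_gt _ cm0).
have [e0 /= e00 h] := H; exists e0 => // e /andP[e1 e2].
have [|h1 h2 h3] := h e; last by split=> //; exact: ltW.
by rewrite /ball_ /= sub0r normrN gtr0_norm.
Unshelve. all: by end_near.
Qed.

Lemma trans_lt_dist (p q r x y z : R) :
  `|x - y| <= p -> `|x - z| < q -> p + q <= r -> `|y - z| < r.
Proof.
rewrite ler_distl => /andP[? ?]; rewrite !ltr_distl => /andP[? ?] ?.
by apply/andP; split; lra.
Qed.

Lemma enlarge_itv (d l q x y : R) :
  `|x - y| <= d -> l <= y < l + q -> l - d <= x < l - d + (q + 2 * d).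
Proof. by rewrite ler_distl => /andP[? ?] /andP[? ?]; apply/andP; split; lra. Qed.

Lemma shrink_itv (d l q x y : R) :
  `|x - y| <= d -> l + d <= y < l + d + (q - 2 * d) -> l <= x < l + q.
Proof. by rewrite ler_distl => /andP[? ?] /andP[? ?]; apply/andP; split; lra. Qed.

Section lattice_copies.
Variables (u0 : 'rV[R]_n) (th r c : R).
Hypotheses (du0 : in_chart X u0) (th_gt0 : 0 < th).
Local Notation B := (dslope X u0).
Hypothesis rP : approx_radius X u0 th r.
Hypothesis c_gt0 : 0 < c.
Hypothesis cP : forall (w : 'I_n -> R) (e : R), 0 <= e ->
  (forall i, `|\sum_j B i j * w j| <= e) -> forall j, `|w j| <= c * e.
Local Notation cell := (lattice_cell B).
Local Notation centre e k := (rowt (cell_centre B e k)).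

Let Bu : B \in unitmx := dslope_unit du0.
Let h0 : 0 < ph 0 u0 := ph_gt0 0 du0.
Let th1 : 0 < 1 + th. Proof. exact: addr_gt0. Qed.

Let mcell e k : measurable (cell e k).
Proof. exact: measurable_parallelepiped. Qed.

Let cell_volume_gt0 (e : R) : 0 < e -> 0 < (2 * e) ^+ n * ph 0 u0.
Proof. by move=> e0; rewrite mulr_gt0// exprn_gt0// mulr_gt0. Qed.

Lemma lattice_cell_dist k e y w : 0 < e -> cell e k y -> cell e k w ->
  forall i, `|tnth y i - tnth w i| <= c * (2 * e).
Proof.
move=> e0 yk wk; have e2 : 0 <= 2 * e by rewrite mulr_ge0// ltW.
apply: (cP (w := fun i => tnth y i - tnth w i) e2).

by move=> i; exact: lattice_cell_diff yk wk.
Qed.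

Lemma centre_near k e y : 0 < e -> c * e <= r / 2 -> cell e k y ->
  (forall i, `|tnth y i - u0 0 i| < r / 2) ->
  forall i, `|centre e k 0 i - u0 0 i| < r.
Proof.
move=> e0 er yk yr i; rewrite mxE; apply: trans_lt_dist (yr i) _.
  apply: (cP (w := fun i => tnth y i - tnth (cell_centre B e k) i) (ltW e0)).
  by move=> l; exact: cell_centre_diff.
by rewrite -lerBrDr (le_trans er)//; lra.
Qed.

Section one_box.
Variables (b : 'I_n -> R) (rho : R).
Hypothesis rho_gt0 : 0 < rho.

(** The cells that meet the box lie in a slightly larger box, so that there are
    not too many of them, and each of them lies in a copy of a small cube. *)
Lemma box_coverable :
  (forall y, box b rho y -> forall i, `|tnth y i - u0 0 i| < r / 2) ->
  coverable X (chart_image (box b rho)) ((1 + th) ^+ n.+1 * (rho ^+ n / ph 0 u0)).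
Proof.
move=> Kr; have [e2 e20 e2P] := near_power (4 * c) rho_gt0 th_gt0.
have r0 : 0 < r / 2.
  have [y yb] : exists y, box b rho y.
    exists [tuple b i | i < n]; apply/boxP => i.
    by rewrite tnth_mktuple lexx ltrDl.
  exact: le_lt_trans (normr_ge0 _) (Kr y yb (Ordinal n_gt0)).
exists (Num.min e2 (r / 2 / c)); first by rewrite lt_min e20 divr_gt0.
move=> e' /andP[e'0 e'e]; pose e := e' / (1 + th).
(* A cell with half-side [e] fits into a copy of [tiny (e * (1 + th))]. *)
have e0 : 0 < e by rewrite divr_gt0.
have ee' : e * (1 + th) = e' by rewrite divfK// gt_eqF.
have ele : e <= e' by rewrite ler_pdivrMr// ler_peMr ?lerDl// ltW.
move: (le_lt_trans ele e'e); rewrite lt_min => /andP[ee2 eer].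
have er : c * e <= r / 2 by rewrite mulrC -ler_pdivlMr// ltW.
have [|p1 _ _] := e2P e; first by rewrite e0.
pose d := c * (2 * e); have d0 : 0 < 2 * d by rewrite mulr_gt0// mulr_gt0// mulr_gt0.
have dE : 4 * c * e = 2 * d by rewrite /d; ring.
pose E := box (fun i => b i - d) (rho + 2 * d).
pose S k := exists2 w, cell e k w & box b rho w.
have [||s [us sS] sle] := @count_disjoint _ _ _ lam _ (cell e)
  (mcell e) S E _ ((rho + 2 * d) ^+ n) (cell_volume_gt0 e0) (measurable_box _ _)
  (fun k k' => lattice_cell_disjoint B e0).
- move=> k [w wk /boxP wK]; split; first exact: lebesgue_lattice_cell.
  move=> y yk; apply/boxP => i.
  exact: (enlarge_itv (lattice_cell_dist e0 yk wk i) (wK i)).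
- by rewrite -(lebesgue_box (fun i => b i - d) (addr_gt0 rho_gt0 d0)).
have cn k y : cell e k y -> box b rho y -> forall i, `|centre e k 0 i - u0 0 i| < r.
  by move=> yk yK; apply: centre_near yk (Kr y yK).
have near y : box b rho y -> forall i, `|rowt y 0 i - u0 0 i| < r.
  move=> yK i; rewrite mxE; apply: lt_trans (Kr y yK i) _.
  by rewrite ltr_pdivrMr// ltr_pMr ?ltr1n// -(@pmulr_lgt0 _ 2^-1).
exists [seq frame X (centre e k) | k <- s].
  move=> g /mapP[k /sS [w wk wK] ->]; apply: frame_isometry.
  by have := cn k w wk wK => cnk; have [[]] := rP cnk cnk.
split.
  move=> _ [y yK <-]; have [k yk] := lattice_cell_cover B y e0.
  exists (frame X (centre e k)); first by apply: map_f; apply/sS; exists y.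
  have [[dc dy] _ cov _] := rP (cn k y yk yK) (near y yK).
  exists (invmx (frame X (centre e k)) *m pt X (rowt y)).
    rewrite -ee'; apply: cov; first exact: ltW.
    move=> i; under eq_bigr do rewrite [rowt y 0 _]mxE [centre e k 0 _]mxE.
    exact: cell_centre_diff.
  by rewrite mulKVmx// (isometry_unit (frame_isometry dc)).
rewrite size_map -ee' mulrA [X in _ * X <= _]exprMn.
have : (size s)%:R * ((2 * e) ^+ n * ph 0 u0) <= (1 + th) * rho ^+ n.
  by apply: le_trans sle _; rewrite -dE.
rewrite mulrA -ler_pdivlMr// => p2.
have -> : (1 + th) ^+ n.+1 * (rho ^+ n / ph 0 u0) =
    (1 + th) * rho ^+ n / ph 0 u0 * (1 + th) ^+ n by rewrite exprS; ring.
by rewrite mulrA ler_wpM2r// exprn_ge0// ltW.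
Qed.

(** The cells inside the box fill a slightly smaller box, so that there are
    enough of them, and each of them contains a copy of a small cube. *)
Lemma box_packable (r' e1 : R) : 0 < e1 ->
  (forall u : 'rV[R]_n, (forall i, `|u 0 i - u0 0 i| < r') ->
   forall e, 0 < e < e1 -> forall x : 'cV[R]_n.+1, tiny X e x ->
   exists z, [/\ in_chart X z, (forall i, `|z 0 i - u0 0 i| < r) &
     frame X u *m x = pt X z]) ->
  (forall y, box b rho y -> forall i,
     `|tnth y i - u0 0 i| < r /\ `|tnth y i - u0 0 i| < r') ->
  packable X (chart_image (box b rho))
    (((1 + th) ^+ (2 * n).+1)^-1 * (rho ^+ n / ph 0 u0)).
Proof.
move=> e10 tP Kr; have [e2 e20 e2P] := near_power (4 * c) rho_gt0 th_gt0.
exists (Num.min e1 (e2 / (1 + th) ^+ 2)).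
  by rewrite lt_min e10 divr_gt0// exprn_gt0.
move=> e' /andP[e'0]; rewrite lt_min => /andP[e'e1 e'e2].
(* A copy of [tiny e'] extends at most [e' * (1 + th)] from the centre of its
   cell; the second factor leaves room for the half-open cell to contain it. *)
pose e := e' * (1 + th) ^+ 2.
have e0 : 0 < e by rewrite mulr_gt0// exprn_gt0.
have ee2 : e < e2 by rewrite -ltr_pdivlMr// exprn_gt0.
have e'e : e' * (1 + th) < e.
  by rewrite /e expr2 mulrA ltr_pMr ?mulr_gt0// ltrDl.
have [|_ + +] := e2P e; first by rewrite e0.
pose d := c * (2 * e); have -> : 4 * c * e = 2 * d by rewrite /d; ring.
move=> p1 p0.
pose S k := cell e k `<=` box b rho.
have [||s [us sS] _] := @count_disjoint _ _ _ lam _ (cell e)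
  (mcell e) S (box b rho) _ (rho ^+ n) (cell_volume_gt0 e0) (measurable_box _ _)
  (fun k k' => lattice_cell_disjoint B e0).
- by move=> k Sk; split=> //; exact: lebesgue_lattice_cell.
- by rewrite -(lebesgue_box b rho_gt0).
have cK k : k \in s -> box b rho (cell_centre B e k).
  by move=> /sS; apply; exact: cell_centre_in.
have cn k : k \in s -> forall i, `|centre e k 0 i - u0 0 i| < r.
  by move=> /cK ks i; rewrite mxE; exact: (Kr _ ks i).1.
have iF k : k \in s -> is_isometry X (frame X (centre e k)).
  by move=> /cn ck; apply: frame_isometry; have [[]] := rP ck ck.
have inside k : k \in s -> forall x, tiny X e' x ->
    exists y, [/\ cell e k y, box b rho y &
      frame X (centre e k) *m x = pt X (rowt y)].
  move=> ks x tx.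
  have cr' i : `|centre e k 0 i - u0 0 i| < r'.
    by rewrite mxE; exact: (Kr _ (cK k ks) i).2.
  have [|z [dz zr fz]] := tP _ cr' e' _ x tx; first by rewrite e'0.
  have [_ _ _ pac] := rP (cn k ks) zr.
  suff zk : cell e k (untup z).
    by exists (untup z); rewrite untupK; split=> //; exact: (sS k).1.
  apply: cell_centre_near => // i; apply: le_lt_trans e'e.
  have := pac e' (ltW e'0) _ i; rewrite -fz mulKmx => [/(_ tx)|]; last first.
    exact: isometry_unit (iF k ks).
  congr (`|_| <= _); apply: eq_bigr => j _.
  by rewrite [rowt _ 0 _]mxE [in RHS]tnth_mktuple.
have fI k k' x x' : k \in s -> k' \in s -> tiny X e' x -> tiny X e' x' ->
    frame X (centre e k) *m x = frame X (centre e k') *m x' -> k = k'.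
  move=> ks k's tx tx' xx'.
  have [y [yk _ ye]] := inside k ks x tx.
  have [y' [yk' _ ye']] := inside k' k's x' tx'.
  have yy' : y = y'.
    rewrite -(rowtK y) -(rowtK y'); congr untup; apply/rowP => i.
    by rewrite -(ptS X) -[in RHS](ptS X) -ye -ye' xx'.
  rewrite -yy' in yk'; apply: contrapT => /eqP kk'.
  have : (cell e k `&` cell e k') y by [].
  by rewrite lattice_cell_disjoint.
have tb := tiny_base X n e'0.
exists [seq frame X (centre e k) | k <- s]; split.
- rewrite map_inj_in_uniq// => k k' ks k's kk'.
  by apply: (fI _ _ _ _ ks k's tb tb); rewrite kk'.
- move=> _ /mapP[k ks ->]; split; first exact: iF.
  move=> _ [x tx <-]; have [y [_ yK ->]] := inside k ks x tx.
  by exists y.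
- move=> _ _ /mapP[k ks ->] /mapP[k' k's ->] [_ [[x tx <-] [x' tx' xx']]].
  by rewrite (fI _ _ _ _ ks k's tx tx' (esym xx')).
rewrite size_map.
have : (((rho - 2 * d) ^+ n)%:E <= ((size s)%:R * ((2 * e) ^+ n * ph 0 u0))%:E)%E.
  rewrite -(lebesgue_box (fun i => b i + d) p0).
  rewrite -(@sum_const_seq _ _ _ lam _ (cell e) _ s); last first.
    by move=> k _; exact: lebesgue_lattice_cell.
  apply: le_trans (@measure_seqU_le _ _ _ lam _ (cell e) (mcell e) s).
  apply: le_measure; rewrite ?inE.
  - exact: measurable_box.
  - exact: measurable_seqU.
  move=> y yE; have [k yk] := lattice_cell_cover B y e0.
  apply/seqUP; exists k => //; apply/sS => w wk; apply/boxP => i.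
  move/boxP: yE => /(_ i); exact: (shrink_itv (lattice_cell_dist e0 wk yk i)).
rewrite lee_fin => p2.
have p3 : rho ^+ n <= (1 + th) * ((size s)%:R * ((2 * e) ^+ n * ph 0 u0)).
  by apply: le_trans p1 _; rewrite ler_wpM2l// ltW.
rewrite mulrC ler_pdivrMr ?exprn_gt0// ler_pdivrMr//.
apply: le_trans p3 _.
have -> : (2 * e) ^+ n = (2 * e') ^+ n * (1 + th) ^+ (2 * n).
  by rewrite /e [2 * (e' * _)]mulrA [LHS]exprMn -exprM.
by rewrite exprS le_eqVlt; apply/orP; left; apply/eqP; ring.
Qed.

End one_box.
End lattice_copies.

(** A cell of the lattice with matrix [dslope X u0] and half-side [e] has Lebesgue
    measure [(2 e)^n * ph 0 u0], so that about [rho^n / ((2 e)^n * ph 0 u0)] cells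
    fill the box. *)
Lemma local_box (u0 : 'rV[R]_n) (th : R) : in_chart X u0 -> 0 < th <= 1 ->
  exists2 r, 0 < r & forall b rho, 0 < rho ->
    (forall y, box b rho y -> forall i, `|tnth y i - u0 0 i| < r) ->
    [/\ forall y, box b rho y -> 0 < radicand X y,
        forall y, box b rho y -> `|height X y - ph 0 u0| <= th * ph 0 u0,
      coverable X (chart_image (box b rho)) ((1 + th) ^+ n.+1 * (rho ^+ n / ph 0 u0)) &
      packable X (chart_image (box b rho)) (((1 + th) ^+ (2 * n).+1)^-1 * (rho ^+ n / ph 0 u0))].
Proof.
move=> du0 th01; have /andP[th0 _] := th01.
have [r r0 rP] := tiny_approx du0 th01.
have [r' r'0 [e1 e10 tP]] := tiny_in_chart n_gt0 du0 r0.
have [c c0 cP] := inv_bound (dslope_unit du0).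
have r2 : r / 2 <= r by rewrite ler_pdivrMr// ler_peMr ?ler1n// ltW.
exists (Num.min (r / 2) r'); first by rewrite lt_min divr_gt0.
move=> b rho rho0 Kr.
have Kr2 y : box b rho y -> forall i, `|tnth y i - u0 0 i| < r / 2.
  by move=> yb i; have := Kr y yb i; rewrite lt_min => /andP[].
have Kr1 y : box b rho y -> forall i,
    `|tnth y i - u0 0 i| < r /\ `|tnth y i - u0 0 i| < r'.
  move=> yb i; split; first exact: lt_le_trans (Kr2 y yb i) r2.
  by have := Kr y yb i; rewrite lt_min => /andP[].
have near y : box b rho y -> forall i, `|rowt y 0 i - u0 0 i| < r.
  by move=> yb i; rewrite mxE; exact: (Kr1 y yb i).1.
split.
- by move=> y /near yn; have [[dy _] _ _ _] := rP _ _ yn yn; rewrite radicandE.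
- by move=> y /near yn; have [_ hy _ _] := rP _ _ yn yn; rewrite heightE.
- exact: (box_coverable du0 th0 rP c0 cP rho0 Kr2).
- exact: (box_packable du0 th0 rP cP rho0 e10 tP Kr1).
Qed.

End boxes.

(** * Covering closed sets and packing open sets in the chart *)

Section chart_volume.
Context {R : realType} (X : geometry) (n : nat).
Hypothesis n_gt0 : (0 < n)%N.
Local Notation T := (n.-tuple (measurableTypeR R)).
Local Notation lam := (@lebesgue_tuple R n).
Local Notation ph := (partial_height X).
Local Notation dmu := (@density_measure R X n).
Implicit Types (y w : n.-tuple R) (i j : 'I_n) (b : 'I_n -> R).

(** Coverings and packings that are optimal up to the factors [1 + del] and
    [1 - del]. The bound on the ratio of heights controls the density on the whole
    box by its value at one point. *)
Definition fine_box (del : R) b rho :=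
  [/\ forall y, box b rho y -> 0 < radicand X y,
      forall y w, box b rho y -> box b rho w -> height X w <= 3 * height X y,
      (dmu (box b rho) < +oo)%E,
      coverable X (chart_image X (box b rho)) ((1 + del) * fine (dmu (box b rho))) &
      packable X (chart_image X (box b rho)) ((1 - del) * fine (dmu (box b rho)))].

Lemma small_powers (del : R) : 0 < del < 1 -> exists2 th, 0 < th <= 1 / 2 &
  (1 + th) ^+ n.+2 <= 1 + del /\ (1 - del) * (1 + th) ^+ (2 * n).+1 <= 1 - th.
Proof.
move=> /andP[d0 d1].
have cp m : (1 + t) ^+ m @[t --> (0:R)] --> (1 : R).
  apply: (cvg_comp (fun t : R => 1 + t) (fun x => x ^+ m) (G := nbhs (1 : R))).
    have {2}-> : 1 = 1 + 0 :> R by rewrite addr0.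
    by apply: cvgD; [exact: cvg_cst | exact: cvg_id].
  by rewrite -{2}(expr1n R m); exact: exprn_continuous.
have H1 : \forall t \near (0:R), (1 + t) ^+ n.+2 < 1 + del.
  by apply: (cvgr_lt _ (cp _)); rewrite ltrDl.
have H2 : \forall t \near (0:R), 0 < (1 - t) - (1 - del) * (1 + t) ^+ (2 * n).+1.
  have c2 : (1 - t) - (1 - del) * (1 + t) ^+ (2 * n).+1 @[t --> (0:R)] -->
      (1 - 0) - (1 - del) * 1.
    apply: cvgB; first by apply: cvgB; [exact: cvg_cst | exact: cvg_id].
    by apply: cvgM; [exact: cvg_cst | exact: cp].
  by apply: (cvgr_gt _ c2); lra.
have [e1 /= e10 h1] := H1; have [e2 /= e20 h2] := H2.
pose th := Num.min (1 / 2) (Num.min (e1 / 2) (e2 / 2)).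
have th0 : 0 < th by rewrite !lt_min !divr_gt0.
have the1 : th <= e1 / 2 by rewrite !ge_min lexx !orbT.
have the2 : th <= e2 / 2 by rewrite !ge_min lexx !orbT.
exists th; first by rewrite th0 ge_min lexx.
split.
  by apply/ltW/h1; rewrite /ball_ /= sub0r normrN gtr0_norm//; lra.
rewrite -subr_ge0; apply/ltW/h2.
by rewrite /ball_ /= sub0r normrN gtr0_norm//; lra.
Qed.

Lemma density_box_bounds b rho (l u : R) : 0 < rho -> 0 <= l ->
  (forall y, box b rho y -> l <= density X y <= u) ->
  ((l * rho ^+ n)%:E <= dmu (box b rho))%E /\
  (dmu (box b rho) <= (u * rho ^+ n)%:E)%E.
Proof.
move=> r0 l0 h; have mb := measurable_box b rho.
have cst (c : R) : (\int[lam]_(y in box b rho) c%:E = (c * rho ^+ n)%:E)%E.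
  rewrite integral_cst// EFinM; congr (_ * _)%E; exact: lebesgue_box.
have mf : measurable_fun (box b rho) (fun y : T => (density X y)%:E).
  by apply: measurable_funTS; apply/measurable_EFinP; exact: measurable_density.
split; rewrite -cst; apply: ge0_le_integral => // y yb; rewrite lee_fin ?density_ge0//.
- by have /andP[] := h y yb.
- by have /andP[] := h y yb.
Qed.

(** On a small box the density is close to its value at [u0], so that the constants
    of [local_box] can be compared with the volume of the box. *)
Lemma local_fine_box (u0 : 'rV[R]_n) (del : R) : in_chart X u0 -> 0 < del < 1 ->
  exists2 r, 0 < r & forall b rho, 0 < rho ->
    (forall y, box b rho y -> forall i, `|tnth y i - u0 0 i| < r) ->
    fine_box del b rho.
Proof.
move=> du0 del01; have [th /andP[th0 th2] [p1 p2]] := small_powers del01.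
have [d0 d1] := andP del01.
have h0 := ph_gt0 0 du0.
have [|r r0 rP] := local_box n_gt0 du0 (th := th); first by rewrite th0; lra.
exists r => // b rho rho0 Kr; have [br bh bc bp] := rP b rho rho0 Kr.
have th1 : 0 < 1 - th by lra.
have th1' : 0 < 1 + th by lra.
have hb y : box b rho y -> (1 - th) * ph 0 u0 <= height X y <= (1 + th) * ph 0 u0.
  by move=> /bh; rewrite ler_distl => /andP[? ?]; apply/andP; split; lra.
set V := rho ^+ n / ph 0 u0 in bc bp.
have [] := @density_box_bounds b rho (((1 + th) * ph 0 u0)^-1)
  (((1 - th) * ph 0 u0)^-1) rho0.
- by rewrite invr_ge0 mulr_ge0// ltW.
- move=> y yb; have /andP[h1 h2] := hb y yb.
  have hy : 0 < height X y by apply: lt_le_trans h1; exact: mulr_gt0.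
  by rewrite /density !lef_pV2 ?posrE ?mulr_gt0// h1 h2.
move=> m1 m2.
have fin : dmu (box b rho) \is a fin_num.
  by rewrite ge0_fin_numE ?measure_ge0//; apply: le_lt_trans m2 _; rewrite ltry.
move: m1 m2; rewrite -(fineK fin) !lee_fin; set m := fine _ => m1 m2.
have V1 : V <= (1 + th) * m.
  rewrite -ler_pdivrMl//; apply: le_trans m1.
  by rewrite /V invfM -mulrA [_^-1 * rho ^+ n]mulrC.
have V2 : (1 - th) * m <= V.
  rewrite -ler_pdivlMl//; apply: le_trans m2 _.
  by rewrite /V invfM -mulrA [_^-1 * rho ^+ n]mulrC.
have m0 : 0 <= m by apply: fine_ge0; exact: measure_ge0.
split=> //.
- move=> y w /hb /andP[y1 _] /hb /andP[_ w1]; apply: le_trans w1 _.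
  have : 0 < ph 0 u0 * (1 / 2 - th) + ph 0 u0 by nra.
  by move=> ?; nra.
- by rewrite -(fineK fin) ltry.
- apply: coverableS bc => //.
  apply: (@le_trans _ _ ((1 + th) ^+ n.+1 * ((1 + th) * m))).
    by rewrite ler_wpM2l// exprn_ge0// ltW.
  by rewrite mulrA -exprSr ler_wpM2r.
- apply: packableS bp => //.
  rewrite ler_pdivlMl ?exprn_gt0//; apply: le_trans V2.
  by rewrite mulrA ler_wpM2r// mulrC.
Qed.

Definition bounded_away (a M : R) y :=
  a <= radicand X y /\ forall i, `|tnth y i| <= M.

(** The points that are bounded away from the edge of the chart form a compact set. *)
Lemma uniform_fine_box (del a M : R) : 0 < del < 1 -> 0 < a ->
  exists2 r, 0 < r & forall b rho, 0 < rho < r ->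
    (exists2 y, box b rho y & bounded_away a M y) -> fine_box del b rho.
Proof.
move=> del01 a0.
have K : compact [set u : 'rV[R]_n | forall i, `[(- M), M]%classic (u ord0 i)].
  by apply: (@rV_compact R n (fun=> `[(- M), M]%classic)) => i; exact: segment_compact.
pose P (r : R) (u : 'rV[R]_n) := a <= partial_rad X 0 u ->
  forall b rho, 0 < rho < r -> box b rho (untup u) -> fine_box del b rho.
have := (compact_near_coveringP _).1 K R (0^'+) P _ => NC.
have /NC : forall u, [set u : 'rV[R]_n | forall i, `[(- M), M]%classic (u ord0 i)] u ->
    \forall u' \near u & r \near 0^'+, P r u'.
  move=> u _; have [au|au] := ltP (partial_rad X 0 u) a.
    have cr := @continuous_partial_rad R X n 0 u.
    have H : \forall u' \near u, partial_rad X 0 u' < a by exact: (cvgr_lt _ cr).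
    near=> u' r => h; suff : partial_rad X 0 u' < a by rewrite ltNge h.
    by near: u'.
  have du : in_chart X u by exact: lt_le_trans au.
  have [r1 r10 r1P] := local_fine_box du del01.
  exists (ball u (r1 / 2), [set r | r < r1 / 2]) => /=.
    split; first by apply: nbhsx_ballx; rewrite divr_gt0.
    by apply: nbhs_right_lt; rewrite divr_gt0.
  move=> [u' r] /= [[_ u'u] rr1] _ b rho /andP[rho0 rhor] /boxP bu'.
  apply: r1P => // y /boxP by_ i.
  have := bu' i; rewrite tnth_mktuple => /andP[? ?].
  have := by_ i => /andP[? ?]; have := u'u 0 i.
  rewrite /ball /= ltr_distl => /andP[? ?].
  by rewrite ltr_distl; apply/andP; split; lra.
move=> [r /= r0 rP]; exists (r / 2); first by rewrite divr_gt0.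
move=> b rho /andP[rho0 rhor] [y yb [ya yM]].
have := rP (r / 2) _ _ (rowt y).
rewrite /P rowtK -radicandE; apply=> //.
- by rewrite /ball_ /= sub0r normrN gtr0_norm ?divr_gt0//; lra.
- by rewrite divr_gt0.
- by move=> i; rewrite /= mxE in_itv /= -ler_norml.
- by rewrite rho0.
Unshelve. all: by end_near.
Qed.

(** The side of the cells is [1 / (m + 1)]; [lattice_cell] expects half of it. *)
Definition grid (m : nat) (k : {ffun 'I_n -> int}) : set T :=
  lattice_cell 1%:M (m.+1%:R^-1 / 2) k.

Lemma gridE m k : grid m k = box (fun i => 2 * (m.+1%:R^-1 / 2) * (k i)%:~R) m.+1%:R^-1.
Proof. by rewrite /grid /box /lattice_cell; congr parallelepiped; field. Qed.

Lemma side_gt0 m : 0 < m.+1%:R^-1 :> R. Proof. by rewrite invr_gt0. Qed.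

Lemma half_side_gt0 m : 0 < m.+1%:R^-1 / 2 :> R.
Proof. by apply: divr_gt0 => //; exact: side_gt0. Qed.

Lemma grid_disjoint m k k' : k != k' -> grid m k `&` grid m k' = set0.
Proof. by move=> kk'; apply: lattice_cell_disjoint => //; exact: half_side_gt0. Qed.

Lemma grid_cover m y : exists k, grid m k y.
Proof. exact/lattice_cell_cover/half_side_gt0. Qed.

Lemma measurable_grid m k : measurable (grid m k).
Proof. exact: measurable_parallelepiped. Qed.

Lemma grid_dist m k y w i : grid m k y -> grid m k w ->
  `|tnth y i - tnth w i| <= m.+1%:R^-1.
Proof.
have gen (p q a b : R) : p <= a < p + q -> p <= b < p + q -> `|a - b| <= q.
  by move=> /andP[? ?] /andP[? ?]; rewrite ler_norml; apply/andP; split; lra.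
rewrite gridE => /boxP/(_ i) yk /boxP/(_ i) wk; exact: gen yk wk.
Qed.

Lemma side_small (r : R) : 0 < r -> exists m0, forall m, (m0 <= m)%N -> m.+1%:R^-1 < r.
Proof.
move=> r0; have [m0 _ h] := near_infty_natSinv_lt (PosNum r0).
by exists m0 => m /h.
Qed.

Lemma side_le1 m : m.+1%:R^-1 <= 1 :> R.
Proof. by rewrite invf_le1 ?ler1n. Qed.

(** The cells are disjoint, of the same positive measure, and stay in a box. *)
Lemma grid_list (m : nat) (S : {ffun 'I_n -> int} -> Prop) (M : R) :
  (forall k, S k -> exists2 y, grid m k y & forall i, `|tnth y i| <= M) ->
  exists2 s : seq {ffun 'I_n -> int}, uniq s & forall k, k \in s <-> S k.
Proof.
move=> SM; pose rho : R := 2 * (`|M| + 2).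
have M0 : 0 <= `|M| := normr_ge0 M.
have rho0 : 0 < rho by rewrite mulr_gt0//; lra.
pose E : set T := box (fun=> - (`|M| + 2)) rho.
have c0 : 0 < (m.+1%:R^-1) ^+ n :> R by rewrite exprn_gt0// side_gt0.
have [||s [us sS] _] := @count_disjoint _ _ _ lam _ (grid m) (measurable_grid m)
  S E _ (rho ^+ n) c0 (measurable_box _ _) (@grid_disjoint m).
- move=> k /SM[y yk yM]; split.
    by rewrite gridE; apply: lebesgue_box; exact: side_gt0.
  move=> w wk; apply/boxP => i; have := grid_dist i wk yk; have := yM i.
  have := ler_norm M; have := side_le1 m; move: (m.+1%:R^-1) => q.
  rewrite ler_norml ler_distl => ? ? /andP[? ?] /andP[? ?].
  by rewrite /rho; apply/andP; split; lra.
- by rewrite -(@lebesgue_box _ n (fun=> - (`|M| + 2)) _ rho0).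
by exists s.
Qed.

Definition grid_union m (s : seq {ffun 'I_n -> int}) : set T :=
  \big[setU/set0]_(k <- s) grid m k.

Lemma measurable_grid_union m s : measurable (grid_union m s).
Proof. by apply: measurable_seqU; exact: measurable_grid. Qed.

Lemma chart_image_inj A B : A `&` B = set0 ->
  chart_image X A `&` chart_image X B = set0 :> set 'cV[R]_n.+1.
Proof.
move=> AB; apply/seteqP; split=> // x [[y Ay yx] [w Bw wx]].
suff yw : y = w.
  by have : (A `&` B) y by [split=> //; rewrite yw]; rewrite AB.
rewrite -(rowtK y) -(rowtK w); congr untup; apply/rowP => i.
by rewrite -(ptS X) -[in RHS](ptS X) yx wx.
Qed.

Lemma chart_image_grid_union m s : chart_image X (grid_union m s) =
  \big[setU/set0]_(k <- s) chart_image X (grid m k).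
Proof.
apply/seteqP; split=> x.
  by move=> [y /seqUP[k ks ky] <-]; apply/seqUP; exists k => //; exists y.
move=> /seqUP[k ks [y ky <-]]; exists y => //.
by rewrite /grid_union; apply/seqUP; exists k.
Qed.

Section fine_union.
Variables (m : nat) (s : seq {ffun 'I_n -> int}) (del : R).
Hypothesis us : uniq s.
Hypothesis sf : forall k, k \in s ->
  fine_box del (fun i => 2 * (m.+1%:R^-1 / 2) * (k i)%:~R) m.+1%:R^-1.

Lemma dmu_grid_union :
  dmu (grid_union m s) = (\sum_(k <- s) fine (dmu (grid m k)))%:E.
Proof.
rewrite /grid_union (measure_seqU dmu (measurable_grid m) us (@grid_disjoint m)).
rewrite -sumEFin; rewrite !big_seq; apply: eq_bigr => k ks.
rewrite fineK// ge0_fin_numE ?measure_ge0// gridE.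
by have [] := sf ks.
Qed.

Lemma coverable_grid_union : coverable X (chart_image X (grid_union m s))
  ((1 + del) * fine (dmu (grid_union m s))).
Proof.
rewrite dmu_grid_union /= mulr_sumr chart_image_grid_union.
apply: coverable_seqU => k ks; rewrite gridE; by have [] := sf ks.
Qed.

Lemma packable_grid_union : packable X (chart_image X (grid_union m s))
  ((1 - del) * fine (dmu (grid_union m s))).
Proof.
rewrite dmu_grid_union /= mulr_sumr chart_image_grid_union.
apply: packable_seqU => // [k k' kk'|k ks].
  by apply: chart_image_inj; exact: grid_disjoint.
by rewrite gridE; have [] := sf ks.
Qed.

End fine_union.

Definition ball_sup y (r : R) w := forall i, `|tnth w i - tnth y i| < r.

Lemma density_measure_fin (A : set T) (K C : R) : measurable A ->
  (forall y, A y -> density X y <= C /\ forall i, `|tnth y i| <= K) ->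
  (dmu A < +oo)%E.
Proof.
move=> mA Ab; have K0 := normr_ge0 K; have leK := ler_norm K.
pose E : set T := box (fun=> - (`|K| + 1)) (2 * (`|K| + 1)).
apply: (@le_lt_trans _ _ (\int[lam]_(y in A) (`|C|%:E))%E).
  apply: ge0_le_integral => //.
  - by move=> y _; rewrite lee_fin density_ge0.
  - by apply: measurable_funTS; apply/measurable_EFinP; exact: measurable_density.
  by move=> y /Ab[dC _]; rewrite lee_fin (le_trans dC)// ler_norm.
rewrite integral_cst//; apply: (@le_lt_trans _ _ (`|C|%:E * lam E)%E).
  apply: lee_wpmul2l; first by rewrite lee_fin.
  apply: le_measure; rewrite ?inE//; first exact: measurable_box.
  move=> y /Ab[_ h]; apply/boxP => i; have := h i; rewrite ler_norml => /andP[? ?].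
  by apply/andP; split; lra.
have -> : lam E = ((2 * (`|K| + 1)) ^+ n)%:E by apply: lebesgue_box; lra.
by rewrite -EFinM ltry.
Qed.

(** The grid cells that meet [A] shrink to the closed set [A] as the mesh tends to
    0. The grids are not nested, so that continuity of the measure is applied to the
    unions over all finer meshes. *)
Lemma coverable_closed (A : set T) (a M c : R) : 0 < a -> measurable A ->
  (forall y, A y -> bounded_away a M y) ->
  (forall y, ~ A y -> exists2 r, 0 < r & forall w, ball_sup y r w -> ~ A w) ->
  (dmu A < c%:E)%E -> coverable X (chart_image X A) c.
Proof.
move=> a0 mA Ab Acl Ac.
have Afin : dmu A \is a fin_num.
  by rewrite ge0_fin_numE ?measure_ge0//; apply: lt_le_trans Ac _; rewrite leey.
pose mA0 := fine (dmu A); have mA00 : 0 <= mA0 by rewrite fine_ge0 ?measure_ge0.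
have mAc : mA0 < c by rewrite -lte_fin /mA0 fineK.
pose mid := (mA0 + c) / 2.
have midc : mid < c by rewrite ltr_pdivrMr//; lra.
have mAmid : mA0 < mid by rewrite ltr_pdivlMr//; lra.
pose del := Num.min (1 / 2) ((c - mid) / c).
have c0 : 0 < c by lra.
have del0 : 0 < del by rewrite lt_min !divr_gt0// subr_gt0.
have del01 : 0 < del < 1.
  by rewrite del0 gt_min; apply/orP; left; lra.
have delc : (1 + del) * mid <= c.
  have : del <= (c - mid) / c by rewrite ge_min lexx orbT.
  rewrite ler_pdivlMr// => h; nra.
have [r r0 rP] := uniform_fine_box M del01 a0.
have [m0 m0P] := side_small r0.
have H m : exists s : seq {ffun 'I_n -> int}, uniq s /\ forall k, k \in s <->
    exists2 y, grid m k y & A y.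
  have [|s us sP] := @grid_list m (fun k => exists2 y, grid m k y & A y) M.
    by move=> k [y yk /Ab[_ yM]]; exists y.
  by exists s.
have [s sP] := boolp.choice H.
have sf m k : (m0 <= m)%N -> k \in s m ->
    fine_box del (fun i => 2 * (m.+1%:R^-1 / 2) * (k i)%:~R) m.+1%:R^-1.
  move=> mm; have [_ sA] := sP m => /sA[y yk Ay].
  apply: rP; first by rewrite side_gt0 m0P.
  by exists y; [rewrite -gridE|exact: Ab].
pose U m := grid_union m (s m).
pose G m := \bigcup_(l in [set l | (m + m0 <= l)%N]) U l.
have mU m : measurable (U m) by exact: measurable_grid_union.
have mG m : measurable (G m) by exact: bigcup_measurable.
have UP m y : U m y -> exists2 w, A w & exists2 k, k \in s m & grid m k y /\ grid m k w.
  move=> /seqUP[k ks yk]; have [_ sA] := sP m; have [w wk Aw] := (sA k).1 ks.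
  by exists w => //; exists k.
have AU m : A `<=` U m.
  move=> y Ay; have [k yk] := grid_cover m y; apply/seqUP; exists k => //.
  by have [_ sA] := sP m; apply/sA; exists y.
have GA : \bigcap_m G m = A.
  apply/seteqP; split=> y; last first.
    by move=> Ay m _; exists (m + m0)%N => //=; exact: AU.
  move=> Gy; apply: contrapT => /Acl[q q0 qP].
  have [m1 m1P] := side_small q0.
  have [l /= ml /UP[w Aw [k ks [yk wk]]]] := Gy m1 Logic.I.
  apply: (qP w) => // i; apply: le_lt_trans (grid_dist i wk yk) _.
  by apply: m1P; apply: leq_trans ml; exact: leq_addr.
have Gfin : (dmu (G 0%N) < +oo)%E.
  apply: (@density_measure_fin _ (`|M| + 1) (3 / Num.sqrt a)) => //.
  move=> y [l /= ml /UP[w Aw [k ks [yk wk]]]]; have [aw wM] := Ab _ Aw; split.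
    have [hr hh _ _ _] := sf l k ml ks; rewrite -gridE in hr hh.
    have hy : 0 < height X y by rewrite sqrtr_gt0; exact: hr.
    have sa : 0 < Num.sqrt a by rewrite sqrtr_gt0.
    have saw : Num.sqrt a <= height X w by rewrite ler_wsqrtr.
    rewrite /density ler_pdivlMr// mulrC ler_pdivrMr//.
    by apply: le_trans saw _; exact: hh.
  move=> i; rewrite -[tnth y i](subrK (tnth w i)) addrC.
  apply: le_trans (ler_normD _ _) _; apply: lerD.
    exact: le_trans (wM i) (ler_norm M).
  exact: le_trans (grid_dist i yk wk) (side_le1 l).
have Gcvg : (dmu \o G) l @[l --> \oo] --> dmu A.
  rewrite -GA; apply: nonincreasing_cvg_mu => //.
    by rewrite GA.
  move=> p q pq; apply/subsetPset => y [l /= lq Uy]; exists l => //=.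
  by apply: leq_trans lq; rewrite leq_add2r.
have : \forall l \near \oo, ((dmu \o G) l < mid%:E)%E.
  have lt : (dmu A < mid%:E)%E by rewrite -(fineK Afin) lte_fin.
  apply: (Gcvg [set x | (x < mid%:E)%E]).
  by apply: open_nbhs_nbhs; split => //; exact: open_ereal_lt_ereal.
move=> [l _ /(_ l (leqnn l))] /= Gl.
pose m := (l + m0)%N.
have Um : (dmu (U m) <= mid%:E)%E.
  apply: le_trans (ltW Gl); apply: le_measure; rewrite ?inE// => y Uy.
  by exists m => //=; exact: leqnn.
have sfm k : k \in s m -> fine_box del (fun i => 2 * (m.+1%:R^-1 / 2) * (k i)%:~R) m.+1%:R^-1.
  by apply: sf; exact: leq_addl.
have usm := (sP m).1.
apply: coverableS (coverable_grid_union usm sfm).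
  by move=> x [y Ay <-]; exists y => //; exact: AU.
apply: le_trans delc; rewrite ler_wpM2l//; first lra.
by move: Um; rewrite /U (dmu_grid_union usm sfm) lee_fin.
Qed.

(** The grid cells contained in [W] exhaust the open set [W] as the mesh tends to 0;
    continuity of the measure is applied to the intersections over all finer
    meshes. *)
Lemma packable_open (W : set T) (a M c : R) : 0 < a -> measurable W ->
  (forall y, W y -> bounded_away a M y) ->
  (forall y, W y -> exists2 r, 0 < r & forall w, ball_sup y r w -> W w) ->
  (c%:E < dmu W)%E -> packable X (chart_image X W) c.
Proof.
move=> a0 mW Wb Wo cW.
have [c0|c0] := leP c 0; first exact: packable0.
have [c1 cc1 c1W] : exists2 c1, c < c1 & (c1%:E < dmu W)%E.
  have := cW; case: (dmu W) => [q|_|//].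
    rewrite lte_fin => cq; exists ((c + q) / 2); rewrite ?lte_fin; lra.
  by exists (c + 1); rewrite ?ltry//; lra.
pose del := Num.min (1 / 2) ((c1 - c) / c1).
have c10 : 0 < c1 by lra.
have del0 : 0 < del by rewrite lt_min !divr_gt0// subr_gt0.
have del01 : 0 < del < 1.
  by rewrite del0 gt_min; apply/orP; left; lra.
have delc : c <= (1 - del) * c1.
  have : del <= (c1 - c) / c1 by rewrite ge_min lexx orbT.
  rewrite ler_pdivlMr// => h; nra.
have [r r0 rP] := uniform_fine_box M del01 a0.
have [m0 m0P] := side_small r0.
have inh m k : exists y, grid m k y.
  exists (cell_centre 1%:M (m.+1%:R^-1 / 2) k); apply: cell_centre_in.
    exact: half_side_gt0.
  exact: unitmx1.
have H m : exists s : seq {ffun 'I_n -> int}, uniq s /\ forall k, k \in s <->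
    grid m k `<=` W.
  have [|s us sP] := @grid_list m (fun k => grid m k `<=` W) M.
    by move=> k kW; have [y yk] := inh m k; have [_ yM] := Wb _ (kW y yk); exists y.
  by exists s.
have [s sP] := boolp.choice H.
have sf m k : (m0 <= m)%N -> k \in s m ->
    fine_box del (fun i => 2 * (m.+1%:R^-1 / 2) * (k i)%:~R) m.+1%:R^-1.
  move=> mm; have [_ sA] := sP m => /sA kW; have [y yk] := inh m k.
  apply: rP; first by rewrite side_gt0 m0P.
  by exists y; [rewrite -gridE|exact/Wb/kW].
pose U m := grid_union m (s m).
pose G m := \bigcap_(l in [set l | (m + m0 <= l)%N]) U l.
have mU m : measurable (U m) by exact: measurable_grid_union.
have mG m : measurable (G m) by exact: bigcap_measurableType.
have UW m : U m `<=` W.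
  by move=> y /seqUP[k ks yk]; have [_ sA] := sP m; exact: (sA k).1 ks y yk.
have GW : \bigcup_m G m = W.
  apply/seteqP; split=> y.
    by move=> [m _ /(_ (m + m0)%N) h]; apply: (UW (m + m0)%N); apply: h => /=.
  move=> /Wo[q q0 qP]; have [m1 m1P] := side_small q0.
  exists m1 => // l /= ml; have [k yk] := grid_cover l y.
  apply/seqUP; exists k => //; have [_ sA] := sP l; apply/sA => w wk.
  apply: qP => i; apply: le_lt_trans (grid_dist i wk yk) _.
  by apply: m1P; apply: leq_trans ml; exact: leq_addr.
have Gcvg : (dmu \o G) l @[l --> \oo] --> dmu W.
  rewrite -GW; apply: nondecreasing_cvg_mu => //.
    by rewrite GW.
  move=> p q pq; apply/subsetPset => y h l /= lq; apply: h => /=.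
  by apply: leq_trans lq; rewrite leq_add2r.
have : \forall l \near \oo, (c1%:E < (dmu \o G) l)%E.
  apply: (Gcvg [set x | (c1%:E < x)%E]).
  by apply: open_nbhs_nbhs; split => //; exact: open_ereal_gt_ereal.
move=> [l _ /(_ l (leqnn l))] /= Gl.
pose m := (l + m0)%N.
have Um : (c1%:E <= dmu (U m))%E.
  apply: le_trans (ltW Gl) _; apply: le_measure; rewrite ?inE// => y Gy.
  by apply: Gy => /=; exact: leqnn.
have sfm k : k \in s m -> fine_box del (fun i => 2 * (m.+1%:R^-1 / 2) * (k i)%:~R) m.+1%:R^-1.
  by apply: sf; exact: leq_addl.
have usm := (sP m).1.
apply: packableS (packable_grid_union usm sfm).
  by move=> x [y Ay <-]; exists y => //; exact: (UW m y Ay).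
apply: le_trans delc _; rewrite ler_wpM2l//.
  by have /andP[? ?] := del01; lra.
by move: Um; rewrite /U (dmu_grid_union usm sfm) lee_fin.
Qed.

End chart_volume.

(** * Hyperplane sections have measure zero *)

Section null_sections.
Context {R : realType}.
Local Notation lam := (@lebesgue_tuple R).
Local Notation mu1 := (@lebesgue_measure R).

(** A nonzero polynomial of degree at most 2 has at most two zeros. *)
Lemma lebesgue_quadratic (A : set (measurableTypeR R)) (a b c : R) : measurable A ->
  (forall s, A s -> a * s ^+ 2 + b * s + c = 0) ->
  [|| a != 0, b != 0 | c != 0] -> mu1 A = 0%E.
Proof.
move=> mA Az abc.
have pts (p q : R) : A `<=` [set p; q] -> mu1 A = 0%E.
  move=> Apq; apply/eqP; rewrite eq_le measure_ge0 andbT.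
  apply: (@le_trans _ _ (mu1 ([set p] `|` [set q]))).
    by apply: le_measure; rewrite ?inE//; apply: measurableU; exact: measurable_set1.
  apply: le_trans (measureU2 _ _ _) _; [exact: measurable_set1|exact: measurable_set1|].
  have pt0 (r : R) : (mu1 [set r] <= 0)%E by rewrite lebesgue_measure_set1.
  by rewrite -[leRHS]adde0; apply: leeD; exact: pt0.
have [[s0 As0]|A0] := pselect (A !=set0); last first.
  by rewrite (_ : A = set0) ?measure0//; apply/seteqP; split=> // s As; case: A0; exists s.
have e0 := Az _ As0.
have [a0|an0] := eqVneq a 0; last first.
  apply: (pts s0 (- b / a - s0)) => s As; have e := Az _ As.
  have [->|ss0] := eqVneq s s0; [by left | right => /=].
  have h : (s - s0) * (a * (s + s0) + b) = 0.
    have -> : (s - s0) * (a * (s + s0) + b) =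
      (a * s ^+ 2 + b * s + c) - (a * s0 ^+ 2 + b * s0 + c) by ring.
    by rewrite e e0 subrr.
  move/eqP: h; rewrite mulf_eq0 subr_eq0 (negbTE ss0) /= => /eqP h.
  have e' : a * (- b / a - s0) = - b - a * s0 by field.
  by apply: (mulfI an0); rewrite e'; lra.
have [b0|bn0] := eqVneq b 0; last first.
  apply: (pts (- c / b) (- c / b)) => s As; left => /=.
  have := Az _ As; rewrite a0 mul0r add0r => h.
  have e' : b * (- c / b) = - c by field.
  by apply: (mulfI bn0); rewrite e'; lra.
by move: abc e0; rewrite a0 b0 !eqxx /= => /eqP cn0; rewrite !mul0r !add0r.
Qed.

Lemma lebesgue_tuple_null_sections n (A : set (n.+1.-tuple (measurableTypeR R))) :
  measurable A -> (forall t, mu1 [set s | A (tcons (s, t))] = 0%E) ->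
  lam n.+1 A = 0%E.
Proof.
move=> mA h; rewrite lebesgue_tuple_cons// (eq_integral (cst 0%E)) => [|t _].
  exact: integral0.
exact: h.
Qed.

Lemma measurable_zero_set n (f : n.-tuple (measurableTypeR R) -> R) :
  measurable_fun setT f -> measurable [set y | f y = 0].
Proof.
move=> mf; rewrite (_ : [set y | _] = f @^-1` [set 0]).
  by rewrite -[X in measurable X]setTI; exact: mf.
by apply/seteqP; split.
Qed.

Lemma lebesgue_tuple_linear n (a : 'I_n -> R) i : a i != 0 ->
  lam n [set y | \sum_j a j * tnth y j = 0] = 0%E.
Proof.
elim: n a i => [a [] //|n IH] a i ai.
have mA m (b : 'I_m -> R) : measurable
    [set y : m.-tuple (measurableTypeR R) | \sum_j b j * tnth y j = 0].
  by apply: measurable_zero_set; exact: measurable_linear.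
pose a' j := a (lift ord0 j).
have sumE s t : \sum_j a j * tnth (@tcons _ (measurableTypeR R) n (s, t)) j =
    a ord0 * s + \sum_j a' j * tnth t j.
  rewrite big_ord_recl tnth_tcons0; congr (_ + _).
  by apply: eq_bigr => j _; rewrite tnth_tconsS.
have [a0|a0] := eqVneq (a ord0) 0; last first.
  apply: lebesgue_tuple_null_sections => // t.
  apply: (@lebesgue_quadratic _ 0 (a ord0) (\sum_j a' j * tnth t j)).
  - exact: (measurable_tcons_section t (mA _ a)).
  - by move=> s /=; rewrite sumE mul0r add0r.
  - by rewrite a0 orbT.
have [j ij] : exists j, i = lift ord0 j.
  by case: (unliftP ord0 i) ai => [j ->|->]; [exists j | rewrite a0 eqxx].
have := IH a' j; rewrite /a' -ij => /(_ ai) N0.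
have muT : mu1 setT = +oo%E by rewrite -set_itvNyy lebesgue_measure_itv.
rewrite lebesgue_tuple_cons//.
transitivity (\int[lam n]_t
    (+oo * (\1_[set y | (\sum_j a' j * tnth y j = 0)%R] t)%:E))%E.
  apply: eq_integral => t _; rewrite indicE.
  have [tN|tN] := boolP (t \in [set y : n.-tuple R | \sum_j a' j * tnth y j = 0]).
    rewrite mule1 -muT; congr (mu1 _).
    apply/seteqP; split=> // s _; rewrite /= sumE a0 mul0r add0r.
    by move: tN; rewrite inE.
  rewrite mule0 (_ : [set s | _] = set0) ?measure0//.
  apply/seteqP; split=> // s; rewrite /= sumE a0 mul0r add0r => h.
  by move: tN; rewrite notin_setE.
rewrite ge0_integralZl//.
- rewrite integral_indic//; last exact: (mA _ a').
  rewrite setIT -[RHS](mule0 +oo%E); congr (_ * _)%E; exact: N0.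
- by apply/measurable_EFinP/measurable_indic; exact: (mA _ a').
Qed.

End null_sections.

Section chart_sections.
Context {R : realType} (X : geometry) (n : nat).
Local Notation T := (n.-tuple (measurableTypeR R)).
Implicit Types (y : n.-tuple R) (l : 'rV[R]_n.+1).

Definition chart_form l y := l 0 0 * height X y + \sum_j l 0 (lift ord0 j) * tnth y j.

Lemma chart_formE l y : (l *m pt X (rowt y)) 0 0 = chart_form l y.
Proof.
rewrite mxE big_ord_recl; congr (_ * _ + _); first by rewrite pt0 heightE.
by apply: eq_bigr => j _; rewrite ptS mxE.
Qed.

Lemma measurable_chart_form l : measurable_fun setT (fun y : T => chart_form l y : R).
Proof.
apply: measurable_funD; last exact: measurable_linear.
by apply: measurable_funM => //; exact: measurable_height.
Qed.

Lemma measurable_in_chart : measurable [set y : T | 0 < radicand X y].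
Proof.
rewrite (_ : [set y | _] = (fun y : T => radicand X y) @^-1` [set` `]0, +oo[]).
  rewrite -[X in measurable X]setTI; exact: measurable_radicand.
by apply/seteqP; split=> y /=; rewrite in_itv /= andbT.
Qed.

Lemma measurable_chart_zero l : measurable [set y : T | 0 < radicand X y /\ chart_form l y = 0].
Proof.
apply: measurableI; first exact: measurable_in_chart.
by apply: measurable_zero_set; exact: measurable_chart_form.
Qed.

End chart_sections.

Section null_chart_sections.
Context {R : realType} (X : geometry) (n : nat).
Hypothesis n_gt0 : (0 < n)%N.
Local Notation kap := (@curvature R X).
Local Notation T := (n.-tuple (measurableTypeR R)).
Local Notation lam := (@lebesgue_tuple R n).
Local Notation dmu := (@density_measure R X n).
Implicit Types (l : 'rV[R]_n.+1).

(** Without head coefficient this is a linear hyperplane. Otherwise every section in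
    the first chart coordinate lies in the zero set of a quadratic polynomial. *)
Lemma lebesgue_chart_zero l : l != 0 ->
  lam [set y : T | 0 < radicand X y /\ chart_form X l y = 0] = 0%E.
Proof.
move=> l0; have [l00|l00] := eqVneq (l 0 0) 0.
  have [i li] : exists i, l 0 (lift ord0 i) != 0.
    apply/existsP; apply: contraR l0 => /existsPn h.
    apply/eqP/rowP => r; rewrite mxE; case: (unliftP ord0 r) => [j ->|->//].
    by apply/eqP; move: (h j); rewrite negbK.
  have := lebesgue_tuple_linear (a := fun i => l 0 (lift ord0 i)) li => h.
  apply/eqP; rewrite eq_le measure_ge0 andbT -h.
  apply: le_measure; rewrite ?inE; first exact: measurable_chart_zero.
    by apply: measurable_zero_set; exact: measurable_linear.
  by move=> y [_]; rewrite /chart_form l00 mul0r add0r.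
case: n n_gt0 l l00 l0 => // m _ l l00 l0.
have mZ := measurable_chart_zero X l.
apply: lebesgue_tuple_null_sections => // t.
(* Squaring the equation gives a nontrivial quadratic one for the head. *)
pose p := l 0 0; pose q := l 0 (lift ord0 ord0).
pose d := \sum_j l 0 (lift ord0 (lift ord0 j)) * tnth t j.
pose h := 1 - kap * \sum_j tnth t j ^+ 2.
have kk : kap = 1 \/ kap = -1 by rewrite /curvature; case: X; [right|left].
have HZ s : [set s | 0 < radicand X (tcons (s, t)) /\
      l 0 0 * height X (tcons (s, t)) +
      \sum_j l 0 (lift ord0 j) * tnth (tcons (s, t)) j = 0] s ->
    (0 < h - kap * s ^+ 2) /\ p ^+ 2 * (h - kap * s ^+ 2) = (q * s + d) ^+ 2.
  have rE : radicand X (tcons (s, t)) = h - kap * s ^+ 2.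
    rewrite /radicand /h big_ord_recl tnth_tcons0.
    by under eq_bigr do rewrite tnth_tconsS; ring.
  move=> [r0]; rewrite big_ord_recl tnth_tcons0 -/p -/q.
  under eq_bigr do rewrite tnth_tconsS.
  rewrite -/d -rE => e; split=> //.
  have -> : q * s + d = - (p * height X (tcons (s, t))) by lra.
  by rewrite sqrrN exprMn sqr_sqrtr// ltW.
apply: (@lebesgue_quadratic _ _ (q ^+ 2 + kap * p ^+ 2) (2 * q * d) (d ^+ 2 - p ^+ 2 * h)).
- exact: (measurable_tcons_section t mZ).
- by move=> s /HZ[_ e]; lra.
(* Its coefficients cannot all vanish: that would force [kap = -1], [p^2 = q^2] and
   [d = 0], hence [h = 0], while [h >= 1]. *)
apply/negPn/negP; rewrite !negb_or !negbK => /and3P[/eqP e1 /eqP e2 /eqP e3].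
have p0 : 0 < p ^+ 2 by rewrite exprn_even_gt0//; exact: l00.
case: kk => k1; first by rewrite k1 in e1; have := sqr_ge0 q; lra.
have h1 : 1 <= h.
  by rewrite /h k1 mulN1r opprK lerDl sum_sq_ge0.
have qn0 : q != 0 by apply/eqP => q0; rewrite q0 k1 in e1; lra.
have d0 : d = 0.
  by move/eqP: e2; rewrite mulf_eq0 mulf_eq0 pnatr_eq0 (negbTE qn0) => /eqP.
by rewrite d0 in e3; nra.
Qed.

Lemma density_chart_zero l : l != 0 ->
  dmu [set y : T | 0 < radicand X y /\ chart_form X l y = 0] = 0%E.
Proof.
move=> /lebesgue_chart_zero l0; rewrite /density_measure /=.
rewrite (ge0_negligible_integral (measurable_chart_zero X l)) ?setDv ?integral_set0//.
- exact: measurable_chart_zero.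
- by apply: measurable_funTS; apply/measurable_EFinP; exact: measurable_density.
- by move=> y _; rewrite lee_fin density_ge0.
Qed.

End null_chart_sections.

(** * Polytopes in the chart *)

Section polyhedral_unions.
Context {R : realType} (X : geometry) (n : nat).
Hypothesis n_gt0 : (0 < n)%N.
Local Notation T := (n.-tuple (measurableTypeR R)).
Local Notation dmu := (@density_measure R X n).
Local Notation M := (@model_space R X n).
Implicit Types (y w : n.-tuple R) (l : 'rV[R]_n.+1) (s : seq (seq 'rV[R]_n.+1)).

Definition union_of_polyhedra s : set 'cV[R]_n.+1 :=
  \bigcup_(L in [set` s]) polyhedral X L.

Definition nonzero_facets s := {in s, forall L, {in L, forall l, l != 0}}.

Lemma spanned_polyhedral (V : 'M[R]_n.+1) : nondeg X V ->
  spanned X V = polyhedral X [seq row i (invmx V) | i : 'I_n.+1].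
Proof.
move=> [Vu Vm]; apply/seteqP; split=> x [Mx].
  move=> [a a0 xa]; split=> // l /mapP[i _ ->].
  by rewrite xa -row_mul mxE mulKmx.
move=> h; split=> //; exists (invmx V *m x); last by rewrite mulKVmx.
move=> i; have := h (row i (invmx V)); rewrite -row_mul mxE; apply.
by apply: map_f; rewrite mem_enum.
Qed.

Lemma polytope_polyhedra P : polytope X P ->
  exists2 s, nonzero_facets s & P = union_of_polyhedra s.
Proof.
move=> /(polytope_subdivision [::])[s -> sn].
exists [seq [seq row i (invmx V) | i : 'I_n.+1] | V <- s].
  move=> L /mapP[V /sn[[Vu _] _] ->] l /mapP[i _ ->].
  apply/eqP => /(congr1 (mulmxr V)) /=; rewrite -row_mul mulVmx// mul0mx row1.
  by move=> /rowP/(_ i)/eqP; rewrite !mxE !eqxx oner_eq0.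
apply/seteqP; split=> x.
  move=> [V /= Vs]; rewrite spanned_polyhedral; last by have [] := sn _ Vs.
  by move=> xV; exists [seq row i (invmx V) | i : 'I_n.+1] => //=; exact: map_f.
move=> [L /= /mapP[V Vs ->] xV]; exists V => //.
by rewrite spanned_polyhedral//; have [] := sn _ Vs.
Qed.

Definition chart_part (P : set 'cV[R]_n.+1) : set T :=
  [set y | 0 < radicand X y /\ P (pt X (rowt y))].

Lemma chart_partP s y : chart_part (union_of_polyhedra s) y <->
  0 < radicand X y /\ exists2 L, L \in s & {in L, forall l, 0 <= chart_form X l y}.
Proof.
split=> [[dy [L /= Ls [_ h]]]|[dy [L Ls h]]]; split=> //.
  by exists L => // l lL; rewrite -chart_formE; exact: h.
exists L => //; split; first by apply: pt_model; rewrite /in_chart -radicandE.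
by move=> l lL; rewrite chart_formE; exact: h.
Qed.

Lemma measurable_forms (L : seq 'rV[R]_n.+1) (I : interval R) :
  measurable [set y : T | {in L, forall l, chart_form X l y \in I}].
Proof.
elim: L => [|l L IH].
  by rewrite (_ : [set y | _] = setT)//; apply/seteqP; split.
rewrite (_ : [set y | _] = ((fun y : T => chart_form X l y) @^-1` [set` I]) `&`
    [set y : T | {in L, forall l, chart_form X l y \in I}]).
  apply: measurableI => //; rewrite -[X in measurable X]setTI.
  exact: measurable_chart_form.
apply/seteqP; split=> y /=.
  by move=> h; split=> [|k kL]; apply: h; rewrite inE ?eqxx ?kL ?orbT.
by move=> [h1 h2] k; rewrite inE => /orP[/eqP ->|/h2].
Qed.

Lemma measurable_seq_exists (I : eqType) (s : seq I) (A : I -> set T) :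
  (forall i, measurable (A i)) -> measurable [set y | exists2 i, i \in s & A i y].
Proof.
move=> mA; rewrite (_ : [set y | _] = \big[setU/set0]_(i <- s) A i).
  exact: measurable_seqU.
by apply/seteqP; split=> y /seqUP.
Qed.

Lemma measurable_chart_part s : measurable (chart_part (union_of_polyhedra s)).
Proof.
rewrite (_ : chart_part _ = [set y : T | 0 < radicand X y] `&`
  [set y : T | exists2 L, L \in s &
     [set y : T | {in L, forall l, chart_form X l y \in `[0, +oo[}] y]).
  apply: measurableI; first exact: measurable_in_chart.
  by apply: measurable_seq_exists => L; exact: measurable_forms.
apply/seteqP; split=> y.
  move=> /chart_partP[dy [L Ls h]]; split=> //; exists L => // l lL.
  by rewrite in_itv /= andbT h.
move=> [dy [L Ls h]]; apply/chart_partP; split=> //; exists L => // l lL.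
by have := h l lL; rewrite in_itv /= andbT.
Qed.

Lemma ball_sup_lt (f : n.-tuple R -> R) y (c : R) :
  continuous (fun u : 'rV[R]_n => f (untup u)) -> f y < c ->
  exists2 r, 0 < r & forall w, ball_sup y r w -> f w < c.
Proof.
move=> cf fy; have fy' : f (untup (rowt y)) < c by rewrite rowtK.
have H : \forall u \near rowt y, f (untup u) < c by exact: (cvgr_lt _ (cf (rowt y))).
have /nbhs_ballP[r /= r0 h] := H; exists r => // w wr.
rewrite -(rowtK w); apply: h; split=> // i j.
by rewrite ord1 !mxE /ball /= distrC; exact: wr.
Qed.

Lemma ball_sup_gt (f : n.-tuple R -> R) y (c : R) :
  continuous (fun u : 'rV[R]_n => f (untup u)) -> c < f y ->
  exists2 r, 0 < r & forall w, ball_sup y r w -> c < f w.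
Proof.
move=> cf cy; have [||r r0 rP] := @ball_sup_lt (fun y => - f y) y (- c).
- by move=> u; apply: (cvgN (cf u)).
- by rewrite ltrN2.
by exists r => // w /rP; rewrite ltrN2.
Qed.

Lemma continuous_radicand : continuous (fun u : 'rV[R]_n => radicand X (untup u)).
Proof.
rewrite (_ : (fun _ => _) = (fun u : 'rV[R]_n => partial_rad X 0 u)).
  exact: continuous_partial_rad.
by apply/funext=> u; rewrite radicandE untupK.
Qed.

Lemma continuous_chart_form l : continuous (fun u : 'rV[R]_n => chart_form X l (untup u)).
Proof.
have ch : continuous (fun u : 'rV[R]_n => height X (untup u)).
  move=> u; apply: (continuous_comp (f := fun u : 'rV[R]_n => radicand X (untup u))
    (g := Num.sqrt)); [exact: continuous_radicand | exact: sqrt_continuous].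
have ct : continuous (fun u : 'rV[R]_n => \sum_j l 0 (lift ord0 j) * tnth (untup u) j).
  apply: continuous_big => [|j _ v]; first exact: add_continuous.
  have ctj : {for v, continuous (fun u : 'rV[R]_n => tnth (untup u) j)}.
    rewrite (_ : (fun _ => _) = (fun u : 'rV[R]_n => u 0 j)).
      exact: coord_continuous.
    by apply/funext=> u; rewrite tnth_mktuple.
  have c : {for v, continuous (fun u : 'rV[R]_n => l 0 (lift ord0 j) * tnth (untup u) j)}.
    by apply: continuousM; first exact: cst_continuous.
  exact: c.
move=> u; have c : {for u, continuous (fun u : 'rV[R]_n => chart_form X l (untup u))}.
  apply: continuousD; last exact: ct.
  by apply: continuousM; [exact: cst_continuous | exact: ch].
exact: c.
Qed.

Lemma ball_sup_seq (I : eqType) (s : seq I) (P : I -> n.-tuple R -> Prop) y :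
  (forall i, i \in s -> exists2 r, 0 < r & forall w, ball_sup y r w -> P i w) ->
  exists2 r, 0 < r & forall w, ball_sup y r w -> forall i, i \in s -> P i w.
Proof.
elim: s => [|i s IH] h; first by exists 1.
have [|r r0 rP] := h i; first by rewrite mem_head.
have [|q q0 qP] := IH; first by move=> j js; apply: h; rewrite inE js orbT.
exists (Num.min r q); first by rewrite lt_min r0.
move=> w wm j; rewrite inE => /orP[/eqP ->|js].
  by apply: rP => k; have := wm k; rewrite lt_min => /andP[].
by apply: qP => // k; have := wm k; rewrite lt_min => /andP[].
Qed.

Lemma ball_sup_coord y (i : 'I_n) (r : R) : 0 < r ->
  exists2 q, 0 < q & forall w, ball_sup y q w -> `|tnth w i| < `|tnth y i| + r.
Proof.
move=> r0; exists r => // w /(_ i) wi.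
rewrite -[tnth w i](subrK (tnth y i)); apply: le_lt_trans (ler_normD _ _) _.
by rewrite addrC ltrD2l.
Qed.

(** The bounds [a] and [K] make this compact in the chart; the bound [d] on the
    coordinates in [I] cuts out slabs around coordinate hyperplanes. *)
Definition compact_part s (a K : R) (I : pred 'I_n) (d : R) : set T :=
  [set y | [/\ a <= radicand X y, forall i, `|tnth y i| <= K,
     forall i, I i -> `|tnth y i| <= d &
     chart_part (union_of_polyhedra s) y]].

Lemma measurable_norm_le (I : pred 'I_n) (K : R) :
  measurable [set y : T | forall i, I i -> `|tnth y i| <= K].
Proof.
rewrite (_ : [set y | _] = \bigcap_(i in [set` I]) ((fun y : T => tnth y i) @^-1` `[- K, K])).
  apply: fin_bigcap_measurable => // i _; rewrite -[X in measurable X]setTI.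
  by apply: measurable_tnth.
by apply/seteqP; split=> y h i Ii; have := h i Ii; rewrite /= in_itv /= -ler_norml.
Qed.

Lemma measurable_compact_part s a K I d : measurable (compact_part s a K I d).
Proof.
rewrite (_ : compact_part s a K I d =
  (fun y : T => radicand X y) @^-1` `[a, +oo[ `&`
  ([set y : T | forall i, predT i -> `|tnth y i| <= K] `&`
  ([set y : T | forall i, I i -> `|tnth y i| <= d] `&` chart_part (union_of_polyhedra s)))).
  apply: measurableI.
    rewrite -[X in measurable X]setTI; exact: measurable_radicand.
  apply: measurableI; first exact: measurable_norm_le.
  apply: measurableI; first exact: measurable_norm_le.
  exact: measurable_chart_part.
apply/seteqP; split=> y /=.
  by move=> [h1 h2 h3 h4]; split; first by rewrite in_itv /= andbT.
by move=> [h1 [h2 [h3 h4]]]; split=> //; [move: h1; rewrite in_itv /= andbT | move=> i; exact: h2].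
Qed.

Lemma coverable_compact_part s (a K d c : R) I : 0 < a ->
  (dmu (compact_part s a K I d) < c%:E)%E ->
  coverable X (chart_image X (compact_part s a K I d)) c.
Proof.
move=> a0; apply: (@coverable_closed R X n n_gt0 _ a K) => //.
- exact: measurable_compact_part.
- by move=> y [].
move=> y ny.
have [ya|ya] := ltP (radicand X y) a.
  have [r r0 rP] := ball_sup_lt continuous_radicand ya.
  by exists r => // w /rP wa [aw _ _ _]; move: wa; rewrite ltNge aw.
have out (i : 'I_n) (q : R) : q < `|tnth y i| -> (forall w, compact_part s a K I d w ->
    `|tnth w i| <= q) -> exists2 r, 0 < r & forall w, ball_sup y r w ->
    ~ compact_part s a K I d w.
  move=> yq h; exists (`|tnth y i| - q); first by rewrite subr_gt0.
  move=> w /(_ i) wi /h wq; have : `|tnth y i| <= `|tnth w i| + `|tnth w i - tnth y i|.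
    rewrite -[X in `|X| <= _](subrK (tnth w i)) addrC.
    by apply: le_trans (ler_normD _ _) _; rewrite distrC.
  by lra.
have [/existsP[i yi]|/existsPn yK] := boolP [exists i, K < `|tnth y i|].
  by apply: (out i K yi) => w [_ h _ _]; exact: h.
have [/existsP[i /andP[Ii yi]]|/existsPn yd] := boolP [exists i, I i && (d < `|tnth y i|)].
  by apply: (out i d yi) => w [_ _ h _]; exact: h.
have ys : forall L, L \in s -> exists2 r, 0 < r & forall w, ball_sup y r w ->
    ~ {in L, forall l, 0 <= chart_form X l w}.
  move=> L Ls; have /existsNP[l /not_implyP[lL /negP]] :
      ~ forall l, l \in L -> 0 <= chart_form X l y.
    move=> h; apply: ny; split=> //.
    - by move=> i; rewrite leNgt; exact: yK.
    - by move=> i Ii; rewrite leNgt; have := yd i; rewrite Ii.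
    - apply/chart_partP; split; first exact: lt_le_trans ya.
      by exists L.
  rewrite -ltNge => ly; have [r r0 rP] := ball_sup_lt (@continuous_chart_form l) ly.
  by exists r => // w /rP wl h; have := h l lL; rewrite leNgt wl.
have [r r0 rP] := ball_sup_seq ys.
exists r => // w /rP wn [_ _ _ /chart_partP[_ [L Ls h]]].
exact: (wn L Ls h).
Qed.

(** The interior of the polyhedra is an increasing union of open sets to which
    [packable_open] applies, and it has full volume because facets are null. *)
Lemma packable_chart_part s (c : R) : nonzero_facets s ->
  (c%:E < dmu (chart_part (union_of_polyhedra s)))%E ->
  packable X (union_of_polyhedra s `&` [set x | 0 < x 0 0]) c.
Proof.
move=> sn cs.
pose Z l : set T := [set y | 0 < radicand X y /\ chart_form X l y = 0].
pose I0 := [set y : T | exists2 L, L \in s &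
  [set y : T | {in L, forall l, chart_form X l y \in `]0, +oo[}] y].
pose W (m : nat) : set T := [set y | [/\ m.+1%:R^-1 < radicand X y,
  forall i, `|tnth y i| < m%:R & I0 y]].
pose W0 := [set y : T | 0 < radicand X y] `&` I0.
have mI0 : measurable I0 by apply: measurable_seq_exists => L; exact: measurable_forms.
have mW0 : measurable W0 by apply: measurableI => //; exact: measurable_in_chart.
have mW m : measurable (W m).
  rewrite (_ : W m = (fun y : T => radicand X y) @^-1` `]m.+1%:R^-1, +oo[ `&`
    (\bigcap_(i in [set: 'I_n]) ((fun y : T => tnth y i) @^-1` `]- m%:R, m%:R[) `&` I0)).
    apply: measurableI.
      rewrite -[X in measurable X]setTI; exact: measurable_radicand.
    apply: measurableI => //; apply: fin_bigcap_measurable => // i _.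
    rewrite -[X in measurable X]setTI; exact: measurable_tnth.
  apply/seteqP; split=> y /=.
    move=> [h1 h2 h3]; split; first by rewrite in_itv /= andbT.
    by split=> // i _; rewrite /= in_itv /= -ltr_norml.
  move=> [h1 [h2 h3]]; split=> //; first by move: h1; rewrite in_itv /= andbT.
  by move=> i; have := h2 i Logic.I; rewrite /= in_itv /= -ltr_norml.
have WU : \bigcup_m W m = W0.
  apply/seteqP; split=> y.
    move=> [m _ [h1 _ h3]]; split=> //=; apply: lt_trans h1.
    by rewrite invr_gt0.
  move=> [dy iy]; have [m1 m1P] := side_small dy.
  pose b := \sum_i `|tnth y i|.
  have b0 : 0 <= b by apply: sumr_ge0 => *; exact: normr_ge0.
  pose m2 := Num.bound b.
  exists (maxn m1 m2) => //; split=> //; first by apply: m1P; exact: leq_maxl.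
  move=> i; apply: (@le_lt_trans _ _ b).
    by rewrite /b (bigD1 i)//= lerDl; apply: sumr_ge0 => *; exact: normr_ge0.
  by apply: lt_le_trans (archi_boundP b0) _; rewrite ler_nat leq_maxr.
have cW0 : (c%:E < dmu W0)%E.
  apply: lt_le_trans cs _.
  pose zs := flatten s; pose N := \big[setU/set0]_(l <- zs) Z l.
  have mZ l : measurable (Z l) by exact: measurable_chart_zero.
  have mN : measurable N by exact: measurable_seqU.
  have N0 : (dmu N <= 0)%E.
    apply: le_trans (measure_seqU_le dmu mZ zs) _.
    rewrite big_seq big1// => l /flattenP[L Ls lL].
    by apply: density_chart_zero => //; exact: (sn L Ls).
  apply: (@le_trans _ _ (dmu (W0 `|` N))).
    apply: le_measure; rewrite ?inE; [exact: measurable_chart_part|exact: measurableU|].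
    move=> y /chart_partP[dy [L Ls h]].
    have [Lp|/existsNP[l /not_implyP[lL ln]]] :=
        pselect (forall l, l \in L -> 0 < chart_form X l y).
      left; split=> //; exists L => // l lL.
      by rewrite in_itv /= andbT Lp.
    right; apply/seqUP; exists l; first by apply/flattenP; exists L.
    split=> //; apply/eqP; rewrite eq_le h// andbT leNgt.
    exact/negP.
  apply: le_trans (measureU2 _ _ _) _ => //.
  by rewrite -[leRHS]adde0; apply: leeD => //; exact: N0.
have Wcvg : (dmu \o W) m @[m --> \oo] --> dmu W0.
  rewrite -WU; apply: nondecreasing_cvg_mu => //; first by rewrite WU.
  move=> p q pq; apply/subsetPset => y [h1 h2 h3]; split=> //.
    apply: le_lt_trans h1; rewrite lef_pV2 ?posrE ?ltr0n// ler_nat; exact: pq.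
  by move=> i; apply: lt_le_trans (h2 i) _; rewrite ler_nat.
have : \forall m \near \oo, (c%:E < (dmu \o W) m)%E.
  apply: (Wcvg [set x | (c%:E < x)%E]).
  by apply: open_nbhs_nbhs; split => //; exact: open_ereal_gt_ereal.
move=> [m _ /(_ m (leqnn m))] /= cWm.
have a0 : 0 < m.+1%:R^-1 :> R by rewrite invr_gt0.
have : packable X (chart_image X (W m)) c.
  apply: (@packable_open R X n n_gt0 _ m.+1%:R^-1 m%:R) => //.
    by move=> y [/ltW h1 h2 _]; split=> // i; exact/ltW/h2.
  move=> y [h1 h2 [L Ls h3]].
  have [r1 r10 r1P] := ball_sup_gt continuous_radicand h1.
  have [r2 r20 r2P] : exists2 r, 0 < r & forall w, ball_sup y r w ->
      forall i : 'I_n, i \in enum 'I_n -> `|tnth w i| < m%:R.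
    apply: ball_sup_seq => i _; have := h2 i; rewrite -subr_gt0 => /(ball_sup_coord y i)[q q0 qP].
    by exists q => // w /qP; rewrite addrC subrK.
  have [r3 r30 r3P] : exists2 r, 0 < r & forall w, ball_sup y r w ->
      forall l, l \in L -> 0 < chart_form X l w.
    apply: ball_sup_seq => l lL.
    have l0 : 0 < chart_form X l y by have := h3 l lL; rewrite in_itv /= andbT.
    exact: (ball_sup_gt (@continuous_chart_form l) l0).
  exists (Num.min r1 (Num.min r2 r3)); first by rewrite !lt_min r10 r20.
  move=> w wr; split.
  - have : ball_sup y r1 w by move=> i; have := wr i; rewrite !lt_min => /and3P[].
    exact: r1P.
  - have : ball_sup y r2 w by move=> i; have := wr i; rewrite !lt_min => /and3P[].
    by move=> /r2P h i; apply: h; rewrite mem_enum.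
  - have : ball_sup y r3 w by move=> i; have := wr i; rewrite !lt_min => /and3P[].
    move=> /r3P h; exists L => // l lL; by rewrite in_itv /= andbT h.
apply: packableS => // x [y [h1 _ [L Ls h3]] <-].
have dy : 0 < radicand X y by exact: lt_trans h1.
split; last by rewrite /= pt0 -heightE sqrtr_gt0.
exists L => //; split; first by apply: pt_model; rewrite /in_chart -radicandE.
by move=> l lL; rewrite chart_formE; have := h3 l lL; rewrite in_itv /= andbT => /ltW.
Qed.

End polyhedral_unions.

(** * The hyperbolic case *)

Section finish.
Context {R : realType}.

Lemma ereal_between (a b : \bar R) : (0 <= a)%E -> (a < b)%E ->
  exists2 c : R, (a < c%:E)%E & (c%:E < b)%E.
Proof.
case: a => [a| |]//; case: b => [b| |]// _; rewrite ?lte_fin => ab.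
  by exists ((a + b) / 2); rewrite lte_fin; lra.
by exists (a + 1); rewrite ?ltry// lte_fin; lra.
Qed.

Lemma ereal_split (a b : \bar R) (c : R) : (0 <= a)%E -> (0 <= b)%E ->
  (c%:E < a + b)%E ->
  exists c1 c2, [/\ (c1%:E < a)%E, (c2%:E < b)%E & c <= c1 + c2].
Proof.
case: a => [a| |]//; case: b => [b| |]// a0 b0 cab.
- move: cab; rewrite -EFinD lte_fin => cab.
  pose d := (a + b - c) / 2; exists (a - d), (b - d).
  by rewrite !lte_fin /d; split; lra.
- exists (-1), (c + 1); rewrite ltry lte_fin; split=> //; last by lra.
  by move: a0; rewrite lee_fin; lra.
- exists (c + 1), (-1); rewrite ltry lte_fin; split=> //; last by lra.
  by move: b0; rewrite lee_fin; lra.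
- exists (c + 1), 0; rewrite !ltry; split=> //; lra.
Qed.

Lemma sheet_vol_chart (X : geometry) n (P : set 'cV[R]_n.+1) :
  sheet_vol X false P = density_measure X (chart_part X P).
Proof.
rewrite sheet_volE; congr (density_measure X _).
by apply/seteqP; split=> y [dy Py]; split=> //; [rewrite -chartE | rewrite chartE].
Qed.

(** The nonnegative coordinates of a point of a hyperbolic simplex on its
    vertices have sum at most 1, by the reversed Cauchy-Schwarz inequality. *)
Lemma hyperbolic_spanned_bounded n (V : 'M[R]_n.+1) x r : nondeg Hyperbolic V ->
  spanned Hyperbolic V x -> `|x r 0| <= \sum_a \sum_b `|V a b|.
Proof.
move=> [_ Vm] [Mx [a a0 xa]].
have S1 : \sum_i a i 0 <= 1.
  have S0 : 0 <= \sum_i a i 0 by exact: sumr_ge0.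
  have q : qform Hyperbolic x <= - (\sum_i a i 0) ^+ 2.
    rewrite /qform xa mulmx_col_sum bform_suml expr2 mulr_suml -sumrN.
    apply: ler_sum => i _; rewrite bformZl -mulrN ler_wpM2l// bform_sumr -sumrN.
    apply: ler_sum => j _; rewrite bformZr -mulrN1 ler_wpM2l//.
    exact: model_bform_leN1.
  have := model_qform Mx; rewrite /curvature => qx.
  by move: q; rewrite qx lerN2; nra.
have ai i : a i 0 <= 1.
  by apply: le_trans S1; rewrite (bigD1 i)//= lerDl; exact: sumr_ge0.
rewrite xa mxE; apply: le_trans (ler_norm_sum _ _ _) _.
apply: (@le_trans _ _ (\sum_b `|V r b|)).
  apply: ler_sum => j _; rewrite normrM ler_piMr// ger0_norm//.
by rewrite [leRHS](bigD1 r)//= lerDl; apply: sumr_ge0 => *; apply: sumr_ge0.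
Qed.

Lemma hyperbolic_polytope_bounded n (P : set 'cV[R]_n.+1) :
  polytope Hyperbolic P -> exists K, forall x, P x -> forall r, `|x r 0| <= K.
Proof.
move=> /(polytope_subdivision [::])[s -> sn].
exists (\sum_(V <- s) \sum_a \sum_b `|V a b|) => x [V /= Vs Vx] r.
apply: le_trans (hyperbolic_spanned_bounded r (sn _ Vs).1 Vx) _.
rewrite (big_rem V)//= lerDl; apply: sumr_ge0 => W _.
by apply: sumr_ge0 => *; apply: sumr_ge0.
Qed.

Lemma hyperbolic_coverable n (P : set 'cV[R]_n.+1) (c : R) : (0 < n)%N ->
  polytope Hyperbolic P -> (vol Hyperbolic P < c%:E)%E -> coverable Hyperbolic P c.
Proof.
move=> n0 pP; rewrite /vol sheet_vol_chart => Pc.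
have [K PK] := hyperbolic_polytope_bounded pP.
have [s sn Ps] := polytope_polyhedra pP.
have Pcp : compact_part Hyperbolic s 1 K pred0 0 = chart_part Hyperbolic P.
  apply/seteqP; split=> y; first by move=> [_ _ _]; rewrite -Ps.
  move=> [dy Py]; split=> //; last by rewrite -Ps.
    rewrite /radicand /= mulN1r opprK lerDl.
    exact: (sum_sq_ge0 (fun i => tnth y i)).
  by move=> i; have := PK _ Py (lift ord0 i); rewrite ptS mxE.
rewrite -Pcp in Pc.
apply: coverableS (coverable_compact_part n0 ltr01 Pc) => // x Px.
have Mx : model_space Hyperbolic x by move: Px; rewrite Ps => -[L _ []].
have [dz xz] := pt_in_chart Mx Mx.2.
exists (untup (\row_j x (lift ord0 j) 0)); last by rewrite untupK -xz.
by rewrite Pcp; split; rewrite ?radicandE untupK// -xz.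
Qed.

Lemma hyperbolic_packable n (Q : set 'cV[R]_n.+1) (c : R) : (0 < n)%N ->
  polytope Hyperbolic Q -> (c%:E < vol Hyperbolic Q)%E -> packable Hyperbolic Q c.
Proof.
move=> n0 pQ; rewrite /vol sheet_vol_chart.
have [s sn ->] := polytope_polyhedra pQ => cQ.
by apply: packableS (packable_chart_part n0 sn cQ) => // x [].
Qed.

(** * The spherical case *)

Section spherical.
Variable n : nat.
Hypothesis n_gt0 : (0 < n)%N.
Local Notation S := Spherical.
Local Notation M := (@model_space R S n).
Local Notation dmu := (@density_measure R S n).
Local Notation T := (n.-tuple (measurableTypeR R)).
Implicit Types (x : 'cV[R]_n.+1) (i j : 'I_n).

Definition signed_perm (p : {perm 'I_n.+1}) (d : 'I_n.+1 -> bool) : 'M[R]_n.+1 :=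
  \matrix_(r, c) ((-1) ^+ d r * (c == p r)%:R).

Lemma signed_permE p d (x : 'cV[R]_n.+1) r :
  (signed_perm p d *m x) r 0 = (-1) ^+ d r * x (p r) 0.
Proof.
rewrite mxE (bigD1 (p r))//= mxE eqxx mulr1 big1 ?addr0// => c cp.
by rewrite mxE (negbTE cp) mulr0 mul0r.
Qed.

Lemma signed_perm_isometry p d : is_isometry S (signed_perm p d).
Proof.
have gg : (signed_perm p d)^T *m signed_perm p d = 1%:M.
  apply/matrixP => a b; rewrite !mxE (bigD1 (perm_inv p a))//= !mxE permKV eqxx mulr1.
  rewrite mulrA -expr2 sqrr_sign mul1r big1 ?addr0 1?eq_sym// => c cp.
  rewrite !mxE (_ : (a == p c) = false) ?mulr0 ?mul0r//.
  by apply: contra_neqF cp => /eqP ->; rewrite permK.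
split=> //; exact: (mulmx1_unit gg).2.
Qed.

Definition reflection := signed_perm 1%g (fun r => r == 0).

Lemma reflection0 x : (reflection *m x) 0 0 = - x 0 0.
Proof. by rewrite signed_permE perm1 eqxx expr1 mulN1r. Qed.

Lemma reflectionS x i : (reflection *m x) (lift ord0 i) 0 = x (lift ord0 i) 0.
Proof. by rewrite signed_permE perm1 mul1r. Qed.

Lemma reflectionK x : reflection *m (reflection *m x) = x.
Proof.
apply/colP => r; case: (unliftP ord0 r) => [j ->|->]; first by rewrite !reflectionS.
by rewrite !reflection0 opprK.
Qed.

Lemma reflection_isometry : is_isometry S reflection.
Proof. exact: signed_perm_isometry. Qed.

Lemma reflection_model x : M (reflection *m x) <-> M x.
Proof.
split; last by apply: isometry_model; exact: reflection_isometry.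
by move=> /(isometry_model reflection_isometry); rewrite reflectionK.
Qed.

Definition reflect_facets (s : seq (seq 'rV[R]_n.+1)) :=
  [seq [seq l *m reflection | l <- L] | L <- s].

Lemma reflect_facetsE s x :
  union_of_polyhedra S (reflect_facets s) x <-> union_of_polyhedra S s (reflection *m x).
Proof.
split=> [[_ /= /mapP[L Ls ->] [Mx h]]|[L /= Ls [Mx h]]].
  exists L => //; split; first exact/reflection_model.
  by move=> l lL; rewrite mulmxA; apply: h; exact: map_f.
exists [seq l *m reflection | l <- L]; first exact: map_f.
split; first exact/reflection_model.
by move=> _ /mapP[l lL ->]; rewrite -mulmxA; exact: h.
Qed.

Lemma reflect_facets_nonzero s : nonzero_facets s -> nonzero_facets (reflect_facets s).
Proof.
move=> sn _ /mapP[L Ls ->] _ /mapP[l lL ->].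
apply/eqP => /(congr1 (mulmxr (invmx reflection))) /=.
rewrite mul0mx mulmxK ?(isometry_unit reflection_isometry)// => /eqP.
by apply/negP; exact: (sn L Ls).
Qed.

(** The reflection carries the lower sheet to the upper one, which is the one
    described by [pt]. *)
Lemma vol_spherical s : vol S (union_of_polyhedra S s) =
  (dmu (chart_part S (union_of_polyhedra S s)) +
   dmu (chart_part S (union_of_polyhedra S (reflect_facets s))))%E.
Proof.
rewrite /vol sheet_vol_chart; congr (_ + _)%E; rewrite sheet_volE.
congr (density_measure S _).
have cE y : chart S true y = reflection *m pt S (rowt y).
  apply/colP => r; case: (unliftP ord0 r) => [j ->|->].
    by rewrite chart_tail reflectionS ptS mxE.
  by rewrite chart_head reflection0 pt0 heightE expr1 mulN1r.
apply/seteqP; split=> y [dy].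
  by rewrite cE => h; split=> //; apply/reflect_facetsE.
by move=> /reflect_facetsE h; split=> //; rewrite cE.
Qed.

Lemma sphere_sum x : M x -> \sum_r x r 0 ^+ 2 = 1.
Proof. by move=> /model_qform; rewrite qformE /= mul1r => <-; rewrite big_ord_recl. Qed.

Lemma sphere_le1 x r : M x -> `|x r 0| <= 1.
Proof.
move=> /sphere_sum xs; rewrite -(@ler_pXn2r _ 2)// ?nnegrE// expr1n real_normK ?num_real//.
by rewrite -xs (bigD1 r)//= lerDl sumr_ge0// => *; exact: sqr_ge0.
Qed.

Lemma radicand_row x : M x -> 0 < x 0 0 ->
  radicand S (untup (\row_j x (lift ord0 j) 0)) = x 0 0 ^+ 2.
Proof.
move=> Mx x0; have [dz xz] := pt_in_chart Mx x0.
by rewrite radicandE untupK {2}xz pt0 sqr_ph.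
Qed.

(** Near the equator the density is unbounded. A point there has another
    coordinate that is not small, and exchanging it with the first one moves the
    point to a thin slab of the chart around a coordinate hyperplane. *)
Definition slab (m : nat) (i : 'I_n) : set T :=
  compact_part S [:: [::]] n.+1%:R^-1 1 (pred1 i) m.+1%:R^-1.

Lemma measurable_slab m i : measurable (slab m i).
Proof. exact: measurable_compact_part. Qed.

(** The slabs decrease to the intersection with a coordinate hyperplane, which is
    null by [density_chart_zero]. *)
Lemma slab_small (i : 'I_n) (eta : R) : 0 < eta ->
  exists m0, forall m, (m0 <= m)%N -> (dmu (slab m i) < eta%:E)%E.
Proof.
move=> eta0.
have a0 : 0 < n.+1%:R^-1 :> R by rewrite invr_gt0.
have fin : (dmu (slab 0 i) < +oo)%E.
  apply: (@density_measure_fin R S n _ 1 (Num.sqrt n.+1%:R^-1)^-1).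
    exact: measurable_slab.
  move=> y [ya y1 _ _]; split=> //; rewrite lef_pV2 ?posrE ?sqrtr_gt0//.
    by rewrite ler_wsqrtr.
  exact: lt_le_trans ya.
have mono p q : (p <= q)%N -> slab q i `<=` slab p i.
  move=> pq y [h1 h2 h3 h4]; split=> // j ji; apply: le_trans (h3 j ji) _.
  by rewrite lef_pV2 ?posrE ?ltr0n// ler_nat.
pose l : 'rV[R]_n.+1 := delta_mx 0 (lift ord0 i).
have l0 : l != 0.
  by apply/eqP => /rowP/(_ (lift ord0 i))/eqP; rewrite !mxE !eqxx oner_eq0.
have cap0 : dmu (\bigcap_m slab m i) = 0%E.
  apply/eqP; rewrite eq_le measure_ge0 andbT.
  rewrite -(density_chart_zero S n_gt0 l0); apply: le_measure; rewrite ?inE.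
  - by apply: bigcap_measurableType => m _; exact: measurable_slab.
  - exact: measurable_chart_zero.
  move=> y h; have [ya _ _ _] := h 0%N Logic.I; split; first exact: lt_le_trans ya.
  have -> : chart_form S l y = tnth y i.
    rewrite /chart_form (bigD1 i)//= big1 => [|j ji].
      by rewrite !mxE !eqxx /= mul0r mul1r add0r addr0.
    by rewrite mxE (inj_eq lift_inj) (negbTE ji) mul0r.
  apply: contrapT => /eqP yi; have yi0 : 0 < `|tnth y i| by rewrite normr_gt0.
  have [m mP] := side_small yi0.
  have [_ _ /(_ i (eqxx i)) + _] := h m Logic.I.
  by rewrite leNgt mP.
have cvg : (dmu \o slab^~ i) m @[m --> \oo] --> dmu (\bigcap_m slab m i).
  apply: nonincreasing_cvg_mu => //.
  - by move=> m; exact: measurable_slab.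
  - by apply: bigcap_measurableType => m _; exact: measurable_slab.
  - by move=> p q pq; apply/subsetPset; exact: mono.
have : \forall m \near \oo, ((dmu \o slab^~ i) m < eta%:E)%E.
  apply: (cvg [set x | (x < eta%:E)%E]).
  apply: open_nbhs_nbhs; split; first exact: open_ereal_lt_ereal.
  by rewrite /= cap0 lte_fin.
by move=> [m0 _ h]; exists m0 => m /h.
Qed.

(** The sign [p.2] allows for a negative coordinate to become a positive head. *)
Definition exchange (p : 'I_n * bool) : 'M[R]_n.+1 :=
  signed_perm (tperm 0 (lift ord0 p.1)) (fun r => p.2 && (r == lift ord0 p.1)).

(** A point of the sphere near the equator has a coordinate [x_i] with
    [x_i^2 >= 1 / (n + 1)], so some [exchange] carries it to a slab of small volume. *)
Lemma equator_coverable (eta : R) : 0 < eta ->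
  exists2 c, 0 < c & coverable S [set x | M x /\ `|x 0 0| <= c] eta.
Proof.
move=> eta0; have nR : (0 : R) < n%:R by rewrite ltr0n.
pose e1 := eta / (n%:R * 2).
have e10 : 0 < e1 by rewrite divr_gt0// mulr_gt0.
have [f fP] := boolp.choice (fun i => slab_small i e10).
pose m := (\sum_i f i + n)%N.
have fm i : (f i <= m)%N.
  by rewrite /m (bigD1 i)//= -addnA leq_addr.
exists m.+1%:R^-1; first by rewrite invr_gt0.
have a0 : 0 < n.+1%:R^-1 :> R by rewrite invr_gt0.
have cov p : coverable S (mulmx (exchange p) @` chart_image S (slab m p.1)) e1.
  apply: coverable_image; first exact: signed_perm_isometry.
  by apply: coverable_compact_part => //; exact: (fP _ _ (fm _)).
have sumE : \sum_(p <- enum {: 'I_n * bool}) e1 = eta.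
  rewrite big_enum /= sumr_const card_prod card_ord card_bool.
  by rewrite -mulr_natr natrM /e1 divfK// mulf_neq0// gt_eqF.
have := @coverable_seqU R S n _ (enum {: 'I_n * bool}) _ (fun=> e1) (fun p _ => cov p).
rewrite sumE; apply: coverableS => // x [Mx xe].
have m1 : m.+1%:R^-1 ^+ 2 <= n.+1%:R^-1 :> R.
  rewrite exprVn lef_pV2 ?posrE ?exprn_gt0// -natrX ler_nat.
  apply: leq_trans (leq_pmulr m.+1 (ltn0Sn m)).
  by rewrite ltnS /m leq_addl.
have [i xi] : exists i, n.+1%:R^-1 <= x (lift ord0 i) 0 ^+ 2.
  apply/existsP; rewrite -[X in is_true X]negbK; apply/negP => /existsPn h.
  have := sphere_sum Mx; rewrite big_ord_recl.
  have : x 0 0 ^+ 2 <= n.+1%:R^-1.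
    apply: le_trans m1; rewrite -real_normK ?num_real//.
    by rewrite ler_pXn2r ?nnegrE ?invr_ge0.
  have : \sum_(j < n) x (lift ord0 j) 0 ^+ 2 < \sum_(j < n) n.+1%:R^-1.
    apply: (@ltr_sum _ _ _ _ (fun j => x (lift ord0 j) 0 ^+ 2)) => [|j _].
      by apply/hasP; exists (Ordinal n_gt0); rewrite ?mem_index_enum.
    by rewrite ltNge; exact: h.
  rewrite sumr_const card_ord -[_ *+ n]mulr_natl => h1 h2 h3.
  have h4 : n%:R * n.+1%:R^-1 + n.+1%:R^-1 = 1 :> R.
    by rewrite -[X in _ + X]mul1r -mulrDl natr1 mulfV.
  have h5 := ler_ltD h2 h1.
  have h6 : x 0 0 ^+ 2 + \sum_(j < n) x (lift ord0 j) 0 ^+ 2 = 1 := h3.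
  by rewrite h6 [ltRHS]addrC h4 ltxx in h5.
pose p := (i, x (lift ord0 i) 0 < 0).
have ig : is_isometry S (exchange p) by exact: signed_perm_isometry.
pose z := invmx (exchange p) *m x.
have xz : exchange p *m z = x by rewrite /z mulKVmx// (isometry_unit ig).
have Mz : M z by apply: isometry_model => //; exact: isometryV.
have xE r : x r 0 =
    (-1) ^+ (p.2 && (r == lift ord0 i)) * z (tperm 0 (lift ord0 i) r) 0.
  by rewrite -[in LHS]xz /exchange signed_permE.
have zi : z (lift ord0 i) 0 = x 0 0 by rewrite xE tpermL andbF mul1r.
have xi0 : x (lift ord0 i) 0 = (-1) ^+ p.2 * z 0 0.
  by rewrite xE tpermR eqxx andbT.
have z0 : z 0 0 = `|x (lift ord0 i) 0|.
  have <- : (-1) ^+ p.2 * x (lift ord0 i) 0 = z 0 0.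
    by rewrite xi0 mulrA -expr2 sqrr_sign mul1r.
  rewrite /p /=; case: ltP => h; last by rewrite mul1r ger0_norm.
  by rewrite mulN1r ltr0_norm.
have zgt0 : 0 < z 0 0.
  by rewrite z0 normr_gt0 -sqrf_eq0 gt_eqF//; exact: lt_le_trans xi.
apply/seqUP; exists p; first by rewrite mem_enum.
exists z => //.
have [dz zz] := pt_in_chart Mz zgt0.
exists (untup (\row_j z (lift ord0 j) 0)); last by rewrite untupK -zz.
split.
- by rewrite radicand_row// z0 real_normK ?num_real.
- by move=> j; rewrite tnth_mktuple mxE; exact: sphere_le1.
- by move=> j /eqP ->; rewrite tnth_mktuple mxE zi.
- split; first by rewrite radicandE untupK.
  by exists [::] => //; rewrite untupK -zz.
Qed.

(** Away from a band around the equator each hemisphere is a compact part of the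
    chart, and the band costs arbitrarily little. *)
Lemma spherical_coverable (P : set 'cV[R]_n.+1) (c : R) :
  polytope S P -> (vol S P < c%:E)%E -> coverable S P c.
Proof.
move=> pP; have [s sn ->] := polytope_polyhedra pP; rewrite vol_spherical.
set s' := reflect_facets s.
have m1 : (0 <= dmu (chart_part S (union_of_polyhedra S s)))%E by exact: measure_ge0.
have m2 : (0 <= dmu (chart_part S (union_of_polyhedra S s')))%E by exact: measure_ge0.
move=> Pc.
have [c1 [c2 [p1 p2 c12]]] : exists c1 c2,
    [/\ (dmu (chart_part S (union_of_polyhedra S s)) < c1%:E)%E,
        (dmu (chart_part S (union_of_polyhedra S s')) < c2%:E)%E & c1 + c2 < c].
  move: m1 m2 Pc; case: (dmu _) => [a| |]//; case: (dmu _) => [b| |]// a0 b0.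
  rewrite -EFinD lte_fin => abc; pose d := (c - a - b) / 3.
  by exists (a + d), (b + d); rewrite !lte_fin /d; split; lra.
have [|e e0 eC] := @equator_coverable (c - (c1 + c2)); first by rewrite subr_gt0.
have e2 : 0 < e ^+ 2 by rewrite exprn_gt0.
have part t (b : R) : (dmu (chart_part S (union_of_polyhedra S t)) < b%:E)%E ->
    coverable S (chart_image S (compact_part S t (e ^+ 2) 1 pred0 0)) b.
  move=> tb; apply: coverable_compact_part => //; apply: le_lt_trans tb.
  apply: le_measure; rewrite ?inE; [exact: measurable_compact_part|exact: measurable_chart_part|].
  by move=> y [].
have C1 := part _ _ p1.
have C2 := coverable_image reflection_isometry (part _ _ p2).
apply: coverableS (coverableU eC (coverableU C1 C2)); last by lra.
have inpart t x : union_of_polyhedra S t x -> e < x 0 0 ->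
    chart_image S (compact_part S t (e ^+ 2) 1 pred0 0) x.
  move=> tx ex; have Mx : M x by case: tx => L _ [].
  have x0 : 0 < x 0 0 by exact: lt_trans ex.
  have [dz xz] := pt_in_chart Mx x0.
  exists (untup (\row_j x (lift ord0 j) 0)); last by rewrite untupK -xz.
  split=> //.
  - by rewrite radicand_row// ler_pXn2r// ?nnegrE; exact: ltW.
  - by move=> j; rewrite tnth_mktuple mxE; exact: sphere_le1.
  - by split; rewrite ?radicandE untupK// -xz.
move=> x sx; have Mx : M x by case: sx => L _ [].
have [h|] := leP `|x 0 0| e; [by left | rewrite lter_normr => /orP[h|h]]; right.
  by left; exact: inpart.
right; exists (reflection *m x); last exact: reflectionK.
apply: inpart; last by rewrite reflection0.
by apply/reflect_facetsE; rewrite reflectionK.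
Qed.

Lemma spherical_packable (Q : set 'cV[R]_n.+1) (c : R) :
  polytope S Q -> (c%:E < vol S Q)%E -> packable S Q c.
Proof.
move=> pQ; have [s sn ->] := polytope_polyhedra pQ; rewrite vol_spherical.
move=> cQ; have [||c1 [c2 [q1 q2 c12]]] := ereal_split _ _ cQ; try exact: measure_ge0.
have P1 := packable_chart_part n_gt0 sn q1.
have P2 := packable_image reflection_isometry
  (packable_chart_part n_gt0 (reflect_facets_nonzero sn) q2).
have P12 := packableU _ P1 P2.
apply: packableS c12 (P12 _).
  move=> x [[]//|[y [sy _] <-]]; exact/reflect_facetsE.
apply/seteqP; split=> // x [[_ /= x0] [y [_ /= y0] yx]].
by move: x0; rewrite -yx reflection0; lra.
Qed.

End spherical.

End finish.

Theorem theoremF (R : realType) (n : nat) (n_ge1 : (1 <= n)%N) :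
  (forall P Q : set 'cV[R]_n.+1,
     polytope Hyperbolic P -> polytope Hyperbolic Q ->
     (vol Hyperbolic P < vol Hyperbolic Q)%E ->
     scissors_embeds Hyperbolic P Q) /\
  (forall P Q : set 'cV[R]_n.+1,
     polytope Spherical P -> polytope Spherical Q ->
     (vol Spherical P < vol Spherical Q)%E ->
     scissors_embeds Spherical P Q).
Proof.
split=> P Q pP pQ PQ.
  have vP : (0 <= vol Hyperbolic P)%E by rewrite /vol sheet_vol_chart measure_ge0.
  have [c Pc cQ] := ereal_between vP PQ.
  apply: (scissors_of_counts pP (hyperbolic_coverable n_ge1 pP Pc)).
  exact: hyperbolic_packable.
have vP : (0 <= vol Spherical P)%E.
  have [s _ ->] := polytope_polyhedra pP.
  by rewrite vol_spherical adde_ge0 ?measure_ge0.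
have [c Pc cQ] := ereal_between vP PQ.
apply: (scissors_of_counts pP (spherical_coverable n_ge1 pP Pc)).
exact: spherical_packable.
Qed.
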